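(* Let $k$ be a commutative ring and $\mathfrak g$ a Lie algebra over $k$. Let $\wedge^+\mathfrak g$ be the positive degree part of the Chevalley–Eilenberg complex $\wedge\mathfrak g$. Then $$\tau\,\psi=B\,\theta$$ as chain maps $\wedge^+\mathfrak g\to HN(U\mathfrak g)_{\mathrm{norm}}$. Hence the triangle formed by $\theta:\wedge^+\mathfrak g\to C^\lambda(U\mathfrak g)[-1]$, $B:C^\lambda(U\mathfrak g)[-1]\to HN(U\mathfrak g)_{\mathrm{norm}}$ and $c\circ e:\wedge^+\mathfrak g\to HN(U\mathfrak g)_{\mathrm{norm}}$ commutes up to natural chain homotopy; that is, $c\circ e$ and $B\circ\theta$ are naturally chain homotopic.
   Context: **Conventions.** For a chain complex $D$, $D[m]_n=D_{n+m}$ with differential $(-1)^md$. For a mixed complex $(M,b,B)$ (or the one associated to a cyclic module), $HN(M)_n=\prod_{j\ge0}M_{n+2j}$ with differential $b+B$; elements are written $(\dots,x_1,x_0)$, $x_j\in M_{n+2j}$. Cyclic operators are signed (Loday's convention); Connes' operator in degree $n$ is $(1-t)s'\sum_{i=0}^nt^i$ with $s'=(-1)^{n+1}ts_n$. The subscript norm denotes the quotient by degenerate elements. For an algebra $A$, $C(A)$ is the standard cyclic module, $C_n(A)=A^{\otimes n+1}$, $t(a_0\otimes\dots\otimes a_n)=(-1)^na_n\otimes a_0\otimes\dots\otimes a_{n-1}$; $HN(A)=HN(C(A))$; $C^\lambda(A)=\mathrm{coker}(1-t)$ with differential induced by the Hochschild boundary $b$. The chain map $B:C^\lambda(A)[-1]\to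 HN(A)$ is $B[x]=(\dots,0,0,Bx)$, with $B$ Connes' operator of $C(A)$; it is followed by $HN(A)\to HN(A)_{\mathrm{norm}}$. **Bar constructions.** Let $\mathsf H=U\mathfrak g$, a cocommutative Hopf algebra with antipode $S$ and counit $\epsilon$ (summationless Sweedler notation $\Delta h=h^{(0)}\otimes h^{(1)}$). $E_n(\mathsf H)=\mathsf H^{\otimes n+1}$, with $\mu_i$ ($i<n$) multiplying entries $i,i+1$, $\mu_n$ applying $\epsilon$ to the last entry, $s_j$ inserting $1$ after position $j$, $\partial'=\sum(-1)^i\mu_i$, $s(x)=1\otimes x$, and cyclic operator $t(h_0\otimes\dots\otimes h_n)=(-1)^nh_0h_1^{(0)}\cdots h_n^{(0)}\otimes S(h_1^{(1)}\cdots h_n^{(1)})\otimes h_1^{(2)}\otimes\dots\otimes h_{n-1}^{(2)}$ (identity for $n=0$); $B'$ is its Connes operator. $\mathrm B(\mathsf H)=k\otimes_{\mathsf H}E(\mathsf H)$, $\mathrm B_n(\mathsf H)=\mathsf H^{\otimes n}$, is the induced cyclic $k$-module, and $\mathrm M(\mathsf H)$ is its normalized mixed complex. **Maps.** $\tau:\mathrm B(\mathsf H)\to C(\mathsf H)$ is the cyclic module map $\tau(h_1\otimes\dots\otimes h_n)=S(h_1^{(0)}\cdots h_n^{(0)})\otimes h_1^{(1)}\otimes\dots\otimes h_n^{(1)}$ ($\tau_0$ is the unit $k\to\mathsf H$); it induces $\tau:HN(\mathrm M(\mathsf H))\to HN(\mathsf H)_{\mathrm{norm}}$. Define $\mathsf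 H$-linear $\Upsilon'^n:E_m(\mathsf H)\to E_{m+2n}(\mathsf H)$ by $\Upsilon'^0=1$ and, recursively in $m$, $\Upsilon'^{n+1}(h\otimes v)=h\cdot s\big((\Upsilon'^{n+1}\partial'-B'\Upsilon'^n)(1\otimes v)\big)$, $v\in\mathsf H^{\otimes m}$ (no $\partial'$ term if $m=0$). Put $\Upsilon=(\dots,1\otimes_{\mathsf H}\Upsilon'^1,\mathrm{id}):\mathrm B(\mathsf H)\to HN(\mathrm B(\mathsf H))$ and let $c:\mathrm B(\mathsf H)\to HN(\mathsf H)_{\mathrm{norm}}$ be $HN(\tau)\circ\Upsilon$ followed by $HN(\mathsf H)\to HN(\mathsf H)_{\mathrm{norm}}$. $\wedge\mathfrak g$ has $d(x_1\wedge\dots\wedge x_n)=\sum_{i<j}(-1)^{i+j}[x_i,x_j]\wedge x_1\wedge\cdots\widehat{x_i}\cdots\widehat{x_j}\cdots\wedge x_n$. The chain map $e:\wedge\mathfrak g\to\mathrm B(U\mathfrak g)$ is $e(x_1\wedge\dots\wedge x_n)=\sum_{\sigma\in\mathfrak S_n}\mathrm{sgn}(\sigma)x_{\sigma(1)}\otimes\dots\otimes x_{\sigma(n)}$; $\psi:\wedge\mathfrak g\to HN(\mathrm M(U\mathfrak g))$ is the chain map $\psi(x)=(\dots,0,0,e(x))$; and $\theta:\wedge^{n+1}\mathfrak g\to C^\lambda_n(U\mathfrak g)$ is $\theta(x_0\wedge\dots\wedge x_n)=$ class of $x_0\otimes e(x_1\wedge\dots\wedge x_n)$.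
   Formalization: θ is not well defined on ∧²g when 2 is not invertible (k=ℤ: x∧x=0 but the class of x⊗x in C^λ_1 is nonzero), so θ and Bθ are taken as functions of the family (x_0,…,x_n) and the equations are stated on the generators x_0∧…∧x_n. *)

(* Defs.v *)
From HB Require Import structures.
From mathcomp Require Import all_boot all_order all_algebra.
From mathcomp Require Import fingroup perm.
From mathcomp Require Import boolp zify.

Set Implicit Arguments.
Unset Strict Implicit.
Unset Printing Implicit Defensive.

Import GRing.Theory.
Local Open Scope ring_scope.

Lemma sig_eq T (P : T -> Prop) (x y : {t | P t}) : sval x = sval y -> x = y.
Proof.
by case: x y => [x p] [y q] /= e; case: y / e q => q; rewrite (Prop_irrelevance p q).
Qed.

Section LinearMaps.
Variable k : pzRingType.
Implicit Types U V W : lmodType k.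

Definition mklin V W (f : V -> W) (Hf : linear f) : {linear V -> W} :=
  let m := GRing.isLinear.Build k V W *:%R f Hf in HB.pack f m.

Lemma lcomp_linear U V W (g : {linear V -> W}) (f : {linear U -> V}) :
  linear (g \o f).
Proof. by move=> a x y /=; rewrite !linearP. Qed.
Definition lcomp U V W (g : {linear V -> W}) (f : {linear U -> V}) :=
  mklin (lcomp_linear g f).

Lemma lid_linear V : linear (@id V). Proof. by []. Qed.
Definition lid V : {linear V -> V} := mklin (@lid_linear V).

Lemma lzero_linear V W : linear (fun _ : V => 0 : W).
Proof. by move=> a x y; rewrite scaler0 addr0. Qed.
Definition lzero V W : {linear V -> W} := mklin (@lzero_linear V W).

Definition bilin U V W (f : U -> V -> W) : Prop :=
  (forall v, linear (f^~ v)) /\ (forall u, linear (f u)).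

End LinearMaps.

Lemma lscale_linear (k : comPzRingType) (V W : lmodType k) (a : k)
  (f : {linear V -> W}) : linear (fun x => a *: f x).
Proof. by move=> b x y; rewrite linearP scalerDr !scalerA mulrC. Qed.
Definition lscale (k : comPzRingType) (V W : lmodType k) (a : k)
  (f : {linear V -> W}) := mklin (lscale_linear a f).

(* The module with generators X and relations Rel.  A formal sum is a list   *)
(* of (coefficient, generator) pairs; two of them are identified when every  *)
(* map from X to a module that kills Rel takes the same value on both, i.e., *)
(* when they differ by an element of the submodule spanned by Rel.           *)
Section Presented.
Variables (k : pzRingType) (X : Type) (Rel : seq (k * X) -> Prop).

Definition ev (M : lmodType k) (f : X -> M) (l : seq (k * X)) : M :=
  \sum_(p <- l) p.1 *: f p.2.

Definition kills (M : lmodType k) (f : X -> M) : Prop :=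
  forall r, Rel r -> ev f r = 0.

Definition rel_eqv (l1 l2 : seq (k * X)) : Prop :=
  forall (M : lmodType k) (f : X -> M), kills f -> ev f l1 = ev f l2.

Definition pres : Type :=
  {C : seq (k * X) -> Prop | exists l, C = rel_eqv l}.

Definition pcl (l : seq (k * X)) : pres :=
  exist _ (rel_eqv l) (ex_intro _ l erefl).
Definition prep (x : pres) : seq (k * X) := projT1 (cid (projT2 x)).

Lemma prepK x : pcl (prep x) = x.
Proof. by apply: sig_eq; rewrite /prep /=; case: cid => l /= ->. Qed.

Lemma pclP l1 l2 : pcl l1 = pcl l2 <-> rel_eqv l1 l2.
Proof.
split=> [[e] | e].
  by have: rel_eqv l2 l2 by []; rewrite -{1}e.
apply: sig_eq; apply/funext => l; apply/propext; split => H M f Hf.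
  by rewrite -(e M f Hf) (H M f Hf).
by rewrite (e M f Hf) (H M f Hf).
Qed.

Lemma ev_prep (M : lmodType k) (f : X -> M) l :
  kills f -> ev f (prep (pcl l)) = ev f l.
Proof. by move=> Hf; have /pclP := prepK (pcl l); apply. Qed.

Definition pscale_seq (a : k) (l : seq (k * X)) :=
  [seq (a * p.1, p.2) | p <- l].

Lemma ev_cat (M : lmodType k) (f : X -> M) l1 l2 :
  ev f (l1 ++ l2) = ev f l1 + ev f l2.
Proof. by rewrite /ev big_cat. Qed.

Lemma ev_scale (M : lmodType k) (f : X -> M) a l :
  ev f (pscale_seq a l) = a *: ev f l.
Proof.
rewrite /ev big_map scaler_sumr; apply: eq_bigr => p _ /=.
by rewrite scalerA.
Qed.

Lemma ev_nil (M : lmodType k) (f : X -> M) : ev f [::] = 0.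
Proof. by rewrite /ev big_nil. Qed.

Definition padd (x y : pres) := pcl (prep x ++ prep y).
Definition popp (x : pres) := pcl (pscale_seq (-1) (prep x)).
Definition pscale (a : k) (x : pres) := pcl (pscale_seq a (prep x)).

HB.instance Definition _ := gen_eqMixin pres.
HB.instance Definition _ := gen_choiceMixin pres.

Let evE := (ev_cat, ev_scale, ev_prep, ev_nil).

Fact paddA : associative padd.
Proof. by move=> x y z; apply/pclP => M f H; rewrite !evE // addrA. Qed.
Fact paddC : commutative padd.
Proof. by move=> x y; apply/pclP => M f H; rewrite !evE // addrC. Qed.
Fact padd0 : left_id (pcl [::]) padd.
Proof.
move=> x; rewrite -[RHS]prepK; apply/pclP => M f H.
by rewrite !evE // add0r.
Qed.
Fact paddN : left_inverse (pcl [::]) popp padd.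
Proof. by move=> x; apply/pclP => M f H; rewrite !evE // scaleN1r addNr. Qed.

HB.instance Definition _ := GRing.isZmodule.Build pres paddA paddC padd0 paddN.

Fact pscaleA a b x : pscale a (pscale b x) = pscale (a * b) x.
Proof. by apply/pclP => M f H; rewrite !evE // scalerA. Qed.
Fact pscale1 : left_id 1 pscale.
Proof.
move=> x; rewrite -[RHS]prepK; apply/pclP => M f H.
by rewrite !evE // scale1r.
Qed.
Fact pscaleDr : right_distributive pscale +%R.
Proof. by move=> a x y; apply/pclP => M f H; rewrite !evE // scalerDr. Qed.
Fact pscaleDl x : {morph pscale^~ x : a b / a + b}.
Proof. by move=> a b; apply/pclP => M f H; rewrite !evE // scalerDl. Qed.

HB.instance Definition _ := GRing.Zmodule_isLmodule.Build k pres
  pscaleA pscale1 pscaleDr pscaleDl.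

Definition pgen (x : X) : pres := pcl [:: (1, x)].

Lemma ev_pgen l : ev pgen l = pcl l.
Proof.
elim: l => [|[a x] l IH]; first by rewrite ev_nil.
rewrite /ev big_cons -/(ev _ _) IH /=; apply/pclP => M f H.
by rewrite !evE // /ev !big_cons !big_nil /= scale1r addr0.
Qed.

Lemma pgen_kills : kills pgen.
Proof.
move=> r Hr; rewrite ev_pgen; apply/pclP => M f H.
by rewrite ev_nil H.
Qed.

Section Lift.
Variables (M : lmodType k) (f : X -> M) (Hf : kills f).
Fact plift_linear : linear (fun z : pres => ev f (prep z)).
Proof. by move=> a x y; rewrite !evE. Qed.
Definition plift : {linear pres -> M} := mklin plift_linear.
Lemma pliftE x : plift (pgen x) = f x.
Proof. by rewrite /= ev_prep // /ev big_seq1 scale1r. Qed.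
End Lift.

Lemma pres_ind (P : pres -> Prop) :
  P 0 -> (forall a x z, P z -> P (a *: pgen x + z)) -> forall z, P z.
Proof.
move=> P0 PD z; rewrite -(prepK z) -ev_pgen.
elim: (prep z) => [|[a x] l IH]; first by rewrite ev_nil.
by rewrite /ev big_cons; apply: PD.
Qed.

Lemma pres_ext (M : lmodType k) (F G : pres -> M) :
  linear F -> linear G -> (forall x, F (pgen x) = G (pgen x)) -> F =1 G.
Proof.
move=> HF HG H; have E : mklin HF =1 mklin HG; last by [].
elim/pres_ind => [|a x z IH]; first by rewrite !linear0.
by rewrite !linearP IH /= H.
Qed.

Lemma kills_pgen3 a x y z :
  Rel [:: (1, x); (- a, y); (-1, z)] -> pgen x = a *: pgen y + pgen z.
Proof.
move=> /pgen_kills; rewrite /ev !big_cons big_nil /= addr0 scale1r.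
by rewrite scaleN1r scaleNr -opprD => /eqP; rewrite subr_eq0 => /eqP.
Qed.

End Presented.

Lemma ev3 (k : pzRingType) X (M : lmodType k) (f : X -> M) a x y z :
  f x = a *: f y + f z -> ev f [:: (1, x); (- a, y); (-1, z)] = 0.
Proof.
rewrite /ev !big_cons big_nil /= addr0 scale1r scaleN1r scaleNr -opprD => ->.
by rewrite subrr.
Qed.

Section Quotient.
Variables (k : pzRingType) (V : lmodType k).

Inductive quot_rel (S : V -> Prop) : seq (k * V) -> Prop :=
| QuotLin a u v : quot_rel S [:: (1, a *: u + v); (- a, u); (-1, v)]
| QuotSub v : S v -> quot_rel S [:: (1, v)].

(* V modulo the submodule spanned by S. *)
Definition quot (S : V -> Prop) : lmodType k := pres (quot_rel S).

Fact qproj_linear S : linear (fun v => pgen (quot_rel S) v : quot S).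
Proof. by move=> a u v; apply: kills_pgen3; constructor. Qed.
Definition qproj S : {linear V -> quot S} := mklin (@qproj_linear S).

Lemma qproj_surj S (z : quot S) : exists v, qproj S v = z.
Proof.
exists (ev id (prep z)); rewrite -[RHS]prepK -ev_pgen /ev linear_sum.
by apply: eq_bigr => p _; rewrite linearZ.
Qed.
Definition qrep S (z : quot S) : V := projT1 (cid (qproj_surj z)).
Lemma qrepK S (z : quot S) : qproj S (qrep z) = z.
Proof. by rewrite /qrep; case: cid. Qed.
End Quotient.
Arguments qproj {k V} S.

(* The map induced on quotients by an f sending the span of S into the span  *)
(* of T (it is only used for such f), computed on a representative.          *)
Definition qmap (k : pzRingType) (V W : lmodType k) (S : V -> Prop)
  (T : W -> Prop) (f : V -> W) (z : quot S) : quot T := qproj T (f (qrep z)).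

Section Tensor.
Variable k : comPzRingType.
Implicit Types U V W M : lmodType k.

Inductive tens_rel V W : seq (k * (V * W)) -> Prop :=
| TensL a v v' w :
    tens_rel [:: (1, (a *: v + v', w)); (- a, (v, w)); (-1, (v', w))]
| TensR a v w w' :
    tens_rel [:: (1, (v, a *: w + w')); (- a, (v, w)); (-1, (v, w'))].

Definition tens V W : lmodType k := pres (@tens_rel V W).

Definition tpair V W (v : V) (w : W) : tens V W := pgen (@tens_rel V W) (v, w).

Lemma tpair_bilin V W : bilin (@tpair V W).
Proof.
by split=> [w a v v' | v a w w']; apply: kills_pgen3; constructor.
Qed.

Section Lift.
Variables (V W M : lmodType k) (f : V -> W -> M) (Hf : bilin f).
Fact tlift_kills : kills (@tens_rel V W) (fun p => f p.1 p.2).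
Proof.
by move=> r [] *; apply: ev3; rewrite /= ?(proj1 Hf) ?(proj2 Hf).
Qed.
Definition tlift : {linear tens V W -> M} := plift tlift_kills.
Lemma tliftE v w : tlift (tpair v w) = f v w.
Proof. exact: pliftE. Qed.
End Lift.

Lemma tens_ind V W (P : tens V W -> Prop) :
  P 0 -> (forall a v w z, P z -> P (a *: tpair v w + z)) -> forall z, P z.
Proof. by move=> P0 PD; apply: pres_ind => // a [v w] z; apply: PD. Qed.

Lemma tens_ext V W M (F G : {linear tens V W -> M}) :
  (forall v w, F (tpair v w) = G (tpair v w)) -> F =1 G.
Proof. by move=> H; apply: pres_ext; try exact: linearP; case. Qed.

Lemma tmap_bilin V W V' W' (f : {linear V -> V'}) (g : {linear W -> W'}) :
  bilin (fun v w => tpair (f v) (g w)).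
Proof.
by split=> [w a v v' | v a w w'];
  rewrite linearP ?(proj1 (tpair_bilin _ _)) ?(proj2 (tpair_bilin _ _)).
Qed.
Definition tmap V W V' W' (f : {linear V -> V'}) (g : {linear W -> W'}) :
  {linear tens V W -> tens V' W'} := tlift (tmap_bilin f g).
Lemma tmapE V W V' W' (f : {linear V -> V'}) (g : {linear W -> W'}) v w :
  tmap f g (tpair v w) = tpair (f v) (g w).
Proof. exact: tliftE. Qed.

Definition tpairl V W (v : V) : {linear W -> tens V W} :=
  mklin (proj2 (tpair_bilin V W) v).

Lemma tlift_param U V W M (f : U -> V -> W -> M) (Hf : forall u, bilin (f u)) :
  (forall v w, linear (fun u => f u v w)) ->
  forall z, linear (fun u => tlift (Hf u) z).
Proof.
move=> H z a u u'; elim/tens_ind: z => [|b v w z IH].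
  by rewrite !linear0 addr0.
rewrite !linearP !tliftE H IH !scalerDr !scalerA [b * a]mulrC.
by rewrite -!addrA; congr (_ + _); rewrite addrCA.
Qed.

Lemma tmap_linl U V W V' W' (f : U -> {linear V -> V'}) (g : {linear W -> W'}) :
  (forall v, linear (fun u => f u v)) ->
  forall z, linear (fun u => tmap (f u) g z).
Proof.
move=> H; apply: tlift_param => v w a u u' /=.
by rewrite H (proj1 (tpair_bilin _ _)).
Qed.

Lemma tmap_linr U V W V' W' (f : {linear V -> V'}) (g : U -> {linear W -> W'}) :
  (forall w, linear (fun u => g u w)) ->
  forall z, linear (fun u => tmap f (g u) z).
Proof.
move=> H; apply: tlift_param => v w a u u' /=.
by rewrite H (proj2 (tpair_bilin _ _)).
Qed.

Fixpoint tpow V n : lmodType k :=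
  if n is n'.+1 then tens V (tpow V n') else k^o.

Fixpoint tpure V n : ('I_n -> V) -> tpow V n :=
  match n with
  | 0 => fun _ => (1 : k^o)
  | n'.+1 => fun v => tpair (v ord0) (tpure (fun i => v (lift ord0 i)))
  end.

Fixpoint tpowmap V W (f : {linear V -> W}) n : {linear tpow V n -> tpow W n} :=
  match n with
  | 0 => lid _
  | n'.+1 => tmap f (tpowmap f n')
  end.

(* v ⊗ (w ⊗ z) |-> w ⊗ (v ⊗ z) *)
Lemma tswap_bilin U V W :
  bilin (fun (u : U) (z : tens V W) => tmap (lid V) (tpairl W u) z).
Proof.
split=> [z | u]; last exact: linearP.
by apply: tmap_linr => w; apply: (proj1 (tpair_bilin _ _)).
Qed.
Definition tswap U V W : {linear tens U (tens V W) -> tens V (tens U W)} :=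
  tlift (tswap_bilin U V W).

(* v_0 ⊗ ... ⊗ v_n |-> v_n ⊗ v_0 ⊗ ... ⊗ v_(n-1) *)
Fixpoint trot V n : {linear tpow V n.+1 -> tpow V n.+1} :=
  match n with
  | 0 => lid _
  | n'.+1 => lcomp (tswap V V (tpow V n')) (tmap (lid V) (trot V n'))
  end.

End Tensor.
Arguments tpairl {k V} W v.

(* The data of a cyclic module: faces d_0, ..., d_(n+1) from degree n+1,     *)
(* degeneracies s_0, ..., s_n from degree n (other indices are not used),    *)
(* and signed cyclic operators t.                                            *)
Record cycData (k : comPzRingType) := CycData {
  cyc_ob :> nat -> lmodType k;
  cyc_d : forall n, nat -> {linear cyc_ob n.+1 -> cyc_ob n};
  cyc_s : forall n, nat -> {linear cyc_ob n -> cyc_ob n.+1};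
  cyc_t : forall n, {linear cyc_ob n -> cyc_ob n} }.

(* The data of a mixed complex. *)
Record mixData (k : comPzRingType) := MixData {
  mix_ob :> nat -> lmodType k;
  mix_b : forall n, mix_ob n.+1 -> mix_ob n;
  mix_B : forall n, mix_ob n -> mix_ob n.+1 }.

Section Cyclic.
Variables (k : comPzRingType) (X : cycData k).

Fact bdry_linear n : linear (fun x : X n.+1 =>
  \sum_(i < n.+2) (-1) ^+ i *: cyc_d X n i x).
Proof.
move=> a x y; rewrite scaler_sumr -big_split; apply: eq_bigr => i _ /=.
by rewrite linearP scalerDr !scalerA mulrC.
Qed.
Definition bdry n : {linear X n.+1 -> X n} := mklin (@bdry_linear n).

Fact cnorm_linear n :
  linear (fun x : X n => \sum_(i < n.+1) iter i (cyc_t X n) x).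
Proof.
move=> a x y; rewrite scaler_sumr -big_split; apply: eq_bigr => i _ /=.
by elim: (i : nat) => [//|j IH] /=; rewrite IH linearP.
Qed.
Definition cnorm n : {linear X n -> X n} := mklin (@cnorm_linear n).

Definition extra n : {linear X n -> X n.+1} :=
  lscale ((-1) ^+ n.+1) (lcomp (cyc_t X n.+1) (cyc_s X n n)).

Fact connes_linear n : linear (fun x : X n =>
  extra n (cnorm n x) - cyc_t X n.+1 (extra n (cnorm n x))).
Proof.
move=> a x y; rewrite (linearP (cnorm n)) (linearP (extra n)) (linearP (cyc_t X n.+1)).
by rewrite scalerBr opprD addrACA.
Qed.
Definition connes n : {linear X n -> X n.+1} := mklin (@connes_linear n).

Definition mixed : mixData k := MixData bdry connes.

Definition degenerate n : X n -> Prop :=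
  match n with
  | 0 => fun _ => False
  | n'.+1 => fun x => exists j y, (j <= n')%N /\ x = cyc_s X n' j y
  end.

Definition normalized : mixData k :=
  @MixData k (fun n => quot (@degenerate n))
    (fun n => @qmap _ _ _ (@degenerate n.+1) (@degenerate n) (bdry n))
    (fun n => @qmap _ _ _ (@degenerate n) (@degenerate n.+1) (connes n)).

End Cyclic.

Section ProductModule.
Variables (k : pzRingType) (F : nat -> lmodType k).
Definition pprod : Type := forall j, F j.
HB.instance Definition _ := gen_eqMixin pprod.
HB.instance Definition _ := gen_choiceMixin pprod.
Let zero : pprod := fun=> 0.
Let opp (x : pprod) : pprod := fun j => - x j.
Let add (x y : pprod) : pprod := fun j => x j + y j.
Let scale a (x : pprod) : pprod := fun j => a *: x j.
Fact pprod_addA : associative add.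
Proof. by move=> x y z; apply/functional_extensionality_dep => j; apply: addrA. Qed.
Fact pprod_addC : commutative add.
Proof. by move=> x y; apply/functional_extensionality_dep => j; apply: addrC. Qed.
Fact pprod_add0 : left_id zero add.
Proof. by move=> x; apply/functional_extensionality_dep => j; apply: add0r. Qed.
Fact pprod_addN : left_inverse zero opp add.
Proof. by move=> x; apply/functional_extensionality_dep => j; apply: addNr. Qed.
HB.instance Definition _ :=
  GRing.isZmodule.Build pprod pprod_addA pprod_addC pprod_add0 pprod_addN.
Fact pprod_scaleA a b x : scale a (scale b x) = scale (a * b) x.
Proof. by apply/functional_extensionality_dep => j; apply: scalerA. Qed.
Fact pprod_scale1 : left_id 1 scale.
Proof. by move=> x; apply/functional_extensionality_dep => j; apply: scale1r. Qed.
Fact pprod_scaleDr : right_distributive scale +%R.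
Proof. by move=> a x y; apply/functional_extensionality_dep => j; apply: scalerDr. Qed.
Fact pprod_scaleDl x : {morph scale^~ x : a b / a + b}.
Proof. by move=> a b; apply/functional_extensionality_dep => j; apply: scalerDl. Qed.
HB.instance Definition _ := GRing.Zmodule_isLmodule.Build k pprod
  pprod_scaleA pprod_scale1 pprod_scaleDr pprod_scaleDl.
End ProductModule.

Section NegativeCyclic.
Variable k : comPzRingType.
Implicit Type M : mixData k.

(* Only the degrees n >= 0 are needed.  The j-th component has degree n+2j.  *)
Definition HN M n : lmodType k := pprod (fun j => M (j.*2 + n)%N).

(* Identification of degrees 2j+(n+1) = (2j+n)+1. *)
Definition HNshift M n (x : HN M n.+1) (j : nat) : M (j.*2 + n).+1 :=
  ecast m (M m) (addnS j.*2 n) (x j).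

Definition HNd M n (x : HN M n.+1) : HN M n := fun j =>
  mix_b (HNshift x j) +
  match j return M (j.*2 + n)%N with
  | 0 => 0
  | i.+1 => mix_B (HNshift x i)
  end.

(* (..., 0, 0, y) *)
Definition HNsingle M n (y : M n) : HN M n := fun j =>
  match j return M (j.*2 + n)%N with
  | 0 => y
  | i.+1 => 0
  end.

Definition HNmap M M' (f : forall n, M n -> M' n) n (x : HN M n) : HN M' n :=
  fun j => f _ (x j).

Definition HNnorm (X : cycData k) n :
    HN (mixed X) n -> HN (normalized X) n :=
  @HNmap (mixed X) (normalized X) (fun m => qproj (@degenerate k X m)) n.

End NegativeCyclic.

(* Associative unital k-algebras.  The library's algType is not used because *)
(* it excludes the zero algebra, hence the zero ground ring.                 *)
HB.mixin Record isAssocAlgebra (k : comPzRingType) A of GRing.Lmodule k A := {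
  aone : A;
  amul : A -> A -> A;
  amulA : associative amul;
  amul1l : left_id aone amul;
  amul1r : right_id aone amul;
  amul_bilin : bilin amul }.
#[short(type="assocAlgType")]
HB.structure Definition AssocAlgebra (k : comPzRingType) :=
  {A of GRing.Lmodule k A & isAssocAlgebra k A}.
Arguments aone {k}.
Arguments amul {k s}.

Section CyclicModuleOfAlgebra.
Variables (k : comPzRingType) (A : assocAlgType k).

Definition lmul (a : A) : {linear A -> A} := mklin (proj2 (@amul_bilin k A) a).
Definition rmul (a : A) : {linear A -> A} := mklin (proj1 (@amul_bilin k A) a).

Lemma lmul_lin b : linear (fun a => lmul a b).
Proof. exact: (proj1 (@amul_bilin k A)). Qed.

(* a ⊗ (b ⊗ w) |-> ab ⊗ w *)
Lemma tact_bilin (W : lmodType k) :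
  bilin (fun (a : A) (z : tens A W) => tmap (lmul a) (lid W) z).
Proof.
split=> [z | a]; last exact: linearP.
by apply: tmap_linl => b; apply: lmul_lin.
Qed.
Definition tact (W : lmodType k) : {linear tens A (tens A W) -> tens A W} :=
  tlift (tact_bilin W).

(* Multiplies the entries i and i+1 (i <= n, counted from 0). *)
Fixpoint tmul n i : {linear tpow A n.+2 -> tpow A n.+1} :=
  match i, n with
  | 0, _ => tact (tpow A n)
  | i'.+1, 0 => lzero _ _
  | i'.+1, n'.+1 => tmap (lid A) (tmul n' i')
  end.

(* Inserts 1 after the first j entries (j <= n). *)
Fixpoint tins n j : {linear tpow A n -> tpow A n.+1} :=
  match j, n with
  | 0, _ => tpairl (tpow A n) (aone A)
  | j'.+1, 0 => lzero _ _
  | j'.+1, n'.+1 => tmap (lid A) (tins n' j')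
  end.

Definition Ccyc : cycData k := @CycData k (fun n => tpow A n.+1)
  (fun n i => if (i <= n)%N then tmul n i
              else lcomp (tmul n 0) (trot A n.+1))
  (fun n j => tins n.+1 j.+1)
  (fun n => lscale ((-1) ^+ n) (trot A n)).

Definition Clambda n : lmodType k :=
  quot (fun x : Ccyc n => exists y, x = y - cyc_t Ccyc n y).

(* B[x] = (..., 0, 0, Bx) *)
Definition Blambda n (z : Clambda n) : HN (mixed Ccyc) n.+1 :=
  @HNsingle k (mixed Ccyc) n.+1 (connes Ccyc n (qrep z)).

End CyclicModuleOfAlgebra.

(* Bar constructions; H, Delta, eps, S stand for a cocommutative Hopf        *)
(* algebra with its comultiplication, counit and antipode.                   *)
Section Bar.
Variables (k : comPzRingType) (H : assocAlgType k).
Variables (Delta : {linear H -> tens H H}) (eps : {linear H -> k^o}).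
Variable S : {linear H -> H}.

(* (a ⊗ b) (p ⊗ u) |-> ap ⊗ (b ⊗ u) *)
Lemma sw2_bilin (U : lmodType k) (z : tens H U) :
  bilin (fun a b : H => tmap (lmul a) (tpairl U b) z).
Proof.
split=> [b | a].
  by apply: tmap_linl => p; apply: lmul_lin.
by apply: tmap_linr => u; apply: (proj1 (tpair_bilin _ _)).
Qed.
Lemma sw2_step_bilin (U V : lmodType k) (f : {linear V -> tens H U}) :
  bilin (fun (h : H) (w : V) => tlift (sw2_bilin (f w)) (Delta h)).
Proof.
split=> [w | h]; first by move=> a x y; rewrite !linearP.
apply: (tlift_param (fun w => sw2_bilin (f w))) => p q a x y.
by rewrite !linearP.
Qed.

(* h_1 ⊗ ... ⊗ h_n |->                                                       *)
(*   h_1^(0) ... h_n^(0) ⊗ (h_1^(1) ⊗ ... ⊗ h_n^(1))                         *)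
Fixpoint sw2 n : {linear tpow H n -> tens H (tpow H n)} :=
  match n with
  | 0 => tpairl k^o (aone H)
  | n'.+1 => tlift (sw2_step_bilin (sw2 n'))
  end.

(* (a ⊗ (b ⊗ c)) (p ⊗ (q ⊗ u)) |-> ap ⊗ (bq ⊗ (c ⊗ u)) *)
Lemma sw3_bilin1 (U : lmodType k) (z : tens H (tens H U)) (a : H) :
  bilin (fun b c : H => tmap (lmul a) (tmap (lmul b) (tpairl U c)) z).
Proof.
split=> [c | b].
  by apply: tmap_linr => p; apply: tmap_linl => q; apply: lmul_lin.
by apply: tmap_linr => p; apply: tmap_linr => u; apply: (proj1 (tpair_bilin _ _)).
Qed.
Lemma sw3_bilin2 (U : lmodType k) (z : tens H (tens H U)) :
  bilin (fun (a : H) y => tlift (sw3_bilin1 z a) y).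
Proof.
split=> [y | a]; last exact: linearP.
apply: tlift_param => b c; apply: tmap_linl => p; exact: lmul_lin.
Qed.
Lemma sw3_step_bilin (U V : lmodType k) (f : {linear V -> tens H (tens H U)}) :
  bilin (fun (h : H) (w : V) =>
    tlift (sw3_bilin2 (f w)) (tmap (lid H) Delta (Delta h))).
Proof.
split=> [w | h]; first by move=> a x y; rewrite !linearP.
apply: (tlift_param (fun w => sw3_bilin2 (f w))) => p.
apply: (tlift_param (fun w => sw3_bilin1 (f w) p)) => q r a x y.
by rewrite !linearP.
Qed.

(* h_1 ⊗ ... ⊗ h_n ⊗ h_(n+1) |->                                             *)
(*   h_1^(0) ... h_(n+1)^(0) ⊗                                               *)
(*     (h_1^(1) ... h_(n+1)^(1) ⊗ (h_1^(2) ⊗ ... ⊗ h_n^(2)));                *)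
(* the last entry is only split in two.                                      *)
Lemma sw3_last_bilin :
  bilin (fun (h : H) (c : tpow H 0) =>
    tmap (lid H) (mklin (proj1 (tpair_bilin H (tpow H 0)) c)) (Delta h)).
Proof.
split=> [c | h]; first by move=> a x y; rewrite !linearP.
by apply: tmap_linr => p; apply: (proj2 (tpair_bilin _ _)).
Qed.
Fixpoint sw3 n : {linear tpow H n.+1 -> tens H (tens H (tpow H n))} :=
  match n with
  | 0 => tlift sw3_last_bilin
  | n'.+1 => tlift (sw3_step_bilin (sw3 n'))
  end.

(* Applies eps to the last, resp. first, entry. *)
Lemma epslast0_bilin : bilin (fun (h : H) (c : tpow H 0) => eps h * c : k^o).
Proof.
split=> [c a x y | h a x y]; first by rewrite linearP mulrDl -mulrA.
by rewrite mulrDr /GRing.scale /= mulrCA.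
Qed.
Fixpoint epslast n : {linear tpow H n.+1 -> tpow H n} :=
  match n with
  | 0 => tlift epslast0_bilin
  | n'.+1 => tmap (lid H) (epslast n')
  end.

Lemma epshead_bilin (W : lmodType k) : bilin (fun (h : H) (w : W) => (eps h : k) *: w).
Proof.
split=> [w a x y | h a x y].
  by rewrite linearP scalerDl -scalerA.
by rewrite scalerDr !scalerA mulrC.
Qed.
Definition epshead (W : lmodType k) : {linear tens H W -> W} :=
  tlift (epshead_bilin W).

(* t (h_0 ⊗ v) for v in degree n+1, without the sign. *)
Lemma Et_bilin n : bilin (fun (h : H) (v : tpow H n.+1) =>
  tmap (lmul h) (tmap S (lid (tpow H n))) (sw3 n v)).
Proof.
split=> [v | h]; last by move=> a x y; rewrite !linearP.
by apply: tmap_linl => p; apply: lmul_lin.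
Qed.
Definition Et n : {linear tpow H n.+1 -> tpow H n.+1} :=
  match n with
  | 0 => lid _
  | n'.+1 => lscale ((-1) ^+ n'.+1) (tlift (Et_bilin n'))
  end.

Definition Ecyc : cycData k := @CycData k (fun n => tpow H n.+1)
  (fun n i => if (i <= n)%N then tmul H n i else epslast n.+1)
  (fun n j => tins H n.+1 j.+1)
  Et.

(* For an H-linear f : E_m(H) -> E_n(H), the map 1 ⊗_H f on                  *)
(* k ⊗_H E_m(H) = H^⊗m; H acts on the first entry of E_m(H).                 *)
Definition coinv m n (f : {linear tpow H m.+1 -> tpow H n.+1}) :
    {linear tpow H m -> tpow H n} :=
  lcomp (epshead _) (lcomp f (tpairl (tpow H m) (aone H))).

Definition Bcyc : cycData k := @CycData k (fun n => tpow H n)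
  (fun n i => @coinv n.+1 n (cyc_d Ecyc n i))
  (fun n j => @coinv n n.+1 (cyc_s Ecyc n j))
  (fun n => @coinv n n (cyc_t Ecyc n)).

Definition MH : mixData k := normalized Bcyc.

Definition tau n : {linear Bcyc n -> Ccyc H n} :=
  lcomp (tmap S (lid (tpow H n))) (sw2 n).

Definition tau_HN n : HN (mixed Bcyc) n -> HN (mixed (Ccyc H)) n :=
  @HNmap k (mixed Bcyc) (mixed (Ccyc H)) tau n.

Definition tau_HN_norm n : HN MH n -> HN (normalized (Ccyc H)) n :=
  @HNmap k MH (normalized (Ccyc H))
    (fun m => @qmap _ _ _ (@degenerate k Bcyc m) (@degenerate k (Ccyc H) m)
                (tau m)) n.

(* The H-linear map h ⊗ v |-> h . f(v). *)
Lemma hlin_bilin m n (f : {linear tpow H m -> tpow H n.+1}) :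
  bilin (fun (h : H) (v : tpow H m) => tmap (lmul h) (lid (tpow H n)) (f v)).
Proof.
split=> [v | h]; last by move=> a x y; rewrite !linearP.
by apply: tmap_linl => p; apply: lmul_lin.
Qed.
Definition hlin m n (f : {linear tpow H m -> tpow H n.+1}) :
    {linear tpow H m.+1 -> tpow H n.+1} := tlift (hlin_bilin f).

Definition Es n : {linear Ecyc n -> Ecyc n.+1} := tpairl (tpow H n.+1) (aone H).

Lemma Ups_step_linear m n (f g : {linear Ecyc m -> Ecyc n}) :
  linear (fun v : tpow H m =>
    Es n (f (tpair (aone H) v) - g (tpair (aone H) v))).
Proof.
move=> a x y; rewrite (proj2 (tpair_bilin _ _)).
by rewrite (linearP f) (linearP g) opprD addrACA -scalerBr (linearP (Es n)).
Qed.

Definition Ecast n p (e : n = p) : {linear Ecyc n -> Ecyc p} :=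
  ecast q {linear Ecyc n -> Ecyc q} e (lid (Ecyc n)).

(* The step from Upsilon'^j (prev) to Upsilon'^(j+1), by recursion on m;     *)
(* Ecast identifies the degrees 2(j+1)+m = 2j+(m+1)+1.                       *)
Fixpoint Ups_succ j (prev : forall m, {linear Ecyc m -> Ecyc (j.*2 + m)%N}) m :
    {linear Ecyc m -> Ecyc (j.*2 + m).+2} :=
  match m with
  | 0 => @hlin 0 (j.*2 + 0).+2 (mklin (@Ups_step_linear 0 (j.*2 + 0).+1
           (lzero _ _) (lcomp (connes Ecyc (j.*2 + 0)) (prev 0))))
  | m'.+1 => @hlin m'.+1 (j.*2 + m'.+1).+2 (mklin (@Ups_step_linear m'.+1 (j.*2 + m'.+1).+1
           (lcomp (Ecast (congr1 succn (esym (addnS j.*2 m'))))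
              (lcomp (Ups_succ prev m') (bdry Ecyc m')))
           (lcomp (connes Ecyc (j.*2 + m'.+1)) (prev m'.+1))))
  end.

Fixpoint Ups' j : forall m, {linear Ecyc m -> Ecyc (j.*2 + m)%N} :=
  match j with
  | 0 => fun m => lid (Ecyc m)
  | j'.+1 => Ups_succ (Ups' j')
  end.

Definition Ups n (x : Bcyc n) : HN (mixed Bcyc) n := fun j => @coinv n (j.*2 + n) (Ups' j n) x.

Definition cmap n (x : Bcyc n) : HN (normalized (Ccyc H)) n :=
  HNnorm (tau_HN (Ups x)).

End Bar.

HB.mixin Record isLieAlgebra (k : comPzRingType) g of GRing.Lmodule k g := {
  bracket : g -> g -> g;
  bracket_bilin : bilin bracket;
  bracketxx : forall x, bracket x x = 0;
  jacobi : forall x y z,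
    bracket x (bracket y z) + bracket y (bracket z x)
      + bracket z (bracket x y) = 0 }.
#[short(type="lieAlgType")]
HB.structure Definition LieAlgebra (k : comPzRingType) :=
  {g of GRing.Lmodule k g & isLieAlgebra k g}.
Arguments bracket {k s}.

Record lieHom (k : comPzRingType) (g g' : lieAlgType k) := LieHom {
  lie_fun :> {linear g -> g'};
  lie_funP : forall x y, lie_fun (bracket x y) = bracket (lie_fun x) (lie_fun y) }.

(* U(g): the words in g modulo multilinearity and xy - yx = [x,y].           *)
Section Enveloping.
Variables (k : comPzRingType) (g : lieAlgType k).

Inductive ug_rel : seq (k * seq g) -> Prop :=
| UgLin a x y u w : ug_rel
    [:: (1, u ++ (a *: x + y) :: w); (- a, u ++ x :: w); (-1, u ++ y :: w)]
| UgLie x y u w : ug_rel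
    [:: (1, u ++ x :: y :: w); (-1, u ++ y :: x :: w);
        (-1, u ++ bracket x y :: w)].

Definition Ug : Type := pres ug_rel.
HB.instance Definition _ := GRing.Lmodule.on Ug.

Definition uword (w : seq g) : Ug := pgen ug_rel w.

Lemma uword_lin a x y u w :
  uword (u ++ (a *: x + y) :: w) = a *: uword (u ++ x :: w) + uword (u ++ y :: w).
Proof. by apply: kills_pgen3; constructor. Qed.

Lemma uword_lie x y u w : uword (u ++ x :: y :: w) =
  uword (u ++ y :: x :: w) + uword (u ++ bracket x y :: w).
Proof.
by rewrite -[uword (u ++ y :: _)]scale1r; apply: kills_pgen3; constructor.
Qed.

Lemma ug_kills (N : lmodType k) (f : seq g -> N) :
  (forall a x y u w,
     f (u ++ (a *: x + y) :: w) = a *: f (u ++ x :: w) + f (u ++ y :: w)) ->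
  (forall x y u w, f (u ++ x :: y :: w) =
     f (u ++ y :: x :: w) + f (u ++ bracket x y :: w)) ->
  kills ug_rel f.
Proof.
move=> H1 H2 r [] *; apply: ev3; first exact: H1.
by rewrite scale1r; apply: H2.
Qed.

Lemma umul_kills1 (u : seq g) : kills ug_rel (fun v => uword (u ++ v)).
Proof.
apply: ug_kills => [a x y v w | x y v w]; rewrite !(catA u v).
  exact: uword_lin.
exact: uword_lie.
Qed.
Lemma umul_kills2 (q : Ug) : kills ug_rel (fun u => plift (umul_kills1 u) q).
Proof.
apply: ug_kills => [a x y u w | x y u w]; elim/pres_ind: q => [|b v z IH].
- by rewrite !linear0 addr0.
- rewrite !linearP !pliftE IH -!catA !cat_cons uword_lin.
  rewrite !scalerDr !scalerA [b * a]mulrC.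
  by rewrite -!addrA; congr (_ + _); rewrite addrCA.
- by rewrite !linear0 addr0.
rewrite !linearP !pliftE IH -!catA !cat_cons uword_lie !scalerDr.
by rewrite -!addrA; congr (_ + _); rewrite addrCA.
Qed.

Definition umul (p q : Ug) : Ug := plift (umul_kills2 q) p.

Lemma umulE u v : umul (uword u) (uword v) = uword (u ++ v).
Proof. by rewrite /umul !pliftE. Qed.

Fact umul_bilin : bilin umul.
Proof.
split=> [q | p]; first exact: linearP.
move=> a x y; rewrite /umul; elim/pres_ind: p => [|b u z IH].
  by rewrite !linear0 addr0.
rewrite !linearP !pliftE IH linearP !scalerDr !scalerA [b * a]mulrC.
by rewrite -!addrA; congr (_ + _); rewrite addrCA.
Qed.

Let umull q := mklin (proj1 umul_bilin q).
Let umulr p := mklin (proj2 umul_bilin p).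

Fact umulA : associative umul.
Proof.
move=> x y z; pose f := umulr x; pose f' := umull z.
apply: (@pres_ext _ _ _ _ (lcomp (umulr x) (umulr y)) (umulr (umul x y)));
  try exact: linearP; move=> w /= {z f f'}.
apply: (@pres_ext _ _ _ _ (lcomp (umulr x) (umull (uword w)))
  (lcomp (umull (uword w)) (umulr x))); try exact: linearP; move=> v /=.
apply: (@pres_ext _ _ _ _ (umull (umul (uword v) (uword w)))
  (lcomp (umull (uword w)) (umull (uword v)))); try exact: linearP.
by move=> u /=; rewrite !umulE catA.
Qed.

Fact umul1l : left_id (uword [::]) umul.
Proof.
apply: (@pres_ext _ _ _ _ (umulr (uword [::])) (lid _)); try exact: linearP.
by move=> w /=; rewrite umulE.
Qed.

Fact umul1r : right_id (uword [::]) umul.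
Proof.
apply: (@pres_ext _ _ _ _ (umull (uword [::])) (lid _)); try exact: linearP.
by move=> w /=; rewrite umulE cats0.
Qed.

HB.instance Definition _ :=
  isAssocAlgebra.Build k Ug umulA umul1l umul1r umul_bilin.

Fact uinj_linear : linear (fun x : g => uword [:: x]).
Proof. by move=> a x y; apply: (uword_lin a x y [::] [::]). Qed.
Definition uinj : {linear g -> Ug} := mklin uinj_linear.

Lemma uinj_bracket x y :
  amul (uinj x) (uinj y) = amul (uinj y) (uinj x) + uinj (bracket x y).
Proof. by rewrite /amul /= !umulE; apply: (uword_lie x y [::] [::]). Qed.

(* For an action phi of g on N, the map U(g) -> N sending x_1 ... x_n to     *)
(* phi x_1 (... (phi x_n n0)).                                               *)
Section Act.
Variables (N : lmodType k) (phi : g -> N -> N) (n0 : N).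
Hypotheses (Hphi : bilin phi) (Hlie : forall x y z,
  phi x (phi y z) = phi y (phi x z) + phi (bracket x y) z).
Fact uact_kills : kills ug_rel (foldr phi n0).
Proof.
apply: ug_kills => [a x y u w | x y u w]; elim: u => [|b u IH] /=.
- exact: (proj1 Hphi).
- by rewrite IH (proj2 Hphi).
- exact: Hlie.
rewrite IH; exact: (linearD (mklin (proj2 Hphi b))).
Qed.
Definition uact : {linear Ug -> N} := plift uact_kills.
Lemma uactE w : uact (uword w) = foldr phi n0 w.
Proof. exact: pliftE. Qed.
End Act.

(* Delta is the algebra map with x |-> x ⊗ 1 + 1 ⊗ x for x in g: a word xw   *)
(* goes to (x ⊗ 1 + 1 ⊗ x) Delta(w).                                         *)
Definition udelta_act (x : g) (z : tens Ug Ug) : tens Ug Ug :=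
  tmap (lmul (uinj x)) (lid Ug) z + tmap (lid Ug) (lmul (uinj x)) z.
Lemma udelta_bilin : bilin udelta_act.
Proof.
have H y : linear (fun x : g => lmul (uinj x) y).
  by move=> a x x'; rewrite linearP lmul_lin.
split=> [z a x y | x a z z']; rewrite /udelta_act.
  rewrite (tmap_linl _ H) (tmap_linr _ H) scalerDr.
  by rewrite -!addrA; congr (_ + _); rewrite addrCA.
rewrite (linearP (tmap (lmul _) _)) (linearP (tmap (lid _) _)) scalerDr.
by rewrite -!addrA; congr (_ + _); rewrite addrCA.
Qed.

Lemma bilin_scaleD (U V W : lmodType k) (f : U -> V -> W) : bilin f ->
  (forall a u u' v, f (a *: u + u') v = a *: f u v + f u' v) *
  (forall a u v v', f u (a *: v + v') = a *: f u v + f u v') *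
  (forall u u' v, f (u + u') v = f u v + f u' v) *
  (forall u v v', f u (v + v') = f u v + f u v').
Proof.
case=> Hl Hr; split; [split; [split|]|].
- by move=> a u u' v; apply: Hl.
- by move=> a u v v'; apply: Hr.
- by move=> u u' v; apply: (linearD (mklin (Hl v))).
by move=> u v v'; apply: (linearD (mklin (Hr u))).
Qed.

Lemma udelta_lie x y z : udelta_act x (udelta_act y z) =
  udelta_act y (udelta_act x z) + udelta_act (bracket x y) z.
Proof.
elim/tens_ind: z => [|a v w z IH].
  by rewrite /udelta_act !linear0 !addr0 !linear0 !addr0.
rewrite !(proj2 udelta_bilin) IH.
suff -> : udelta_act x (udelta_act y (tpair v w)) =
    udelta_act y (udelta_act x (tpair v w)) + udelta_act (bracket x y) (tpair v w).
  by rewrite scalerDr addrACA.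
have tD := bilin_scaleD (tpair_bilin Ug Ug).
have mD := bilin_scaleD umul_bilin.
rewrite /udelta_act !tmapE.
rewrite !(linearD (tmap (lmul _) _)) !(linearD (tmap (lid _) _)) !tmapE.
have E v' : lmul (uinj x) (lmul (uinj y) v') = lmul (uinj y) (lmul (uinj x) v')
    + lmul (uinj (bracket x y)) v'.
  have E1 p q : lmul p (lmul q v') = lmul (amul p q) v' by exact: amulA.
  rewrite !E1 uinj_bracket; exact: (linearD (rmul v')).
rewrite (E v) (E w) !tD.
set p := tpair _ _; set q := tpair _ w; set r := tpair _ _.
set s := tpair _ _; set t := tpair _ _; set u := tpair _ _.
rewrite -!addrA; congr (p + _).
rewrite [r + (s + _)]addrCA [q + (s + _)]addrCA; congr (s + _).
by rewrite [LHS]addrCA; congr (r + _); rewrite [LHS]addrCA.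
Qed.

Definition udelta : {linear Ug -> tens Ug Ug} :=
  uact (tpair (aone Ug) (aone Ug)) udelta_bilin udelta_lie.

Lemma ueps_bilin : bilin (fun (x : g) (c : k^o) => 0 : k^o).
Proof. by split=> ? ? ? ?; rewrite scaler0 addr0. Qed.
Lemma ueps_lie (x y : g) (c : k^o) : (0 : k^o) = 0 + 0.
Proof. by rewrite addr0. Qed.
Definition ueps : {linear Ug -> k^o} := uact (1 : k^o) ueps_bilin ueps_lie.

(* S(x_1 ... x_n) = (-x_n) ... (-x_1) *)
Lemma uanti_bilin : bilin (fun (x : g) (z : Ug) => - amul z (uinj x)).
Proof.
have mD := bilin_scaleD umul_bilin.
split=> [z a x y | x a z z']; rewrite ?linearP /amul /= !mD opprD scalerN //.
Qed.
Lemma uanti_lie x y z : - amul (- amul z (uinj y)) (uinj x) =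
  - amul (- amul z (uinj x)) (uinj y) + - amul z (uinj (bracket x y)).
Proof.
have mN p q : amul (- p) q = - amul p q := linearN (rmul q) p.
rewrite !mN !opprK -!amulA (uinj_bracket x y).
have mD p q : amul z (p + q) = amul z p + amul z q := linearD (lmul z) p q.
by rewrite mD addrK.
Qed.
Definition uanti : {linear Ug -> Ug} := uact (aone Ug) uanti_bilin uanti_lie.

End Enveloping.
Arguments uinj {k g}.

Section EnvelopingMap.
Variables (k : comPzRingType) (g g' : lieAlgType k) (f : lieHom g g').
Lemma umap_kills : kills (@ug_rel k g) (fun w => uword (map f w)).
Proof.
apply: ug_kills => [a x y u w | x y u w]; rewrite !map_cat /=.
  by rewrite linearP uword_lin.
by rewrite lie_funP uword_lie.
Qed.
Definition umap : {linear Ug g -> Ug g'} := plift umap_kills.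
End EnvelopingMap.

(* The n-th exterior power: degree n part of T(V)/(v ⊗ v).                   *)
Section Exterior.
Variables (k : comPzRingType) (V : lmodType k).

Inductive ext_rel n : seq (k * ('I_n -> V)) -> Prop :=
| ExtLin a u v w i :
    (forall j, j != i -> u j = v j /\ u j = w j) -> u i = a *: v i + w i ->
    ext_rel [:: (1, u); (- a, v); (-1, w)]
| ExtAlt v (i j : 'I_n) : i.+1 = j :> nat -> v i = v j -> ext_rel [:: (1, v)].

Definition ext n : lmodType k := pres (@ext_rel n).
Definition wedge n (v : 'I_n -> V) : ext n := pgen (@ext_rel n) v.

Lemma wedge_lin n a (u v w : 'I_n -> V) i :
  (forall j, j != i -> u j = v j /\ u j = w j) -> u i = a *: v i + w i ->
  wedge u = a *: wedge v + wedge w.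
Proof. by move=> H1 H2; apply: kills_pgen3; apply: (ExtLin H1 H2). Qed.

Lemma wedge_alt n (v : 'I_n -> V) (i j : 'I_n) :
  i.+1 = j :> nat -> v i = v j -> wedge v = 0.
Proof.
move=> H1 H2; have /pgen_kills := ExtAlt H1 H2.
by rewrite /ev big_seq1 scale1r.
Qed.

Lemma wedge0 n (v : 'I_n -> V) i : v i = 0 -> wedge v = 0.
Proof.
move=> H; have := @wedge_lin n (-1) v v v i; by rewrite !scaleN1r !addNr; apply.
Qed.

Lemma ext_kills n (N : lmodType k) (f : ('I_n -> V) -> N) :
  (forall a u v w i, (forall j, j != i -> u j = v j /\ u j = w j) ->
     u i = a *: v i + w i -> f u = a *: f v + f w) ->
  (forall v (i j : 'I_n), i.+1 = j :> nat -> v i = v j -> f v = 0) ->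
  kills (@ext_rel n) f.
Proof.
move=> H1 H2 r [a u v w i h1 h2 | v i j h1 h2]; first exact: ev3 (H1 _ _ _ _ _ h1 h2).
by rewrite /ev big_seq1 (H2 _ _ _ h1 h2) scaler0.
Qed.

End Exterior.

Lemma tpure_lin (k : comPzRingType) (V : lmodType k) n a (u v w : 'I_n -> V) i :
  (forall j, j != i -> u j = v j /\ u j = w j) -> u i = a *: v i + w i ->
  tpure u = a *: tpure v + tpure w.
Proof.
elim: n u v w i => [u v w []//|n IH] u v w i H1 H2 /=.
case: (unliftP ord0 i) => [i' ei | ei]; rewrite {i}ei in H1 H2.
  have [<- <-] := H1 ord0 isT.
  rewrite -(proj2 (tpair_bilin _ _)); congr tpair; apply: (IH _ _ _ i') => //.
  by move=> j nj; apply: H1; rewrite (inj_eq lift_inj).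
rewrite H2 (proj1 (tpair_bilin _ _)); congr (_ *: tpair _ _ + tpair _ _).
  by congr tpure; apply/funext => j; case: (H1 (lift ord0 j) isT).
by congr tpure; apply/funext => j; case: (H1 (lift ord0 j) isT).
Qed.

Definition fcons (T : Type) n (a : T) (v : 'I_n -> T) (i : 'I_n.+1) : T :=
  if unlift ord0 i is Some j then v j else a.

Lemma fcons0 T n (a : T) (v : 'I_n -> T) : fcons a v ord0 = a.
Proof. by rewrite /fcons unlift_none. Qed.
Lemma fconsS T n (a : T) (v : 'I_n -> T) j : fcons a v (lift ord0 j) = v j.
Proof. by rewrite /fcons liftK. Qed.

Section ExteriorMap.
Variables (k : comPzRingType) (V W : lmodType k) (f : {linear V -> W}) (n : nat).
Lemma extmap_kills : kills (@ext_rel k V n) (fun v => wedge (fun i => f (v i))).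
Proof.
apply: ext_kills => [a u v w i H1 H2 | v i j H1 H2]; last first.
  by apply: (wedge_alt H1); rewrite H2.
apply: (@wedge_lin _ _ _ _ _ _ _ i) => [j /H1 [e1 e2] | ].
  by rewrite -{1}e1 -e2.
by rewrite H2 linearP.
Qed.
Definition extmap : {linear ext V n -> ext W n} := plift extmap_kills.
End ExteriorMap.

Section ChevalleyEilenberg.
Variables (k : comPzRingType) (g : lieAlgType k).

(* [x_i, x_j] followed by the x_l with l <> i, j (for i < j). *)
Definition ce_word n (x : 'I_n.+2 -> g) (i j : 'I_n.+2) : 'I_n.+1 -> g :=
  fcons (bracket (x i) (x j)) (fun l : 'I_n => x (inord (bump j (bump i l)))).

Definition ce_sum n (x : 'I_n.+2 -> g) : ext g n.+1 :=
  \sum_(i < n.+2) \sum_(j < n.+2 | (i < j)%N)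
    (-1) ^+ (i + j) *: wedge (ce_word x i j).

Lemma sum_pair_cancel (I : finType) (N : zmodType) (F : I -> I -> N) (p q : I) :
  p != q ->
  (forall i j, i != p -> i != q -> j != p -> j != q -> F i j = 0) ->
  (forall i, i != p -> i != q -> F i p + F i q = 0) ->
  (forall j, j != p -> j != q -> F p j + F q j = 0) ->
  F p p = 0 -> F p q = 0 -> F q p = 0 -> F q q = 0 ->
  \sum_i \sum_j F i j = 0.
Proof.
move=> npq H0 H1 H2 pp pq qp qq.
have S2 (G : I -> N) : (forall i, i != p -> i != q -> G i = 0) ->
    \sum_i G i = G p + G q.
  move=> HG; rewrite (bigD1 p) //= (bigD1 q) 1?eq_sym //= big1 ?addr0 //.
  by move=> i /andP [ip iq]; apply: HG.
rewrite S2 => [|i ip iq]; last by rewrite S2 ?H1 // => j; apply: H0.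
rewrite -big_split /= S2 => [|j]; last exact: H2.
by rewrite pp pq qp qq !addr0.
Qed.

Lemma bump_adj (p q y : nat) : p.+1 = q -> y != p -> bump q y = bump p y.
Proof. by rewrite /bump; lia. Qed.

Lemma ce_kills n : kills (@ext_rel k g n.+2) (@ce_sum n).
Proof.
apply: ext_kills => [a u v w p H1 H2 | x p q epq xpq].
  rewrite /ce_sum scaler_sumr -big_split; apply: eq_bigr => i _.
  rewrite scaler_sumr -big_split; apply: eq_bigr => j ij /=.
  suff -> : wedge (ce_word u i j) =
      a *: wedge (ce_word v i j) + wedge (ce_word w i j).
    by rewrite scalerDr !scalerA mulrC.
  have bl (l : 'I_n) : (bump j (bump i l) < n.+2)%N.
    by have := ltn_ord l; have := ltn_ord j; rewrite /bump; lia.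
  have [pij | ] := boolP ((p == i) || (p == j)).
    apply: (@wedge_lin _ _ _ _ _ _ _ ord0) => [l | ].
      case: (unliftP ord0 l) => [l' -> _ | -> //]; rewrite /ce_word !fconsS.
      apply: H1; apply/eqP => /(congr1 val) /=; rewrite inordK //.
      by case/orP: pij => /eqP ->; rewrite /bump; lia.
    rewrite /ce_word !fcons0; case/orP: pij => /eqP e; rewrite e in H1 H2.
      have [|<- <-] := H1 j; first by rewrite -val_eqE /=; lia.
      by rewrite H2 (proj1 bracket_bilin).
    have [|<- <-] := H1 i; first by rewrite -val_eqE /=; lia.
    by rewrite H2 (proj2 bracket_bilin).
  rewrite negb_or => /andP [pi pj].
  have Hl : (unbump i (unbump j p) < n)%N.
    move: pi pj; rewrite -!val_eqE /=; have := ltn_ord p; have := ltn_ord j.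
    by rewrite /unbump; lia.
  have El : bump j (bump i (Ordinal Hl)) = p.
    by move: pi pj; rewrite -!val_eqE /= /bump /unbump; lia.
  apply: (@wedge_lin _ _ _ _ _ _ _ (lift ord0 (Ordinal Hl))) => [l | ].
    case: (unliftP ord0 l) => [l' -> nl | -> _]; rewrite /ce_word ?fconsS ?fcons0.
      apply: H1; apply/eqP => /(congr1 val) /=; rewrite inordK // -El => e.
      by case/eqP: nl; congr lift; apply: val_inj; move: e; rewrite /= /bump; lia.
    by split; congr bracket; case: (H1 i); case: (H1 j); rewrite 1?eq_sym.
  by rewrite /ce_word !fconsS El inord_val.
pose F (i j : 'I_n.+2) := if (i < j)%N then (-1) ^+ (i + j) *: wedge (ce_word x i j) else 0.
have -> : ce_sum x = \sum_i \sum_j F i j.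
  by apply: eq_bigr => i _; rewrite big_mkcond.
have Ep : p.+1 = q :> nat by [].
apply: (@sum_pair_cancel _ _ _ p q).
- by rewrite -val_eqE /=; lia.
- move=> i j; rewrite -!val_eqE /= => ip iq jp jq; rewrite /F; case: ifP => // ij.
  have Hl : (unbump i (unbump j p) < n)%N.
    by have := ltn_ord q; have := ltn_ord j; rewrite /unbump; lia.
  have Hl' : (unbump i (unbump j q) < n)%N.
    by have := ltn_ord q; have := ltn_ord j; rewrite /unbump; lia.
  rewrite (@wedge_alt _ _ _ _ (lift ord0 (Ordinal Hl)) (lift ord0 (Ordinal Hl'))).
  + by rewrite scaler0.
  + by rewrite /= /bump /unbump; lia.
  rewrite /ce_word !fconsS.
  have -> : bump j (bump i (Ordinal Hl)) = p by rewrite /= /bump /unbump; lia.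
  have -> : bump j (bump i (Ordinal Hl')) = q by rewrite /= /bump /unbump; lia.
  by rewrite !inord_val.
- move=> i; rewrite -!val_eqE /= => ip iq; rewrite /F.
  have -> : (i < q)%N = (i < p)%N by lia.
  case: ifP => ij; last by rewrite addr0.
  have -> : ce_word x i q = ce_word x i p.
    apply/funext => l; case: (unliftP ord0 l) => [l' -> | ->].
      rewrite /ce_word !fconsS.
      have [e | e] := eqVneq (bump i l') p.
        have -> : bump q (bump i l') = p by rewrite /bump in e *; lia.
        have -> : bump p (bump i l') = q by rewrite /bump in e *; lia.
        by rewrite !inord_val xpq.
      by congr (x (inord _)); apply: bump_adj Ep e.
    by rewrite /ce_word !fcons0 xpq.
  by rewrite -scalerDl -Ep addnS exprS mulN1r subrr scale0r.
- move=> j; rewrite -!val_eqE /= => jp jq; rewrite /F.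
  have -> : (q < j)%N = (p < j)%N by lia.
  case: ifP => ij; last by rewrite addr0.
  have -> : ce_word x q j = ce_word x p j.
    apply/funext => l; case: (unliftP ord0 l) => [l' -> | ->].
      rewrite /ce_word !fconsS.
      have [e | e] := eqVneq (l' : nat) p.
        have -> : bump j (bump q l') = p by rewrite /bump; lia.
        have -> : bump j (bump p l') = q by rewrite /bump; lia.
        by rewrite !inord_val xpq.
      by congr (x (inord (bump j _))); apply: bump_adj Ep e.
    by rewrite /ce_word !fcons0 xpq.
  by rewrite -scalerDl -Ep addSn exprS mulN1r subrr scale0r.
- by rewrite /F ltnn.
- rewrite /F -Ep ltnSn (@wedge0 _ _ _ _ ord0) ?scaler0 //.
  by rewrite /ce_word fcons0 -xpq bracketxx.
- by rewrite /F -Ep ltnNge leqnSn.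
by rewrite /F ltnn.
Qed.

(* The signs (-1)^(i+j) do not depend on counting from 0 or from 1. *)
Definition ce n : {linear ext g n.+1 -> ext g n} :=
  match n with
  | 0 => lzero _ _
  | n'.+1 => plift (@ce_kills n')
  end.

Definition esum n (x : 'I_n -> g) : tpow (Ug g) n :=
  \sum_(s : 'S_n) (-1) ^+ s *: tpure (fun i => uinj (x (s i))).

Lemma esum_kills n : kills (@ext_rel k g n) (@esum n).
Proof.
apply: ext_kills => [a u v w p H1 H2 | x p q epq xpq].
  rewrite /esum scaler_sumr -big_split; apply: eq_bigr => s _ /=.
  rewrite (@tpure_lin _ _ _ a _ (fun i => uinj (v (s i)))
     (fun i => uinj (w (s i))) (perm_inv s p)).
  - by rewrite scalerDr !scalerA mulrC.
  - move=> j nj; have [|e1 e2] := H1 (s j); last by rewrite -{1}e1 -e2.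
    by apply: contra_neq nj => <-; rewrite permK.
  rewrite permKV H2; exact: uinj_linear.
have npq : p != q by rewrite -val_eqE /= -epq; lia.
pose T (s : 'S_n) := tpure (fun i => uinj (x (s i))).
pose t := tperm p q.
have xt i : x (t i) = x i by rewrite /t; case: tpermP => // ->.
have Tt (s : 'S_n) : T (s * t)%g = T s.
  by rewrite /T; congr tpure; apply/funext => i; rewrite permM xt.
rewrite /esum (bigID (@odd_perm _)) /= [X in _ + X](reindex_inj (mulIg t)) /=.
rewrite [X in _ + X](eq_bigl (fun s : 'S_n => odd_perm s)); last first.
  by move=> s; rewrite odd_permM odd_tperm npq addbT negbK.
rewrite -big_split big1 // => s os; rewrite -/(T _) -/(T (s * t)%g) Tt.
by rewrite odd_permM odd_tperm npq os /= scaleN1r scale1r addNr.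
Qed.

Definition emap n : {linear ext g n -> tpow (Ug g) n} := plift (@esum_kills n).

End ChevalleyEilenberg.

Section ExteriorToCyclic.
Variables (k : comPzRingType) (g : lieAlgType k).

Definition BUg : cycData k := Bcyc (udelta g) (ueps g) (uanti g).
Definition CUg : cycData k := Ccyc (Ug g).
Definition HNUg_norm n : lmodType k := HN (normalized CUg) n.

Definition psi n (w : ext g n) : HN (normalized BUg) n :=
  @HNsingle k (normalized BUg) n (qproj (@degenerate k BUg n) (emap g n w)).

Definition tau_psi n (w : ext g n) : HNUg_norm n := 
  @tau_HN_norm k (Ug g) (udelta g) (ueps g) (uanti g) n (psi w).

Definition c_e n (w : ext g n) : HNUg_norm n :=
  @cmap k (Ug g) (udelta g) (ueps g) (uanti g) n (emap g n w).

(* The class of x_0 ⊗ e(x_1 ∧ ... ∧ x_n), as a function of the family        *)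
(* (x_0, ..., x_n).  If 2 is not invertible it need not factor through the   *)
(* exterior power: the class of x ⊗ x in C^lambda_1 is killed by 2 but need  *)
(* not vanish.  Its image under B always does factor.                        *)
Definition theta n (x : 'I_n.+1 -> g) : Clambda (Ug g) n :=
  qproj _ (tpair (uinj (x ord0)) (emap g n (wedge (fun i => x (lift ord0 i))))).

Definition B_theta n (x : 'I_n.+1 -> g) : HNUg_norm n.+1 :=
  HNnorm (Blambda (theta x)).

(* Chain maps from the positive degree part of the exterior algebra; its     *)
(* differential vanishes in degree 1.                                        *)
Definition chain_map (F : forall n, ext g n -> HNUg_norm n) : Prop :=
  [/\ forall n, linear (F n.+1),
      forall w : ext g 1, HNd (F 1%N w) = 0
    & forall n (w : ext g n.+2), HNd (F n.+2 w) = F n.+1 (ce g n.+1 w)].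

End ExteriorToCyclic.

Definition HNUg_map (k : comPzRingType) (g g' : lieAlgType k) (f : lieHom g g')
    n (x : HNUg_norm g n) : HNUg_norm g' n :=
  @HNmap k (normalized (CUg g)) (normalized (CUg g'))
    (fun m => @qmap _ _ _ (@degenerate k (CUg g) m) (@degenerate k (CUg g') m)
                (tpowmap (umap f) m.+1)) n x.

(* Natural families of maps from the positive degree part of the exterior    *)
(* algebra, of degree 1.                                                     *)
Definition natural1 (k : comPzRingType)
    (h : forall (g : lieAlgType k) n, {linear ext g n.+1 -> HNUg_norm g n.+2}) :
    Prop :=
  forall (g g' : lieAlgType k) (f : lieHom g g') n (w : ext g n.+1),
    HNUg_map f (h g n w) = h g' n (extmap f n.+1 w).

(* Main.v *)
(* U(g) is a cocommutative Hopf algebra, and its tensor powers are spanned by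
   the values of group-like points: families of elements indexed by words,
   multiplicative for the shuffle coproduct, such as w |-> product of the
   letters of w (the coefficients of a product of exponentials).  Identities
   between multilinear maps may be checked on such points, hence as if H were a
   group algebra; in the homogeneous coordinates g_0, g_1, ... the cyclic
   operators of E(H) permute, drop and repeat the g_i, which gives the cyclic
   identities of E(H) and the cyclicity of tau.

   As the x_i are primitive, B'(1 (x) x_1 (x) ... (x) x_n) distributes n
   letters over n+1 factors, so some factor is 1 and the element is
   degenerate. Thus psi is a chain map. For tau psi = B theta, in tau e(x)
   every letter moved into the first factor leaves a 1 behind, so tau e(x) = 1
   (x) e(x) up to degenerate elements, while the cyclic norm of x_0 (x) e(x_1,
   ..., x_n) is e(x_0, ..., x_n) by the decomposition of S_(n+1) into rotation
   cosets of S_n.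

   Upsilon e and psi both lift e, and contracting E(H) by s(x) = 1 (x) x gives
   the H-linear homotopy
     K^(j+1)(1 (x) v) = s((Upsilon^(j+1) - K^(j+1) d' - B' K^j)(1 (x) v)).
   It works on the H-span of the elements 1 (x) e(x), where B' is degenerate and
   which d' preserves: e(x_1, ..., x_n) is an iterated signed insertion Ins_x,
   and the anticommutator of Ins_x with the faces of E(U(g)) other than the
   first is ad_x. *)
Require Import Defs.
From mathcomp Require Import all_boot all_order all_algebra.
From mathcomp Require Import fingroup perm.
From mathcomp Require Import boolp zify.

Set Implicit Arguments.
Unset Strict Implicit.
Unset Printing Implicit Defensive.

Import GRing.Theory.
Local Open Scope ring_scope.

(* Keeps [/=] from unfolding bundled linear maps to their raw functions. *)
Arguments GRing.Linear.sort : simpl never.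
Arguments tpure : simpl never.

(** Over an arbitrary commutative ring neither a PBW basis nor exponentials with factorials are at
    hand. Points avoid both: the coefficient of a product of letters at a word has no denominator,
    and tagging letters by positions makes any pure tensor of words a single coefficient of a tensor
    of grouplike points.

    The computations take place in E(H), where the contraction s lives. Chains of HN(C(H)) are
    written as images of families in E(H) under [Etau], the composite E(H) -> B(H) -> C(H). It
    factors through coinvariants, and d'(1 ⊗ e(x)) = e(x) + 1 ⊗ e(dx), where the counit kills the
    first entries of e(x). So after [Etau] an H-linear map takes the same value on d'(1 ⊗ e(x)) and
    on 1 ⊗ e(dx); this links the recursions on E(H) to the differential of the exterior algebra.

    Upsilon commutes with the differentials exactly, but (..., 0, id) does so only where B' is
    degenerate. The homotopy identity therefore holds only modulo degenerate elements, and applying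
    B' to such a congruence requires B' to preserve the degenerate span. *)

Section BundledMaps.
Variables (k : comPzRingType) (U V W : lmodType k).
Lemma lcompE (g : {linear V -> W}) (f : {linear U -> V}) x : lcomp g f x = g (f x).
Proof. by []. Qed.
Lemma lidE (x : V) : lid V x = x. Proof. by []. Qed.
Lemma lscaleE a (f : {linear V -> W}) x : lscale a f x = a *: f x.
Proof. by []. Qed.
Fact lsub_linear (f g : {linear V -> W}) : linear (fun x => f x - g x).
Proof. by move=> a x y; rewrite !linearP scalerDr addrACA. Qed.
Definition lsub f g : {linear V -> W} := mklin (lsub_linear f g).
Lemma lsubE f g x : lsub f g x = f x - g x. Proof. by []. Qed.
Fact ladd_linear (f g : {linear V -> W}) : linear (fun x => f x + g x).
Proof. by move=> a x y; rewrite !linearP scalerDr addrACA. Qed.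
Definition ladd f g : {linear V -> W} := mklin (ladd_linear f g).
Lemma laddE f g x : ladd f g x = f x + g x. Proof. by []. Qed.
Lemma tpairlE (v : V) (w : W) : tpairl W v w = tpair v w. Proof. by []. Qed.
End BundledMaps.

Lemma bdryE (k : comPzRingType) (X : cycData k) n x :
  bdry X n x = \sum_(i < n.+2) (-1) ^+ i *: cyc_d X n i x.
Proof. by []. Qed.
Lemma cnormE (k : comPzRingType) (X : cycData k) n x :
  cnorm X n x = \sum_(i < n.+1) iter i (cyc_t X n) x.
Proof. by []. Qed.
Lemma extraE (k : comPzRingType) (X : cycData k) n x :
  extra X n x = (-1) ^+ n.+1 *: cyc_t X n.+1 (cyc_s X n n x).
Proof. by []. Qed.
Lemma connesE (k : comPzRingType) (X : cycData k) n x :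
  connes X n x = extra X n (cnorm X n x) - cyc_t X n.+1 (extra X n (cnorm X n x)).
Proof. by []. Qed.

(** * Linear maps out of quotients *)

Section QuotientMaps.
Variables (k : pzRingType) (V : lmodType k) (S : V -> Prop).

Lemma qproj_sub v : S v -> qproj S v = 0.
Proof.
move=> Sv; have /pgen_kills : quot_rel S [:: (1, v)] by constructor.
by rewrite /ev big_seq1 scale1r.
Qed.

(** Membership in the span of S is expressed throughout as [qproj S v = 0]. With M another quotient,
    this lemma carries a property of the elements of S to their span. *)
Lemma qproj_kills (M : lmodType k) (F : {linear V -> M}) :
  (forall v, S v -> F v = 0) -> forall v, qproj S v = 0 -> F v = 0.
Proof.
move=> FS; have Fk : kills (quot_rel S) F.
  move=> r [a u v | v Sv]; first by apply: ev3; rewrite linearP.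
  by rewrite /ev big_seq1 FS // scaler0.
move=> v Hv; rewrite -(pliftE Fk).
by have -> : pgen (quot_rel S) v = 0 by []; rewrite linear0.
Qed.

Lemma qproj_eq v w : qproj S (v - w) = 0 <-> qproj S v = qproj S w.
Proof.
rewrite linearB; split=> [/eqP | ->]; last by rewrite subrr.
by rewrite subr_eq0 => /eqP.
Qed.

End QuotientMaps.

Section QuotientMaps.
Variables (k : pzRingType) (V W : lmodType k) (S : V -> Prop) (T : W -> Prop).
Variable (f : {linear V -> W}).
Hypothesis fST : forall v, S v -> qproj T (f v) = 0.

Lemma qproj_map v : qproj S v = 0 -> qproj T (f v) = 0.
Proof. exact: (qproj_kills (F := lcomp (qproj T) f)). Qed.

Lemma qmapE v : qmap T f (qproj S v) = qproj T (f v).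
Proof.
apply/qproj_eq; rewrite -linearB; apply: qproj_map.
by rewrite linearB qrepK subrr.
Qed.

End QuotientMaps.

(** * Cyclic modules and their degenerate elements *)

Section CyclicModules.
Variables (k : comPzRingType) (X : cycData k).
Local Notation d := (cyc_d X).
Local Notation s := (cyc_s X).
Local Notation t := (cyc_t X).

(** The identities are grouped by use: [simplicial_degen] and [cyclic_degen] make [bdry] and
    [connes] descend to the quotient by degenerate elements, while [cyclic_faces], with the first,
    gives the relations of a mixed complex. *)
Record simplicial_degen : Prop := SimplicialDegen {
  dsl : forall n i j x, (i < j <= n.+1)%N ->
    d n.+1 i (s n.+1 j x) = s n j.-1 (d n i x);
  dse : forall n j x, (j <= n)%N -> d n j (s n j x) = x;
  dse1 : forall n j x, (j <= n)%N -> d n j.+1 (s n j x) = x;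
  dsg : forall n i j x, (j.+1 < i <= n.+2)%N ->
    d n.+1 i (s n.+1 j x) = s n j (d n i.-1 x);
  ss_last : forall n j x, (j <= n)%N -> s n.+1 n.+1 (s n j x) = s n.+1 j (s n n x) }.

Record cyclic_degen : Prop := CyclicDegen {
  st : forall n j x, (j < n)%N -> s n j.+1 (t n x) = - t n.+1 (s n j x);
  s0t : forall n x, s n 0 (t n x) = (-1) ^+ n *: t n.+1 (t n.+1 (s n n x)) }.

Record cyclic_faces : Prop := CyclicFaces {
  dd : forall n i j x, (i < j <= n.+2)%N ->
    d n i (d n.+1 j x) = d n j.-1 (d n.+1 i x);
  dt : forall n i x, (i <= n)%N -> d n i.+1 (t n.+1 x) = - t n (d n i x);
  d0t : forall n x, d n 0 (t n.+1 x) = (-1) ^+ n.+1 *: d n n.+1 x;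
  tt_id : forall n x, iter n.+1 (t n) x = x }.

Section Degenerate.
Hypotheses (Hs : simplicial_degen) (Hc : cyclic_degen).
Local Notation dg n := (qproj (@degenerate k X n)).

Lemma dg_s n j x : (j <= n)%N -> dg n.+1 (s n j x) = 0.
Proof. by move=> jn; apply: qproj_sub; exists j, x. Qed.

Lemma bdry_degenerate n x : @degenerate k X n.+1 x -> dg n (bdry X n x) = 0.
Proof.
move=> [j [y [jn ->]]]; rewrite bdryE.
have [i0 Ei0] : exists i0 : 'I_n.+2, i0 = j :> nat.
  by exists (inord j); rewrite inordK // ltnS leqW.
have [i1 Ei1] : exists i1 : 'I_n.+2, i1 = j.+1 :> nat.
  by exists (inord j.+1); rewrite inordK // ltnS.
(* The faces j and j + 1 of s_j y both return y, with opposite signs; all other faces are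
   degenerate. *)
rewrite (bigD1 i0) //= (bigD1 i1) /=; last by rewrite -val_eqE /= Ei0 Ei1; lia.
rewrite Ei0 Ei1 (dse Hs) // (dse1 Hs) // addrA exprS mulN1r scaleNr subrr add0r.
rewrite linear_sum big1 // => i /andP [/eqP ni0 /eqP ni1].
have {}ni0 : (i : nat) <> j by move=> e; apply: ni0; apply: val_inj; rewrite /= e.
have {}ni1 : (i : nat) <> j.+1 by move=> e; apply: ni1; apply: val_inj; rewrite /= e.
rewrite linearZ /=; have := ltn_ord i => lti.
case: n => [|n] in x i0 i1 i y jn Ei0 Ei1 ni0 ni1 lti *; first by lia.
have [ij | ij] := ltnP i j.
  by rewrite (dsl Hs) ?dg_s ?scaler0 //; lia.
by rewrite (dsg Hs) ?dg_s ?scaler0 //; lia.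
Qed.

Let tts n x : t n.+1 (t n.+1 (s n n x)) = (-1) ^+ n *: s n 0 (t n x).
Proof.
by rewrite (s0t Hc) scalerA -exprD addnn -signr_odd odd_double scale1r.
Qed.

(** Up to sign t s' is s_0 t. Hence the Connes operator (1 - t) s' N reduces to s' N in the
    normalized complex. *)
Lemma t_extra_degenerate n x : dg n.+1 (t n.+1 (extra X n x)) = 0.
Proof. by rewrite extraE linearZ /= tts !linearZ /= dg_s // !scaler0. Qed.

(* Besides the degenerate elements, the span of these contains the image of
   the extra degeneracy t s_n, so that it is stable under t. *)
Let weak n : X n -> Prop :=
  match n with
  | 0 => fun _ => False
  | n'.+1 => fun x => exists j y, (j <= n')%N /\
      (x = s n' j y \/ j = n' /\ x = t n'.+1 (s n' j y))
  end.
Let wk n := qproj (@weak n).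

Let wk_s n j y : (j <= n)%N -> wk n.+1 (s n j y) = 0.
Proof. by move=> jn; apply: qproj_sub; exists j, y; split=> //; left. Qed.

Let wk_t n x : wk n x = 0 -> wk n (t n x) = 0.
Proof.
apply: qproj_map => {}x; case: n x => [//|n] x [j [y [jn [->|[-> ->]]]]].
  move: jn; rewrite leq_eqVlt => /orP [/eqP -> | jn].
    by apply: qproj_sub; exists n, y; split=> //; right.
  by rewrite -[t _ _]opprK -(st Hc) // linearN wk_s ?oppr0.
by rewrite tts linearZ /= wk_s ?scaler0.
Qed.

Let extra_wk n x : wk n x = 0 -> dg n.+1 (extra X n x) = 0.
Proof.
apply: qproj_map => {}x; case: n x => [//|n] x [j [y [jn H]]].
suff E : dg n.+2 (t n.+2 (s n.+1 n.+1 x)) = 0.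
  by rewrite extraE linearZ /= E scaler0.
case: H => [-> | [-> ->]].
  rewrite (ss_last Hs) // -[t _ _]opprK -(st Hc) ?ltnS // linearN.
  by rewrite dg_s ?oppr0 // ltnS.
rewrite (st Hc) // linearN -(ss_last Hs) // tts.
by rewrite linearN linearZ /= dg_s ?scaler0 ?oppr0.
Qed.

(** Rotations may leave the degenerate span, but they stay in the span of [weak], and the extra
    degeneracy sends that back to degenerate elements. *)
Lemma extra_cnorm_degenerate n x :
  @degenerate k X n x -> dg n.+1 (extra X n (cnorm X n x)) = 0.
Proof.
move=> Hx; apply: extra_wk; rewrite cnormE linear_sum big1 // => i _.
elim: (i : nat) => [|m IH]; last exact: wk_t.
case: n x Hx {i} => [//|n] x [j [y [jn ->]]]; exact: wk_s.
Qed.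

Lemma connes_degenerate n x :
  @degenerate k X n x -> dg n.+1 (connes X n x) = 0.
Proof.
move=> Hx; rewrite connesE linearB /= t_extra_degenerate subr0.
exact: extra_cnorm_degenerate.
Qed.

End Degenerate.

Lemma tZ n a x : t n (a *: x) = a *: t n x. Proof. exact: linearZ. Qed.

Lemma iter_linear n i : linear (iter i (t n)).
Proof. by move=> a x y; elim: i => //= i ->; rewrite linearP. Qed.

Lemma cnorm_cyclic n : (forall x, iter n.+1 (t n) x = x) ->
  forall x, cnorm X n (t n x) = cnorm X n x.
Proof.
move=> tt x; rewrite !cnormE big_ord_recr [RHS]big_ord_recl addrC -iterSr tt.
by congr (_ + _); apply: eq_bigr => i _; rewrite -iterSr.
Qed.

Section Identities.
Hypotheses (Hf : cyclic_faces).

Lemma bdry_bdry n x : bdry X n (bdry X n.+1 x) = 0.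
Proof.
rewrite bdryE; under eq_bigr => i _ do rewrite bdryE linear_sum scaler_sumr.
rewrite pair_bigA /=.
under eq_bigr => p _ do rewrite linearZ /= scalerA -exprD.
rewrite (bigID (fun p : 'I_n.+2 * 'I_n.+3 => (p.1 < p.2)%N)) /=.
(* The simplicial identity matches (i, j) for j <= i with (j, i + 1), which has the opposite sign;
   [h] is the inverse matching. *)
have [h' h'E] : exists h' : 'I_n.+2 * 'I_n.+3 -> 'I_n.+2 * 'I_n.+3,
    forall p : 'I_n.+2 * 'I_n.+3, (p.2 <= p.1)%N -> (h' p).1 = p.2 :> nat /\ (h' p).2 = p.1.+1 :> nat.
  exists (fun p : 'I_n.+2 * 'I_n.+3 => (inord p.2, inord p.1.+1)) => p le /=.
  by have := ltn_ord p.1 => lt; rewrite !inordK //; lia.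
have [h hE] : exists h : 'I_n.+2 * 'I_n.+3 -> 'I_n.+2 * 'I_n.+3,
    forall p : 'I_n.+2 * 'I_n.+3, (p.1 < p.2)%N -> (h p).1 = p.2.-1 :> nat /\ (h p).2 = p.1 :> nat.
  exists (fun p : 'I_n.+2 * 'I_n.+3 => (inord p.2.-1, inord p.1)) => p le /=.
  by have := ltn_ord p.1; have := ltn_ord p.2 => lt lt'; rewrite !inordK //; lia.
have ordP (p q : 'I_n.+2 * 'I_n.+3) : p.1 = q.1 :> nat -> p.2 = q.2 :> nat -> p = q.
  by case: p q => [a b] [c e] /= /val_inj -> /val_inj ->.
rewrite (reindex_onto h' h); last first.
  move=> p lt; have [e1 e2] := hE p lt.
  have [|e3 e4] := h'E (h p); first by lia.
  by apply: ordP; lia.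
rewrite [X in X + _](eq_bigl (fun p : 'I_n.+2 * 'I_n.+3 => ~~ (p.1 < p.2)%N)); last first.
  move=> p /=; rewrite -leqNgt; apply/andP/idP => [[lt /eqP e] | le].
    by have [] := hE _ lt; rewrite e; move: lt; lia.
  have [e3 e4] := h'E _ le; split; first by lia.
  by apply/eqP/ordP; have [|e1 e2] := hE (h' p); lia.
rewrite -big_split big1 // => p; rewrite -leqNgt => le.
have [e3 e4] := h'E _ le; rewrite e3 e4 /=.
rewrite (dd Hf); last by have := ltn_ord p.1; lia.
by rewrite addnS exprS mulN1r scaleNr [(p.2 + _)%N]addnC addNr.
Qed.

Lemma iter_tZ n i a x : iter i (t n) (a *: x) = a *: iter i (t n) x.
Proof. by rewrite -[iter i (t n)]/(mklin (@iter_linear n i) : _ -> _) linearZ. Qed.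

Lemma cnorm_t n x : cnorm X n (t n x) = cnorm X n x.
Proof. by apply: cnorm_cyclic => y; apply: tt_id. Qed.

Lemma t_cnorm n x : t n (cnorm X n x) = cnorm X n x.
Proof.
rewrite !cnormE linear_sum big_ord_recr [RHS]big_ord_recl addrC.
by congr (_ + _); rewrite -[RHS](tt_id Hf).
Qed.

(** The operator b' of the bar complex: b (1 - t) = (1 - t) b', b' N = N b, and s' is a contraction
    for it. *)
Definition bdry' n x := \sum_(i < n.+1) (-1) ^+ i *: d n i x.

Lemma bdry_t n x : bdry X n (x - t n.+1 x) = bdry' x - t n (bdry' x).
Proof.
rewrite linearB !bdryE big_ord_recr /= -/(bdry' x) [X in _ - X]big_ord_recl.
rewrite expr0 scale1r (d0t Hf) opprD addrA addrK; congr (_ + _).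
rewrite /bdry' -sumrN [t n _]linear_sum -sumrN; apply: eq_bigr => i _ /=.
have := ltn_ord i; rewrite ltnS => lti.
by rewrite /bump /= add1n (dt Hf) // scalerN opprK exprS mulN1r scaleNr [t n (_ *: _)]linearZ.
Qed.

(* Index pairs (i, j) with d_i t^j = +- t^l d_m correspond to the pairs (l, m). *)
Lemma d_iter_t n i j x : (i <= n)%N -> (j <= n.+1)%N ->
  (-1) ^+ i *: d n i (iter j (t n.+1) x) =
  if (j <= i)%N then (-1) ^+ (i - j) *: iter j (t n) (d n (i - j) x)
  else (-1) ^+ (n.+2 + i - j) *: iter j.-1 (t n) (d n (n.+2 + i - j) x).
Proof.
have step m l y : (m <= n.+1)%N -> (l <= m)%N ->
    (-1) ^+ m *: d n m (iter l (t n.+1) y) =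
    (-1) ^+ (m - l) *: iter l (t n) (d n (m - l) y).
  elim: l m y => [|l IH] m y lm ll; first by rewrite subn0.
  case: m ll lm => [//|m]; rewrite !ltnS => ll lm.
  rewrite iterS (dt Hf) // exprS mulN1r scaleNr scalerN opprK subSS.
  by rewrite iterS -!tZ IH // leqW.
move=> le_in le_jn; case: ifP => [ji | /negbT]; first by apply: step => //; lia.
rewrite -ltnNge => ij.
have [l El] : exists l, j = (i + l.+1)%N by exists (j - i.+1)%N; lia.
rewrite El iterD step ?subnn // ?expr0 ?scale1r //; last by lia.
rewrite iterS (d0t Hf) step //; last by lia.
have -> : (n.+2 + i - (i + l.+1) = n.+1 - l)%N by lia.
by rewrite iter_tZ -iterD addnS.
Qed.

Lemma bdry'_cnorm n x : bdry' (cnorm X n.+1 x) = cnorm X n (bdry X n x).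
Proof.
(* [h] sends (i, j) to the pair (m, l) given by [d_iter_t]. It is injective between finite sets of
   equal size, hence bijective. *)
have [h hE] : exists h : 'I_n.+1 * 'I_n.+2 -> 'I_n.+2 * 'I_n.+1, forall p : 'I_n.+1 * 'I_n.+2,
    (if p.2 <= p.1 then (h p).1 = p.1 - p.2 :> nat /\ (h p).2 = p.2 :> nat
     else (h p).1 = n.+2 + p.1 - p.2 :> nat /\ (h p).2 = p.2.-1 :> nat)%N.
  exists (fun p : 'I_n.+1 * 'I_n.+2 => (inord (if p.2 <= p.1 then p.1 - p.2 else n.+2 + p.1 - p.2),
                    inord (if p.2 <= p.1 then p.2 : nat else p.2.-1))%N).
  move=> p; have := ltn_ord p.1; have := ltn_ord p.2 => l1 l2.
  by case: (leqP p.2 p.1) => le /=; rewrite !inordK //; lia.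
have h_inj : injective h.
  move=> [a b] [a' b'] e; have := hE (a, b); have := hE (a', b'); rewrite e /=.
  have := ltn_ord a; have := ltn_ord b; have := ltn_ord a'; have := ltn_ord b'.
  move=> l1 l2 l3 l4; case: ifP => c1; case: ifP => c2 [h1 h2] [h3 h4];
    by congr pair; apply: val_inj => /=; lia.
have h_bij : bijective h by apply: inj_card_bij => //; rewrite !card_prod mulnC.
have -> : bdry' (cnorm X n.+1 x) = \sum_(i < n.+1) \sum_(j < n.+2)
    (-1) ^+ i *: d n i (iter j (t n.+1) x).
  by apply: eq_bigr => i _; rewrite cnormE linear_sum scaler_sumr.
have -> : cnorm X n (bdry X n x) = \sum_(m < n.+2) \sum_(l < n.+1)
    iter l (t n) ((-1) ^+ m *: d n m x).
  rewrite cnormE exchange_big; apply: eq_bigr => l _.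
  exact: (linear_sum (mklin (@iter_linear n l))).
rewrite !pair_bigA /= [RHS](reindex h); last exact: onW_bij.
apply: eq_bigr => p _; have := hE p; have := ltn_ord p.1; have := ltn_ord p.2.
move=> l1 l2 Hp; rewrite iter_tZ d_iter_t //.
by case: ifP Hp => le [-> ->].
Qed.

Section Connes.
Hypotheses (Hs : simplicial_degen).

Lemma d0_extra n x : d n 0 (extra X n x) = x.
Proof.
by rewrite extraE linearZ /= (d0t Hf) scalerA -exprD addnn -signr_odd odd_double
  scale1r (dse1 Hs).
Qed.

Lemma dS_extra n i x : (i <= n)%N ->
  d n.+1 i.+1 (extra X n.+1 x) = extra X n (d n i x).
Proof.
move=> le; rewrite !extraE linearZ /= (dt Hf) ?(dsl Hs) ?leqnn ?andbT ?ltnS //; last exact: leqW.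
by rewrite exprS mulN1r scaleNr scalerN opprK.
Qed.

Lemma bdry'_extra n x : bdry' (extra X n.+1 x) = x - extra X n (bdry' x).
Proof.
rewrite /bdry' big_ord_recl expr0 scale1r d0_extra; congr (_ + _).
rewrite [extra X n _]linear_sum -sumrN; apply: eq_bigr => i _ /=.
have := ltn_ord i; rewrite ltnS => lti.
rewrite /bump /= add1n dS_extra // exprS mulN1r scaleNr.
by rewrite [extra X n (_ *: _)]linearZ.
Qed.

(** b (1 - t) s' N = (1 - t) b' s' N = (1 - t) (1 - s' b') N. Here (1 - t) N = 0 and b' N = N b,
    which leaves - (1 - t) s' N b. *)
Lemma bdry_connes n x :
  bdry X n.+1 (connes X n.+1 x) = - connes X n (bdry X n x).
Proof.
rewrite connesE bdry_t bdry'_extra bdry'_cnorm [t n.+1 (_ - _)]linearB t_cnorm.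
by rewrite [in RHS]connesE !opprB addrC addrA subrK.
Qed.

Lemma bdry_connes0 x : bdry X 0 (connes X 0 x) = 0.
Proof.
by rewrite connesE bdry_t /bdry' big_ord1 expr0 scale1r d0_extra t_cnorm subrr.
Qed.

Lemma connes_connes n x : connes X n.+1 (connes X n x) = 0.
Proof.
rewrite [connes X n.+1 _]connesE [connes X n x]connesE [cnorm X _ (_ - _)]linearB.
rewrite cnorm_t subrr.
by rewrite !linear0 addr0.
Qed.

Lemma connes_sub3 n (a b : X n.+1) (c : X n) :
  connes X n.+1 (a - b - connes X n c) = connes X n.+1 a - connes X n.+1 b.
Proof. by rewrite linearB /= connes_connes subr0 linearB. Qed.

End Connes.
End Identities.
End CyclicModules.

(** * Points of modules in the dual of the shuffle coalgebra *)

Section Unshuffles.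
Variables (k : comPzRingType) (X : Type).

(** Runs over all ways to distribute the letters of w, in order, to two words. This is the coproduct
    of the free algebra on X with primitive letters; the lemmas below are its counit,
    coassociativity and cocommutativity. *)
Fixpoint usum (M : zmodType) (F : seq X -> seq X -> M) (w : seq X) : M :=
  if w is x :: w' then
    usum (fun a b => F (x :: a) b) w' + usum (fun a b => F a (x :: b)) w'
  else F [::] [::].

Lemma eq_usum (M : zmodType) (F G : seq X -> seq X -> M) w :
  (forall a b, F a b = G a b) -> usum F w = usum G w.
Proof. by elim: w F G => //= x w IH F G e; congr (_ + _); apply: IH. Qed.

Lemma usumD (M : zmodType) (F G : seq X -> seq X -> M) w :
  usum (fun a b => F a b + G a b) w = usum F w + usum G w.
Proof. by elim: w F G => //= x w IH F G; rewrite !IH addrACA. Qed.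

Lemma usum0 (M : zmodType) (F : seq X -> seq X -> M) w :
  (forall a b, F a b = 0) -> usum F w = 0.
Proof. by elim: w F => //= x w IH F F0; rewrite !IH // addr0. Qed.

Lemma linear_usum (M N : lmodType k) (f : {linear M -> N}) F w :
  f (usum F w) = usum (fun a b => f (F a b)) w.
Proof. by elim: w F => //= x w IH F; rewrite linearD !IH. Qed.

Lemma usumC (M : zmodType) (F : seq X -> seq X -> M) w :
  usum F w = usum (fun a b => F b a) w.
Proof. by elim: w F => //= x w IH F; rewrite addrC; congr (_ + _); apply: IH. Qed.

Lemma usumA (M : zmodType) (F : seq X -> seq X -> seq X -> M) w :
  usum (fun a b => usum (fun c e => F c e b) a) w =
  usum (fun a b => usum (fun c e => F a c e) b) w.
Proof.
elim: w F => //= x w IH F; rewrite !usumD addrA.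
by rewrite (IH (fun a b c => F (x :: a) b c)) (IH (fun a b c => F a (x :: b) c))
  (IH (fun a b c => F a b (x :: c))).
Qed.

Lemma usum_unit (M : zmodType) (G : seq X -> M) w :
  usum (fun a b => if a is [::] then G b else 0) w = G w.
Proof. by elim: w G => //= x w IH G; rewrite usum0 // add0r IH. Qed.

Let usum4 (M : zmodType) (F : seq X -> seq X -> seq X -> seq X -> M) w :=
  usum (fun a b => usum (fun c e => usum (fun c' e' => F c e c' e') b) a) w.

Let usum4_cons (M : zmodType) (F : seq X -> seq X -> seq X -> seq X -> M) x w :
  usum4 F (x :: w) =
  usum4 (fun a => F (x :: a)) w + usum4 (fun a b => F a (x :: b)) w +
  (usum4 (fun a b c => F a b (x :: c)) w + usum4 (fun a b c e => F a b c (x :: e)) w).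
Proof.
rewrite /usum4 /= usumD; congr (_ + _); rewrite -usumD; apply: eq_usum => a b.
by rewrite -usumD.
Qed.

Lemma usumACA (M : zmodType) (F : seq X -> seq X -> seq X -> seq X -> M) w :
  usum (fun a b => usum (fun c e => usum (fun c' e' => F c e c' e') b) a) w =
  usum (fun a b => usum (fun c e => usum (fun c' e' => F c c' e e') b) a) w.
Proof.
rewrite -/(usum4 F w) -/(usum4 (fun a b c e => F a c b e) w).
elim: w F => // x w IH F; rewrite !usum4_cons addrACA.
by congr (_ + _ + (_ + _)); apply: IH.
Qed.

Lemma usum_cat (M : zmodType) (F : seq X -> seq X -> M) u v :
  usum F (u ++ v) =
  usum (fun a b => usum (fun c e => F (a ++ c) (b ++ e)) v) u.
Proof. by elim: u F => //= x u IH F; rewrite !IH. Qed.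

(* A map seq X -> M is a point of M with values in the dual of the shuffle
   coalgebra on X; conv extends a bilinear map to points. *)
Definition conv (M N L : lmodType k) (f : M -> N -> L) (u : seq X -> M)
  (v : seq X -> N) : seq X -> L := usum (fun a b => f (u a) (v b)).

Definition pt (M : lmodType k) (c : M) : seq X -> M :=
  fun w => if w is [::] then c else 0.

Section Conv.
Variables (M N L : lmodType k).

Lemma usum_bilinl (f : M -> N -> L) F w n : bilin f ->
  f (usum F w) n = usum (fun a b => f (F a b) n) w.
Proof. by move=> [Hf _]; apply: (linear_usum (mklin (Hf n))). Qed.

Lemma usum_bilinr (f : M -> N -> L) F w m : bilin f ->
  f m (usum F w) = usum (fun a b => f m (F a b)) w.
Proof. by move=> [_ Hf]; apply: (linear_usum (mklin (Hf m))). Qed.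

Lemma linear_conv (K : lmodType k) (g : {linear L -> K}) (f : M -> N -> L) u v w :
  g (conv f u v w) = conv (fun a b => g (f a b)) u v w.
Proof. exact: linear_usum. Qed.

Lemma eq_conv (f g : M -> N -> L) u v w :
  (forall a b, f a b = g a b) -> conv f u v w = conv g u v w.
Proof. by move=> e; apply: eq_usum. Qed.

Lemma conv_ptl (f : M -> N -> L) c v w : bilin f -> conv f (pt c) v w = f c (v w).
Proof.
move=> [Hf _]; rewrite -[RHS](usum_unit (fun b => f c (v b))); apply: eq_usum => -[|x a] b //=.
exact: (linear0 (mklin (Hf (v b)))).
Qed.

Lemma conv_ptr (f : M -> N -> L) c u w : bilin f -> conv f u (pt c) w = f (u w) c.
Proof.
move=> [_ Hf]; rewrite -[RHS](usum_unit (fun b => f (u b) c)) /conv usumC; apply: eq_usum => -[|x a] b //=.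
exact: (linear0 (mklin (Hf (u b)))).
Qed.

Lemma convC (f : M -> N -> L) u v w : conv f u v w = conv (fun b a => f a b) v u w.
Proof. exact: usumC. Qed.

End Conv.

(** Coassociativity of unshuffling extends an associativity law from elements to points. The four
    bilinear maps are independent, so products, actions and tensor pairings are all covered. *)
Lemma convA (A B C D E F : lmodType k) (f : D -> C -> F) (g : A -> B -> D)
   (f' : A -> E -> F) (g' : B -> C -> E) u v r w :
  bilin f -> bilin f' -> (forall a b c, f (g a b) c = f' a (g' b c)) ->
  conv f (conv g u v) r w = conv f' u (conv g' v r) w.
Proof.
move=> Hf Hf' e; rewrite /conv.
under eq_usum => a b do rewrite usum_bilinl //.
rewrite (usumA (fun a b c => f (g (u a) (v b)) (r c))).
by apply: eq_usum => a b; rewrite usum_bilinr //; apply: eq_usum.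
Qed.

Lemma convACA (A B C D E F E' F' G : lmodType k) (f : E -> F -> G) (g : A -> B -> E)
  (h : C -> D -> F) (f' : E' -> F' -> G) (g' : A -> C -> E') (h' : B -> D -> F') u v r s w :
  bilin f -> bilin f' -> (forall a b c d, f (g a b) (h c d) = f' (g' a c) (h' b d)) ->
  conv f (conv g u v) (conv h r s) w = conv f' (conv g' u r) (conv h' v s) w.
Proof.
move=> Hf Hf' e; rewrite /conv.
have L (E0 F0 : lmodType k) (f0 : E0 -> F0 -> G) P Q : bilin f0 ->
    usum (fun a b => f0 (usum P a) (usum Q b)) w =
    usum (fun a b => usum (fun c e => usum (fun c' e' => f0 (P c e) (Q c' e')) b) a) w.
  move=> H0; apply: eq_usum => a b; rewrite usum_bilinl //.
  by apply: eq_usum => c c'; rewrite usum_bilinr.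
rewrite !L // (usumACA (fun a b c d => f (g (u a) (v b)) (h (r c) (s d)))).
by do 3 apply: eq_usum => ? ?.
Qed.

End Unshuffles.
Arguments pt {k X M} c.

Section TensorPoints.
Variables (k : comPzRingType) (X : Type).

Lemma tmap_conv (V W V' W' : lmodType k) (f : {linear V -> V'}) (g : {linear W -> W'})
    (u : seq X -> V) v w :
  tmap f g (conv (@tpair k V W) u v w) =
  conv (@tpair k V' W') (fun a => f (u a)) (fun b => g (v b)) w.
Proof. by rewrite linear_conv; apply: eq_usum => a b; rewrite tmapE. Qed.

Variable V : lmodType k.

Fixpoint ptens n (u : nat -> seq X -> V) : seq X -> tpow V n :=
  match n with
  | 0 => pt (1 : k^o)
  | n'.+1 => conv (@tpair k V (tpow V n')) (u 0) (ptens n' (fun i => u i.+1))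
  end.

Lemma ptensS n u : ptens n.+1 u = conv (@tpair k V (tpow V n)) (u 0) (ptens n (fun i => u i.+1)).
Proof. by []. Qed.

Lemma ptens_ext n u v : (forall j, (j < n)%N -> u j = v j) -> ptens n u = ptens n v.
Proof.
elim: n u v => //= n IH u v e.
by rewrite e // (IH _ (fun i => v i.+1)) // => j lt; apply: e.
Qed.

(** Exchanging two tensor factors exchanges the corresponding points because unshuffling is
    cocommutative. *)
Lemma tswap_ptens n u0 (v : nat -> seq X -> V) w :
  tswap V V (tpow V n) (conv (@tpair k V _) u0 (ptens n.+1 v) w) =
  conv (@tpair k V _) (v 0) (conv (@tpair k V _) u0 (ptens n (fun i => v i.+1))) w.
Proof.
rewrite linear_conv /=.
have E a z : tswap V V (tpow V n) (tpair a z) = tmap (lid V) (tpairl (tpow V n) a) z.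
  exact: tliftE.
rewrite (eq_conv _ _ _ E) convC.
rewrite (@convA _ _ V (tpow V n) V _ _ _ _ _ (@tpair k V _)
   (fun b a => tpair a b)) //; first last.
- by move=> a b c; rewrite tmapE.
- exact: tpair_bilin.
- split=> [v' | z]; first exact: linearP.
  exact: (proj1 (tswap_bilin V V (tpow V n)) z).
by apply: eq_usum => a b; congr tpair; rewrite convC.
Qed.

Lemma trot_ptens n u w :
  trot V n (ptens n.+1 u w) = ptens n.+1 (fun j => if j is j'.+1 then u j' else u n) w.
Proof.
elim: n u w => [|n IH] u w //.
rewrite ptensS [trot V n.+1]/(lcomp _ _) lcompE tmap_conv.
rewrite (_ : (fun b => _) = ptens n.+1 (fun j => if j is j'.+1 then u j'.+1 else u n.+1)).
  exact: tswap_ptens.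
by apply/funext => b; rewrite IH.
Qed.

End TensorPoints.

Lemma bilin_tpair (k : comPzRingType) (V W M : lmodType k)
  (f : {linear tens V W -> M}) : bilin (fun v w => f (tpair v w)).
Proof.
split=> [w | v] a x y.
  by rewrite (proj1 (tpair_bilin V W)) linearP.
by rewrite (proj2 (tpair_bilin V W)) linearP.
Qed.

Section TensorPairs.
Variables (k : comPzRingType) (V W : lmodType k).
Lemma tpairNl (v : V) (w : W) : tpair (- v) w = - tpair v w.
Proof. exact: (linearN (mklin (proj1 (tpair_bilin V W) w))). Qed.
Lemma tpairNr (v : V) (w : W) : tpair v (- w) = - tpair v w.
Proof. exact: (linearN (tpairl W v)). Qed.
Lemma tpairDr (v : V) (w w' : W) : tpair v (w + w') = tpair v w + tpair v w'.
Proof. exact: (linearD (tpairl W v)). Qed.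
Lemma tpairDl (v v' : V) (w : W) : tpair (v + v') w = tpair v w + tpair v' w.
Proof. exact: (linearD (mklin (proj1 (tpair_bilin V W) w))). Qed.
Lemma tpair0r (v : V) : tpair v (0 : W) = 0.
Proof. exact: (linear0 (tpairl W v)). Qed.
Lemma tpair0l (w : W) : tpair (0 : V) w = 0.
Proof. exact: (linear0 (mklin (proj1 (tpair_bilin V W) w))). Qed.
End TensorPairs.

Section AlgebraPoints.
Variables (k : comPzRingType) (H : assocAlgType k) (X : Type).
Local Notation P := (seq X -> H).

Lemma lmulE (a b : H) : lmul a b = amul a b. Proof. by []. Qed.

Lemma amulNl (a c : H) : amul (- a) c = - amul a c.
Proof. exact: (linearN (rmul c)). Qed.

Lemma amulNr (a c : H) : amul c (- a) = - amul c a.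
Proof. exact: (linearN (lmul c)). Qed.

Lemma tactE (W : lmodType k) (a b : H) (z : W) :
  tact H W (tpair a (tpair b z)) = tpair (amul a b) z.
Proof. by rewrite /tact tliftE tmapE. Qed.

Definition pmul (u v : P) : P := conv (@amul k H) u v.
Definition pone : P := pt (aone H).

Lemma pmulA : associative pmul.
Proof.
move=> u v w; apply/funext => x; symmetry.
by apply: convA => [||a b c]; rewrite ?amulA //; apply: amul_bilin.
Qed.

Lemma pmul1l : left_id pone pmul.
Proof.
by move=> u; apply/funext => w; rewrite /pmul conv_ptl ?amul1l //; apply: amul_bilin.
Qed.

Lemma pmul1r : right_id pone pmul.
Proof.
by move=> u; apply/funext => w; rewrite /pmul conv_ptr ?amul1r //; apply: amul_bilin.
Qed.

Definition pmerge i (u : nat -> P) j : P :=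
  if (j < i)%N then u j else if j == i then pmul (u j) (u j.+1) else u j.+1.

Lemma tmul_ptens n i (u : nat -> P) w : (i <= n)%N ->
  tmul H n i (ptens n.+2 u w) = ptens n.+1 (pmerge i u) w.
Proof.
elim: i n u w => [|i IH] [|n] u w // le; rewrite [ptens _ u]ptensS.
- rewrite -[tmul H 0 0]/(tact H _) linear_conv ptensS; symmetry.
  by apply: convA => [||a b c]; rewrite ?tactE //;
    [apply: tpair_bilin | apply: bilin_tpair].
- rewrite -[tmul H n.+1 0]/(tact H _) linear_conv ptensS; symmetry.
  by apply: convA => [||a b c]; rewrite ?tactE //;
    [apply: tpair_bilin | apply: bilin_tpair].
rewrite -[tmul H n.+1 i.+1]/(tmap (lid H) (tmul H n i)) tmap_conv [in RHS]ptensS.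
by apply: eq_usum => a b; rewrite IH.
Qed.

Definition insert_one i (u : nat -> P) j : P :=
  if (j < i)%N then u j else if j == i then pone else u j.-1.

Lemma tins_ptens n i (u : nat -> P) w : (i <= n)%N ->
  tins H n i (ptens n u w) = ptens n.+1 (insert_one i u) w.
Proof.
elim: i n u w => [|i IH] [|n] u w // le; rewrite [ptens _.+1 (insert_one _ _)]ptensS.
- by rewrite conv_ptl //; apply: tpair_bilin.
- by rewrite conv_ptl //; apply: tpair_bilin.
rewrite -[tins H n.+1 i.+1]/(tmap (lid H) (tins H n i)) [in LHS]ptensS tmap_conv.
apply: eq_usum => a b; rewrite IH //; congr tpair.
rewrite (@ptens_ext _ _ _ _ _ (fun j => insert_one i.+1 u j.+1)) // => -[|j] _ //.
by rewrite /insert_one; case: i {IH le}.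
Qed.

End AlgebraPoints.
Arguments pone {k} H X _.

(** * Cocommutative Hopf algebras and the cyclic module E(H) *)

Section TensorSquareProduct.
Variables (k : comPzRingType) (H : assocAlgType k).

Lemma amul2_bilin (z : tens H H) :
  bilin (fun a b : H => tmap (lmul a) (lmul b) z).
Proof.
by split=> [b | a]; [apply: tmap_linl | apply: tmap_linr] => c; apply: lmul_lin.
Qed.
Definition amul2 (y z : tens H H) : tens H H := tlift (amul2_bilin z) y.

Lemma amul2E a b c e :
  amul2 (tpair a b) (tpair c e) = tpair (amul a c) (amul b e).
Proof. by rewrite /amul2 tliftE tmapE. Qed.

Lemma bilin_amul2 : bilin amul2.
Proof.
split=> [z | y]; first exact: linearP.
by apply: (tlift_param (fun z => amul2_bilin z)) => a b r x x'; rewrite linearP.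
Qed.

Lemma amul2_lin :
  (forall r x y z, amul2 (r *: x + y) z = r *: amul2 x z + amul2 y z) *
  (forall r x y z, amul2 z (r *: x + y) = r *: amul2 z x + amul2 z y) *
  (forall z, amul2 0 z = 0) * (forall z, amul2 z 0 = 0).
Proof.
split; [split; [split|] |] => *.
- exact: (proj1 bilin_amul2).
- exact: (proj2 bilin_amul2).
- exact: (linear0 (mklin (proj1 bilin_amul2 _))).
exact: (linear0 (mklin (proj2 bilin_amul2 _))).
Qed.

Lemma amul2Dl x y z : amul2 (x + y) z = amul2 x z + amul2 y z.
Proof. exact: (linearD (mklin (proj1 bilin_amul2 z))). Qed.
Lemma amul2Dr x y z : amul2 z (x + y) = amul2 z x + amul2 z y.
Proof. exact: (linearD (mklin (proj2 bilin_amul2 z))). Qed.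

Lemma amul2A : associative amul2.
Proof.
move=> x y z; elim/tens_ind: x => [|r a b x IH]; rewrite ?amul2_lin // IH.
congr (_ *: _ + _); elim/tens_ind: y {IH x} => [|{}r c d y IH]; rewrite ?amul2_lin // ?IH.
congr (_ *: _ + _); elim/tens_ind: z {IH y} => [|{}r e f z IH]; rewrite ?amul2_lin // ?IH.
by rewrite !amul2E !amulA.
Qed.

Lemma antipode_bilin (S : {linear H -> H}) : bilin (fun a b => amul (S a) b).
Proof.
split=> [b r x y | a]; last exact: (proj2 (amul_bilin)).
by rewrite linearP; apply: (proj1 (amul_bilin)).
Qed.
End TensorSquareProduct.

(** Coassociativity and cocommutativity enter through [gl_dense]: the coproduct of a grouplike point
    is a sum over unshuffles, which has both properties. *)
Record cocommutative_hopf (k : comPzRingType) (H : assocAlgType k)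
    (Delta : {linear H -> tens H H}) (eps : {linear H -> k^o})
    (S : {linear H -> H}) : Prop := CocommutativeHopf {
  deltaM : forall a b, Delta (amul a b) = amul2 (Delta a) (Delta b);
  delta1 : Delta (aone H) = tpair (aone H) (aone H);
  epsM : forall a b, eps (amul a b) = (eps a : k) * eps b;
  eps1 : eps (aone H) = 1;
  antiM : forall a b, S (amul a b) = amul (S b) (S a);
  anti1 : S (aone H) = aone H;
  antiK : involutive S;
  delta_anti : forall a, Delta (S a) = tmap S S (Delta a);
  eps_anti : forall a, eps (S a) = eps a;
  antipode : forall a, tlift (antipode_bilin S) (Delta a) = (eps a : k) *: aone H }.

Section HopfPoints.
Variables (k : comPzRingType) (H : assocAlgType k) (X : Type).
Variables (Delta : {linear H -> tens H H}) (eps : {linear H -> k^o}).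
Variable S : {linear H -> H}.
Hypothesis Hopf : cocommutative_hopf Delta eps S.
Local Notation P := (seq X -> H).

(** A group element over the convolution algebra of functions on words. [gl_nil] is what lets an
    empty share of the letters produce the entry 1 in the pigeonhole argument. *)
Record grouplike (u : P) : Prop := Grouplike {
  gl_delta : forall w, Delta (u w) = conv (@tpair k H H) u u w;
  gl_eps : forall w, eps (u w) = pt (1 : k^o) w;
  gl_nil : u [::] = aone H }.

Definition pinv (u : P) : P := fun w => S (u w).

Lemma gl_one : grouplike (pone H X).
Proof.
split=> [w | w |] //.
  rewrite conv_ptl; last exact: tpair_bilin.
  case: w => [|x w] /=; first exact: (delta1 Hopf).
  by rewrite linear0 -[tpair _ 0]/(tpairl H (aone H) 0) linear0.
by case: w => [|x w] /=; rewrite ?linear0 ?(eps1 Hopf).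
Qed.

Lemma gl_mul u v : grouplike u -> grouplike v -> grouplike (pmul u v).
Proof.
move=> gu gv; split=> [w | w |].
- rewrite linear_conv (eq_conv _ _ _ (deltaM Hopf)).
  rewrite /conv (eq_usum (G := fun a b => amul2 (conv (@tpair k H H) u u a)
    (conv (@tpair k H H) v v b))); last first.
    by move=> a b; rewrite (gl_delta gu) (gl_delta gv).
  apply: convACA => *; [exact: bilin_amul2 | exact: tpair_bilin | exact: amul2E].
- rewrite linear_conv (eq_conv _ _ _ (epsM Hopf)).
  rewrite -[RHS](@usum_unit X _ (pt (1 : k^o))); apply: eq_usum => a b.
  rewrite (gl_eps gu) (gl_eps gv); case: a => [|x a] /=; first by rewrite mul1r.
  by rewrite mul0r.
by rewrite /pmul /conv /= (gl_nil gu) (gl_nil gv) amul1l.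
Qed.

Lemma gl_inv u : grouplike u -> grouplike (pinv u).
Proof.
move=> gu; split=> [w | w |]; rewrite /pinv.
- by rewrite (delta_anti Hopf) (gl_delta gu) tmap_conv.
- by rewrite (eps_anti Hopf) (gl_eps gu).
by rewrite (gl_nil gu) (anti1 Hopf).
Qed.

Lemma pinvM u v : pinv (pmul u v) = pmul (pinv v) (pinv u).
Proof.
apply/funext => w; rewrite /pinv /pmul linear_conv [LHS]convC.
by apply: eq_usum => a b; rewrite (antiM Hopf).
Qed.

Lemma pinvK : involutive pinv.
Proof. by move=> u; apply/funext => w; apply: (antiK Hopf). Qed.

Lemma pmulV u : grouplike u -> pmul (pinv u) u = (pone H X).
Proof.
move=> gu; apply/funext => w; transitivity ((eps (u w) : k) *: aone H).
  rewrite -(antipode Hopf) (gl_delta gu) linear_conv.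
  by apply: eq_usum => a b; rewrite tliftE.
by rewrite (gl_eps gu); case: w => [|x w]; rewrite /= ?scale1r ?scale0r.
Qed.

Lemma pmulVr u : grouplike u -> pmul u (pinv u) = (pone H X).
Proof. by move=> gu; rewrite -{1}(pinvK u) pmulV //; apply: gl_inv. Qed.

Lemma pmulKV u v : grouplike u -> pmul (pinv u) (pmul u v) = v.
Proof. by move=> gu; rewrite pmulA pmulV // pmul1l. Qed.

Lemma pmulVK u v : grouplike u -> pmul u (pmul (pinv u) v) = v.
Proof. by move=> gu; rewrite pmulA pmulVr // pmul1l. Qed.

Fixpoint pprod n (u : nat -> P) : P :=
  if n is n'.+1 then pmul (u 0) (pprod n' (fun i => u i.+1)) else (pone H X).

(** All Sweedler components of a grouplike point are copies of it, so this map only pairs the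
    product of the entries with the unchanged tensor. *)
Lemma sw2_ptens n u w : (forall i, grouplike (u i)) ->
  sw2 Delta n (ptens n u w) = conv (@tpair k _ _) (pprod n u) (ptens n u) w.
Proof.
elim: n u w => [|n IH] u w gu.
  by rewrite /= conv_ptl; [|exact: tpair_bilin].
rewrite ptensS linear_conv.
rewrite /conv (eq_usum (G := fun a b => tlift (sw2_bilin
    (conv (@tpair k _ _) (pprod n (fun i => u i.+1)) (ptens n (fun i => u i.+1)) b))
    (conv (@tpair k H H) (u 0) (u 0) a))); last first.
  by move=> a b; rewrite tliftE (gl_delta (gu 0)) IH.
apply: (@convACA _ _ _ _ _ _ _ _ _ _ _ (fun d y => tlift (sw2_bilin y) d)) => [||a b c d].
- split=> [y | d]; first exact: linearP.
  by apply: (tlift_param (fun y => sw2_bilin y)) => a b r x y; rewrite linearP.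
- exact: tpair_bilin.
by rewrite tliftE tmapE.
Qed.

Lemma sw3_ptens n u w : (forall i, grouplike (u i)) ->
  sw3 Delta n (ptens n.+1 u w) =
  conv (@tpair k _ _) (pprod n.+1 u) (conv (@tpair k _ _) (pprod n.+1 u) (ptens n u)) w.
Proof.
elim: n u w => [|n IH] u w gu.
  rewrite ptensS /= pmul1r conv_ptr; last exact: tpair_bilin.
  rewrite tliftE (gl_delta (gu 0)) tmap_conv.
  by apply: eq_usum => a b; rewrite conv_ptr //; apply: tpair_bilin.
rewrite ptensS linear_conv.
rewrite /conv (eq_usum (G := fun a b => tlift (sw3_bilin2
    (conv (@tpair k _ _) (pprod n.+1 (fun i => u i.+1))
       (conv (@tpair k _ _) (pprod n.+1 (fun i => u i.+1)) (ptens n (fun i => u i.+1))) b))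
    (conv (@tpair k H _) (u 0) (conv (@tpair k H H) (u 0) (u 0)) a))); last first.
  move=> a b; rewrite tliftE (gl_delta (gu 0)) IH // tmap_conv.
  by congr (tlift _ _); apply: eq_usum => c d; rewrite (gl_delta (gu 0)).
rewrite [pprod n.+2 u]/=.
have B3 (U : lmodType k) :
    bilin (fun (d : tens H (tens H H)) (y : tens H (tens H U)) => tlift (sw3_bilin2 y) d).
  split=> [y | d]; first exact: linearP.
  apply: (tlift_param (fun y => sw3_bilin2 y)) => a.
  by apply: (tlift_param (fun y => sw3_bilin1 y a)) => b c r x y; rewrite !linearP.
have B2 (U : lmodType k) :
    bilin (fun (d : tens H H) (y : tens H U) => tlift (sw2_bilin y) d).
  split=> [y | d]; first exact: linearP.
  by apply: (tlift_param (fun y => sw2_bilin y)) => a b r x y; rewrite linearP.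
rewrite -/(conv (fun (d : tens H (tens H H)) y => tlift (sw3_bilin2 y) d) _ _ w).
rewrite (@convACA _ _ _ _ _ _ _ _ _ _ _ _ _ _ (@tpair k _ _) (@amul k H)
   (fun d y => tlift (sw2_bilin y) d)) => [||| a d p y]; [|exact: B3|exact: tpair_bilin|].
  apply: eq_usum => a b; congr tpair.
  apply: convACA => [||b' c q z]; [exact: B2 | exact: tpair_bilin |].
  by rewrite tliftE tmapE.
rewrite tliftE.
have : lcomp (tpairl _ (amul a p)) (tlift (sw2_bilin y)) =1 tlift (sw3_bilin1 (tpair p y) a).
  by apply: tens_ext => b c; rewrite lcompE !tliftE.
by move=> /(_ d) <-.
Qed.

(** The formula of t for a group: u_0 ... u_(n+1) | (u_1 ... u_(n+1))^-1 | u_1 | ... | u_n. *)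
Definition Etu n (u : nat -> P) j : P :=
  match j with
  | 0 => pprod n.+2 u
  | 1 => pinv (pprod n.+1 (fun i => u i.+1))
  | j'.+2 => u j'.+1
  end.

Lemma Et_ptens n u w : (forall i, grouplike (u i)) ->
  Et Delta S n.+1 (ptens n.+2 u w) = (-1) ^+ n.+1 *: ptens n.+2 (Etu n u) w.
Proof.
move=> gu; rewrite lscaleE; congr (_ *: _); rewrite ptensS linear_conv.
rewrite {1}/conv (eq_usum (G := fun a b => tmap (lmul (u 0 a)) (tmap S (lid _))
   (conv (@tpair k _ _) (pprod n.+1 (fun i => u i.+1))
    (conv (@tpair k _ _) (pprod n.+1 (fun i => u i.+1)) (ptens n (fun i => u i.+1))) b))); last first.
  by move=> a b; rewrite tliftE sw3_ptens.
symmetry; rewrite ptensS.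
rewrite (_ : ptens n.+1 _ = fun b => tmap S (lid (tpow H n)) (conv (@tpair k _ _)
    (pprod n.+1 (fun i => u i.+1)) (ptens n (fun i => u i.+1)) b)); last first.
  by apply/funext => b; rewrite tmap_conv.
rewrite [Etu n u 0]/=.
apply: (@convA _ _ _ _ _ _ _ _ (fun a c => tpair a (tmap S (lid (tpow H n)) c)) _
  (fun a z => tmap (lmul a) (tmap S (lid (tpow H n))) z)) => [||a b c].
- split=> [z a x y | a x y z]; first by rewrite (proj1 (tpair_bilin _ _)).
  by rewrite linearP (proj2 (tpair_bilin _ _)).
- split=> [z | a]; last exact: linearP.
  by apply: tmap_linl => b; apply: lmul_lin.
by rewrite tmapE.
Qed.

Lemma epslast_ptens n u w : grouplike (u n) ->
  epslast eps n (ptens n.+1 u w) = ptens n u w.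
Proof.
elim: n u w => [|n IH] u w gu.
  rewrite ptensS linear_conv -[RHS]usum_unit; apply: eq_usum => a b.
  rewrite tliftE (gl_eps gu); case: a => [|x a] /=; rewrite ?mul1r ?mul0r //.
rewrite ptensS -[epslast eps n.+1]/(tmap (lid H) (epslast eps n)) tmap_conv [in RHS]ptensS.
by apply: eq_usum => a b; rewrite IH.
Qed.

Lemma epshead_ptens n u w : grouplike (u 0) ->
  epshead eps (tpow H n) (ptens n.+1 u w) = ptens n (fun i => u i.+1) w.
Proof.
move=> gu; rewrite ptensS linear_conv -[RHS]usum_unit; apply: eq_usum => a b.
by rewrite tliftE (gl_eps gu); case: a => [|x a] /=; rewrite ?scale1r ?scale0r.
Qed.

End HopfPoints.

(** * Homogeneous coordinates on E(H) *)

Section HomogeneousPoints.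
Variables (k : comPzRingType) (H : assocAlgType k) (X : Type).
Variables (Delta : {linear H -> tens H H}) (eps : {linear H -> k^o}).
Variable S : {linear H -> H}.
Hypothesis Hopf : cocommutative_hopf Delta eps S.
Local Notation P := (seq X -> H).
Local Notation gl := (@grouplike k H X Delta eps).
Local Notation inv := (@pinv k H X S).
Local Notation E := (Ecyc Delta eps S).

(** Stands in for a spanning set of group elements: all coefficients of all grouplike tensors
    together detect linear maps. *)
Definition gl_dense : Prop := forall n (M : lmodType k) (F G : {linear tpow H n -> M}),
  (forall u, (forall i, gl (u i)) -> forall w, F (ptens n u w) = G (ptens n u w)) -> F =1 G.

Definition hom (g : nat -> P) j : P :=
  if j is j'.+1 then pmul (inv (g j')) (g j'.+1) else g 0.

(* The tensor g_0 | g_0^-1 g_1 | ... | g_(n-1)^-1 g_n of E_n(H).  In these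
   homogeneous coordinates the cyclic structure of E(H) just permutes,
   drops and repeats the g_i. *)
Definition htens n (g : nat -> P) : seq X -> tpow H n.+1 := ptens n.+1 (hom g).

Lemma htens_ext n g g' : (forall j, (j <= n)%N -> g j = g' j) -> htens n g = htens n g'.
Proof.
move=> e; apply: ptens_ext => -[|j] lt /=; first exact: e.
by rewrite !e // ltnW.
Qed.

Lemma gl_hom g : (forall i, gl (g i)) -> forall i, gl (hom g i).
Proof. by move=> gg [|i] //=; apply: (gl_mul Hopf) => //; apply: (gl_inv Hopf). Qed.

Lemma pprod_hom g n : (forall i, gl (g i)) ->
  pprod n (fun i => hom g i.+1) = pmul (inv (g 0)) (g n).
Proof.
elim: n g => [|n IH] g gg /=; first by rewrite (pmulV Hopf).
by rewrite (IH (fun i => g i.+1)) // -pmulA (pmulVK Hopf).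
Qed.

Lemma E_d n i g w : (i <= n.+1)%N -> (forall i, gl (g i)) ->
  cyc_d E n i (htens n.+1 g w) = htens n (fun j => g (bump i j)) w.
Proof.
rewrite -[cyc_d E n i]/(if (i <= n)%N then tmul H n i else epslast eps n.+1).
move=> le gg; case: ifP => [le' | /negbT]; last first.
  rewrite -ltnNge => lt; have {le lt} -> : i = n.+1 by lia.
  rewrite /htens (epslast_ptens _ (gl_hom gg n.+1)) -/(htens n g).
  by congr (_ w); apply: htens_ext => j jn; rewrite /bump leqNgt ltnS jn.
rewrite /htens tmul_ptens //; congr (_ w); apply: ptens_ext => j jn; rewrite /pmerge.
case: ltngtP => [lt | lt | ->].
- by case: j lt {jn} => [|j] lt /=; rewrite /bump; [congr g | congr (pmul (inv (g _)) (g _))]; lia.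
- by case: j lt {jn} => [|j] lt //=; rewrite /bump; congr (pmul (inv (g _)) (g _)); lia.
case: i {le le' j jn} => [|i] /=; first by rewrite (pmulVK Hopf).
rewrite -pmulA (pmulVK Hopf) // /bump.
by congr (pmul (inv (g _)) (g _)); lia.
Qed.

Lemma E_s n i g w : (i <= n)%N -> (forall i, gl (g i)) ->
  cyc_s E n i (htens n g w) = htens n.+1 (fun j => g (unbump i j)) w.
Proof.
rewrite -[cyc_s E n i]/(tins H n.+1 i.+1) => le gg; rewrite /htens tins_ptens //; congr (_ w).
apply: ptens_ext => j jn; rewrite /insert_one.
case: ltngtP => [lt | lt | ->].
- by case: j lt {jn} => [|j] lt /=; rewrite /unbump; [congr g | congr (pmul (inv (g _)) (g _))]; lia.
- case: j lt {jn} => [|[|j]] lt //=; rewrite /unbump.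
  by congr (pmul (inv (g _)) (g _)); lia.
rewrite /= /unbump -[LHS](pmulV Hopf (gg i)).
by congr (pmul (inv (g _)) (g _)); lia.
Qed.

Definition rotidx n j := if j is j'.+1 then j' else n.

Lemma E_t n g w : (forall i, gl (g i)) ->
  cyc_t E n (htens n g w) = (-1) ^+ n *: htens n (fun j => g (rotidx n j)) w.
Proof.
move=> gg; case: n => [|n]; first by rewrite expr0 scale1r.
rewrite -[cyc_t E n.+1]/(Et Delta S n.+1) (Et_ptens _ _ _ (gl_hom gg)).
congr (_ *: _ w); apply: ptens_ext => -[|[|j]] jn //.
  rewrite -[Etu _ _ _ _]/(pmul (g 0) (pprod n.+1 (fun i => hom g i.+1))).
  by rewrite pprod_hom // (pmulVK Hopf).
by rewrite /Etu (pprod_hom n.+1 gg) (pinvM Hopf) (pinvK Hopf).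
Qed.

Lemma E_extra n g w : (forall i, gl (g i)) ->
  extra E n (htens n g w) = htens n.+1 (fun j => if j is j'.+1 then g j' else g n) w.
Proof.
move=> gg; rewrite extraE E_s // E_t // scalerA -exprD addnn -signr_odd odd_double.
rewrite scale1r; congr (_ w); apply: htens_ext => -[|j] jn /=; congr g; rewrite /unbump; lia.
Qed.

Lemma iter_E_t n i g w : (forall i, gl (g i)) ->
  iter i (cyc_t E n) (htens n g w) =
  (-1) ^+ (n * i) *: htens n (fun j => g (iter i (rotidx n) j)) w.
Proof.
move=> gg; elim: i => [|i IH]; first by rewrite muln0 scale1r.
rewrite iterS IH linearZ /= E_t // scalerA -exprD mulnS addnC; congr (_ *: _ w).
by apply: htens_ext => j _; rewrite -iterSr.
Qed.

Lemma iter_rotidx n i j : (j <= n)%N -> (i <= n.+1)%N ->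
  iter i (rotidx n) j = (if i <= j then j - i else j + n.+1 - i)%N.
Proof.
move=> jn; elim: i => [|i IH] lt; first by rewrite subn0.
rewrite iterS IH ?(ltnW lt) //; case: (leqP i j) => l1; case: (leqP i.+1 j) => l2; rewrite /rotidx;
  case E: subn => [|m]; lia.
Qed.

Lemma ptens_htens n u : (forall i, gl (u i)) ->
  exists2 g, forall i, gl (g i) & ptens n.+1 u = htens n g.
Proof.
(* The partial products u_0 ... u_j, whose successive quotients are the u_j. *)
move=> gu; pose g := fix g j := if j is j'.+1 then pmul (g j') (u j) else u 0.
have gg i : gl (g i) by elim: i => //= i IH; apply: (gl_mul Hopf).
by exists g => //; apply: ptens_ext => -[|j] _ //=; rewrite (pmulKV Hopf).
Qed.

Section Dense.
Hypothesis dense : gl_dense.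

Lemma htens_dense n (M : lmodType k) (F G : {linear tpow H n.+1 -> M}) :
  (forall g, (forall i, gl (g i)) -> forall w, F (htens n g w) = G (htens n g w)) -> F =1 G.
Proof.
by move=> FG; apply: dense => u gu w; have [g gg ->] := ptens_htens n gu; apply: FG.
Qed.

Lemma E_cyclic_faces : cyclic_faces E.
Proof.
split=> [n i j x le | n i x le | n x | n x].
- refine (@htens_dense n.+2 _ (lcomp (cyc_d E n i) (cyc_d E n.+1 j))
            (lcomp (cyc_d E n j.-1) (cyc_d E n.+1 i)) _ x) => g gg w.
  rewrite !lcompE !E_d //; try lia; congr (_ w); apply: htens_ext => l ln.
  by congr g; rewrite /bump; lia.
- rewrite -scaleN1r; refine (@htens_dense n.+1 _ (lcomp (cyc_d E n i.+1) (cyc_t E n.+1))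
    (lscale (-1) (lcomp (cyc_t E n) (cyc_d E n i))) _ x) => g gg w.
  rewrite lscaleE [LHS]lcompE [X in _ *: X]lcompE [cyc_t E n.+1 _]E_t // [LHS]linearZZ !E_d //; try lia.
  rewrite [cyc_t E n _]E_t // scalerA -exprS /=; congr (_ *: _ w); apply: htens_ext => l ln.
  by congr g; case: l ln => [|l] ln; rewrite ?bumpS //= /bump le.
- refine (@htens_dense n.+1 _ (lcomp (cyc_d E n 0) (cyc_t E n.+1))
    (lscale ((-1) ^+ n.+1) (cyc_d E n n.+1)) _ x) => g gg w.
  rewrite lscaleE lcompE [cyc_t E n.+1 _]E_t // [LHS]linearZZ !E_d //.
  congr (_ *: _ w); apply: htens_ext => l ln.
  by rewrite /bump /= ltnNge ln.
refine (@htens_dense n _ (mklin (@iter_linear _ E n n.+1)) (lid _) _ x) => g gg w.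
rewrite lidE -[LHS]/(iter n.+1 (cyc_t E n) (htens n g w)) iter_E_t //.
(* The sign accumulated by n + 1 rotations is (-1)^(n (n + 1)) = 1. *)
rewrite -signr_odd oddM /= andbN expr0 scale1r; congr (_ w); apply: htens_ext => l ln.
by rewrite -iterS iter_rotidx // ifN ?addnK //; lia.
Qed.

Lemma E_simplicial_degen : simplicial_degen E.
Proof.
split=> [n i j x le | n j x le | n j x le | n i j x le | n j x le].
- refine (@htens_dense n.+1 _ (lcomp (cyc_d E n.+1 i) (cyc_s E n.+1 j))
    (lcomp (cyc_s E n j.-1) (cyc_d E n i)) _ x) => g gg w.
  rewrite !lcompE E_s ?E_d ?E_s //; try lia; congr (_ w); apply: htens_ext => l ln.
  by congr g; rewrite /bump /unbump; lia.
- refine (@htens_dense n _ (lcomp (cyc_d E n j) (cyc_s E n j)) (lid _) _ x) => g gg w.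
  rewrite lidE lcompE E_s ?E_d //; try lia; congr (_ w); apply: htens_ext => l ln.
  by congr g; rewrite /bump /unbump; lia.
- refine (@htens_dense n _ (lcomp (cyc_d E n j.+1) (cyc_s E n j)) (lid _) _ x) => g gg w.
  rewrite lidE lcompE E_s ?E_d //; try lia; congr (_ w); apply: htens_ext => l ln.
  by congr g; rewrite /bump /unbump; lia.
- refine (@htens_dense n.+1 _ (lcomp (cyc_d E n.+1 i) (cyc_s E n.+1 j))
    (lcomp (cyc_s E n j) (cyc_d E n i.-1)) _ x) => g gg w.
  rewrite !lcompE E_s ?E_d ?E_s //; try lia; congr (_ w); apply: htens_ext => l ln.
  by congr g; rewrite /bump /unbump; lia.
refine (@htens_dense n _ (lcomp (cyc_s E n.+1 n.+1) (cyc_s E n j))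
    (lcomp (cyc_s E n.+1 j) (cyc_s E n n)) _ x) => g gg w.
rewrite !lcompE !E_s //; try lia; congr (_ w); apply: htens_ext => l ln.
by congr g; rewrite /unbump; lia.
Qed.

Lemma E_cyclic_degen : cyclic_degen E.
Proof.
split=> [n j x le | n x].
- rewrite -scaleN1r; refine (@htens_dense n _ (lcomp (cyc_s E n j.+1) (cyc_t E n))
    (lscale (-1) (lcomp (cyc_t E n.+1) (cyc_s E n j))) _ x) => g gg w.
  rewrite lscaleE [LHS]lcompE [X in _ *: X]lcompE [cyc_t E n _]E_t // [LHS]linearZZ !E_s //; try lia.
  rewrite [cyc_t E n.+1 _]E_t // scalerA -exprS [(-1) ^+ n.+2]exprS exprS mulrA.
  rewrite mulN1r opprK mul1r; congr (_ *: _ w); apply: htens_ext => l ln.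
  by congr g; case: l ln => [|l] ln; rewrite ?unbumpS //= /unbump; lia.
refine (@htens_dense n _ (lcomp (cyc_s E n 0) (cyc_t E n))
    (lscale ((-1) ^+ n) (lcomp (cyc_t E n.+1) (lcomp (cyc_t E n.+1) (cyc_s E n n)))) _ x) => g gg w.
rewrite lscaleE [LHS]lcompE [X in _ *: X]lcompE [X in _ *: cyc_t _ _ X]lcompE.
rewrite [cyc_t E n _]E_t // [LHS]linearZZ !E_s //; try lia.
rewrite [cyc_t E n.+1 (htens _ _ _)]E_t // [cyc_t E n.+1 _]linearZZ [cyc_t E n.+1 _]E_t // !scalerA
  -mulrA -exprD addnn -mul2n exprM sqrrN !expr1n mulr1.
congr (_ *: _ w); apply: htens_ext => l ln.
by congr g; case: l ln => [|[|l]] ln; rewrite /unbump /= ?ltnn ?subn0 ?subSS //; lia.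
Qed.

End Dense.
End HomogeneousPoints.

Lemma usum0_size (X : Type) (M : zmodType) (F : seq X -> seq X -> M) w :
  (forall a b, (size a + size b = size w)%N -> F a b = 0) -> usum F w = 0.
Proof.
elim: w F => [|x w IH] F F0 /=; first exact: F0.
by rewrite !IH ?addr0 // => a b e; apply: F0; rewrite /= -e ?addnS.
Qed.

Section Pigeonhole.
Variables (k : comPzRingType) (H : assocAlgType k) (X : Type).

(* A word shorter than the number of factors leaves one of them empty. *)
Lemma ptens_short n (M : lmodType k) (F : {linear tpow H n.+1 -> M})
    (v : nat -> seq X -> H) w :
  (forall j, v j [::] = aone H) -> (size w <= n)%N ->
  (forall j y, (j <= n)%N -> F (tins H n j y) = 0) -> F (ptens n.+1 v w) = 0.
Proof.
move=> + + HF; elim: n M F HF v w => [|n IH] M F HF v w v1 sw.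
  by case: w sw => // _; rewrite ptensS /conv /= v1 -[tpair _ _]/(tins H 0 0 1) HF.
rewrite ptensS linear_conv; apply: usum0_size => a b e; case: a e => [|x a] e.
  by rewrite v1 -[tpair _ _]/(tins H n.+1 0 (ptens n.+1 _ b)) HF.
apply: (IH _ (lcomp F (tpairl _ (v 0 (x :: a))))) => [j y jn | j | ] //.
  rewrite lcompE tpairlE.
  have -> : tpair (v 0 (x :: a)) (tins H n j y) =
            tins H n.+1 j.+1 (tpair (v 0 (x :: a)) y).
    by rewrite -[tins H n.+1 j.+1]/(tmap (lid H) (tins H n j)) tmapE.
  exact: HF.
by move: sw; rewrite -e /=; lia.
Qed.

End Pigeonhole.

(** * Degeneracy of B' on short words, and cyclicity of tau *)

Section Comparison.
Variables (k : comPzRingType) (H : assocAlgType k) (X : Type).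
Variables (Delta : {linear H -> tens H H}) (eps : {linear H -> k^o}).
Variable S : {linear H -> H}.
Hypothesis Hopf : cocommutative_hopf Delta eps S.
Local Notation P := (seq X -> H).
Local Notation gl := (@grouplike k H X Delta eps).
Local Notation inv := (@pinv k H X S).
Local Notation E := (Ecyc Delta eps S).
Local Notation C := (Ccyc H).
Local Notation htens := (htens S).

(** Degeneracies of E(H) insert 1 after the first entry, so only the n other factors count and the
    word must have fewer than n letters. *)
Lemma ptens_degenerate n (v : nat -> P) w :
  (forall j, v j [::] = aone H) -> (size w < n)%N ->
  qproj (@degenerate k E n) (ptens n.+1 v w) = 0.
Proof.
case: n => [//|n] v1 sw; rewrite ptensS linear_conv; apply: usum0_size => a b e.
apply: (ptens_short (F := lcomp (qproj (@degenerate k E n.+1)) (tpairl _ (v 0 a)))) => [j||j y jn] //.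
  by lia.
rewrite lcompE tpairlE; apply: qproj_sub; exists j, (tpair (v 0 a) y); split=> //.
by rewrite -[cyc_s E n j]/(tmap (lid H) (tins H n j)) tmapE.
Qed.

(** In homogeneous coordinates every term of B' is again a tensor of grouplike points, now with n +
    1 factors after the first, while the word still has at most n letters. *)
Lemma connes_htens_degenerate n g w : (forall i, gl (g i)) -> (size w <= n)%N ->
  qproj (@degenerate k E n.+1) (connes E n (htens n g w)) = 0.
Proof.
move=> gg sw.
have h0 g' : (forall i, gl (g' i)) -> qproj (@degenerate k E n.+1) (htens n.+1 g' w) = 0.
  move=> gg'; apply: ptens_degenerate => [j|]; last by [].
  exact: (gl_nil (gl_hom Hopf gg' j)).
have e0 g' : (forall i, gl (g' i)) ->
    qproj (@degenerate k E n.+1) (extra E n (htens n g' w)) = 0.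
  by move=> gg'; rewrite E_extra // h0 // => -[|i].
have te0 g' : (forall i, gl (g' i)) ->
    qproj (@degenerate k E n.+1) (cyc_t E n.+1 (extra E n (htens n g' w))) = 0.
  move=> gg'; rewrite E_extra // E_t // => [|[|i]] //.
  by rewrite [LHS]linearZZ h0 ?scaler0 // => -[|[|i]] /=.
have N0 (F : {linear E n -> quot (@degenerate k E n.+1)}) :
    (forall g', (forall i, gl (g' i)) -> F (htens n g' w) = 0) ->
    F (cnorm E n (htens n g w)) = 0.
  move=> F0; rewrite cnormE linear_sum big1 // => i _.
  by rewrite iter_E_t // linearZZ F0 ?scaler0.
rewrite connesE linearB /=; set y := cnorm E n _.
have -> : qproj (@degenerate k E n.+1) (extra E n y) = 0.
  exact: (N0 (lcomp (qproj _) (extra E n))).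
have -> : qproj (@degenerate k E n.+1) (cyc_t E n.+1 (extra E n y)) = 0.
  exact: (N0 (lcomp (qproj _) (lcomp (cyc_t E n.+1) (extra E n)))).
by rewrite subrr.
Qed.

(** The coordinates of tau: g_n^-1 g_0 | g_0^-1 g_1 | ... | g_(n-1)^-1 g_n. The chain is closed up
    into a cycle, which makes the compatibility with rotations visible. *)
Definition cycu n (g : nat -> P) j : P :=
  if j is j'.+1 then pmul (inv (g j')) (g j'.+1) else pmul (inv (g n)) (g 0).

(** tau precomposed with the passage to coinvariants, so that it can be compared with the cyclic
    structure of E(H) on grouplike tensors. *)
Definition Etau n : {linear E n -> C n} := lcomp (tau Delta eps S n) (epshead eps (tpow H n)).

Lemma Etau_ptens n g w : (forall i, gl (g i)) ->
  Etau n (htens n g w) = ptens n.+1 (cycu n g) w.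
Proof.
move=> gg; rewrite lcompE (epshead_ptens _ _ (gl_hom Hopf gg 0)).
rewrite lcompE (sw2_ptens _ _ (fun i => gl_hom Hopf gg i.+1)).
rewrite tmap_conv ptensS; apply: eq_usum => a b.
rewrite (pprod_hom Hopf n gg) -/(inv (pmul (inv (g 0)) (g n)) a).
by rewrite (pinvM Hopf) (pinvK Hopf).
Qed.

Definition rotu n (u : nat -> P) j := if j is j'.+1 then u j' else u n.

Lemma C_d n i (u : nat -> P) w :
  cyc_d C n i (ptens n.+2 u w) =
  ptens n.+1 (if (i <= n)%N then pmerge i u else pmerge 0 (rotu n.+1 u)) w.
Proof.
rewrite -[cyc_d C n i]/(if (i <= n)%N then tmul H n i else lcomp (tmul H n 0) (trot H n.+1)).
case: ifP => le; first exact: tmul_ptens.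
by rewrite lcompE trot_ptens tmul_ptens.
Qed.

Lemma C_s n i (u : nat -> P) w : (i <= n)%N ->
  cyc_s C n i (ptens n.+1 u w) = ptens n.+2 (insert_one i.+1 u) w.
Proof. by move=> le; apply: tins_ptens. Qed.

Lemma C_t n (u : nat -> P) w :
  cyc_t C n (ptens n.+1 u w) = (-1) ^+ n *: ptens n.+1 (rotu n u) w.
Proof. by rewrite -[cyc_t C n]/(lscale _ (trot H n)) lscaleE trot_ptens. Qed.

Section Dense.
Hypothesis dense : gl_dense X Delta eps.

Lemma Etau_d n i x : (i <= n.+1)%N ->
  Etau n (cyc_d E n i x) = cyc_d C n i (Etau n.+1 x).
Proof.
move=> le; refine (@htens_dense _ _ X _ _ _ Hopf dense n.+1 _ (lcomp (Etau n) (cyc_d E n i))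
  (lcomp (cyc_d C n i) (Etau n.+1)) _ x) => g gg w.
rewrite [LHS]lcompE [RHS]lcompE Etau_ptens // E_d // Etau_ptens // C_d; congr (_ w); apply: ptens_ext => j jn.
case: ifP => [le' | /negbT]; last first.
  rewrite -ltnNge => lt; have {le lt} -> : i = n.+1 by lia.
  case: j jn => [|j] jn; rewrite /pmerge /rotu /cycu /bump /=.
    by rewrite ltnn -pmulA (pmulVK Hopf).
  by congr (pmul (inv (g _)) (g _)); lia.
rewrite /pmerge; case: ltngtP => [lt | lt | ->].
- by case: j lt {jn} => [|j] lt /=; rewrite /bump; congr (pmul (inv (g _)) (g _)); lia.
- by case: j lt {jn} => [|j] lt //=; rewrite /bump; congr (pmul (inv (g _)) (g _)); lia.
rewrite /cycu /bump; case: i {le jn j} le' => [|i] le' /=.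
  by rewrite -pmulA (pmulVK Hopf).
by rewrite -pmulA (pmulVK Hopf) //; congr (pmul (inv (g _)) (g _)); lia.
Qed.

Lemma Etau_s n i x : (i <= n)%N ->
  Etau n.+1 (cyc_s E n i x) = cyc_s C n i (Etau n x).
Proof.
move=> le; refine (@htens_dense _ _ X _ _ _ Hopf dense n _ (lcomp (Etau n.+1) (cyc_s E n i))
  (lcomp (cyc_s C n i) (Etau n)) _ x) => g gg w.
rewrite [LHS]lcompE [RHS]lcompE Etau_ptens // E_s // Etau_ptens // C_s //; congr (_ w); apply: ptens_ext => j jn.
rewrite /insert_one; case: ltngtP => [lt | lt | ->].
- by case: j lt {jn} => [|j] lt /=; rewrite /unbump; congr (pmul (inv (g _)) (g _)); lia.
- by case: j lt {jn} => [|[|j]] lt //=; rewrite /unbump; congr (pmul (inv (g _)) (g _)); lia.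
rewrite /= /unbump -[RHS](pmulV Hopf (gg i)).
by congr (pmul (inv (g _)) (g _)); lia.
Qed.

Lemma Etau_t n x : Etau n (cyc_t E n x) = cyc_t C n (Etau n x).
Proof.
refine (@htens_dense _ _ X _ _ _ Hopf dense n _ (lcomp (Etau n) (cyc_t E n))
  (lcomp (cyc_t C n) (Etau n)) _ x) => g gg w.
rewrite [LHS]lcompE [RHS]lcompE Etau_ptens // C_t E_t // [LHS]linearZZ Etau_ptens //.
congr (_ *: _ w); apply: ptens_ext => -[|j] jn //=.
  by case: n jn {x}.
by case: j jn.
Qed.

Lemma Etau_bdry n x : Etau n (bdry E n x) = bdry C n (Etau n.+1 x).
Proof.
rewrite !bdryE linear_sum; apply: eq_bigr => i _.
by rewrite linearZZ Etau_d // -ltnS.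
Qed.

Lemma Etau_connes n x : Etau n.+1 (connes E n x) = connes C n (Etau n x).
Proof.
have N : Etau n (cnorm E n x) = cnorm C n (Etau n x).
  rewrite !cnormE linear_sum; apply: eq_bigr => i _.
  by elim: (i : nat) => [//|j IH]; rewrite !iterS Etau_t IH.
have X' y : Etau n.+1 (extra E n y) = extra C n (Etau n y).
  by rewrite !extraE linearZZ Etau_t Etau_s.
by rewrite !connesE linearB Etau_t X' N.
Qed.

End Dense.
End Comparison.

(** * Degeneracies and rotations of the cyclic module of an algebra *)

Section AlgebraDegeneracies.
Variables (k : comPzRingType) (H : assocAlgType k) (X : Type).
Local Notation P := (seq X -> H).
Local Notation C := (Ccyc H).

Hypothesis dense : forall n (M : lmodType k) (F G : {linear tpow H n -> M}),
  (forall (u : nat -> P) w, F (ptens n u w) = G (ptens n u w)) -> F =1 G.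

Let eqC n (M : lmodType k) (F G : {linear C n -> M}) x :
  (forall (u : nat -> P) w, F (ptens n.+1 u w) = G (ptens n.+1 u w)) -> F x = G x.
Proof. by move=> FG; apply: dense. Qed.

Ltac same_index := first
  [ reflexivity |
    exfalso; lia
  | match goal with |- pmul (?f ?a) (?f ?b) = pmul (?f ?c) (?f ?d) =>
      replace c with a by lia; replace d with b by lia; reflexivity end
  | match goal with |- ?f ?a = ?f ?b =>
      replace b with a by lia; reflexivity end ].
Ltac idx := rewrite /pmerge /insert_one /rotu /=;
  repeat (case: ifP => [? | /negbT ?]); rewrite /= ?pmul1r ?pmul1l; same_index.

Lemma C_simplicial_degen : simplicial_degen C.
Proof.
split=> [n i j x le | n j x le | n j x le | n i j x le | n j x le].
- refine (@eqC n.+1 _ (lcomp (cyc_d C n.+1 i) (cyc_s C n.+1 j))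
    (lcomp (cyc_s C n j.-1) (cyc_d C n i)) x _) => u w.
  rewrite [LHS]lcompE [RHS]lcompE C_s ?C_d ?C_s //; try lia.
  congr (_ w); apply: ptens_ext => l ln; rewrite !ifT; try lia.
  by case: j le => [//|j] le /=; idx.
- refine (@eqC n _ (lcomp (cyc_d C n j) (cyc_s C n j)) (lid _) x _) => u w.
  rewrite [LHS]lcompE lidE C_s ?C_d ?C_s //; try lia.
  congr (_ w); apply: ptens_ext => l ln; rewrite !ifT; try lia.
  by idx.
- refine (@eqC n _ (lcomp (cyc_d C n j.+1) (cyc_s C n j)) (lid _) x _) => u w.
  rewrite [LHS]lcompE lidE C_s ?C_d ?C_s //; try lia.
  congr (_ w); apply: ptens_ext => l ln; case: ifP => jn; first by idx.
  by case: l ln => [|l] ln; idx.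
- refine (@eqC n.+1 _ (lcomp (cyc_d C n.+1 i) (cyc_s C n.+1 j))
    (lcomp (cyc_s C n j) (cyc_d C n i.-1)) x _) => u w.
  rewrite [LHS]lcompE [RHS]lcompE C_s ?C_d ?C_s //; try lia.
  congr (_ w); apply: ptens_ext => l ln; case: i le => [//|i] le /=; rewrite ltnS.
  case: ifP => jn; first by idx.
  by case: l ln => [|l] ln; idx.
refine (@eqC n _ (lcomp (cyc_s C n.+1 n.+1) (cyc_s C n j))
    (lcomp (cyc_s C n.+1 j) (cyc_s C n n)) x _) => u w.
rewrite [LHS]lcompE [RHS]lcompE !C_s //; try lia.
by congr (_ w); apply: ptens_ext => l ln; idx.
Qed.

Lemma C_cyclic_degen : cyclic_degen C.
Proof.
split=> [n j x le | n x].
- rewrite -scaleN1r; refine (@eqC n _ (lcomp (cyc_s C n j.+1) (cyc_t C n))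
    (lscale (-1) (lcomp (cyc_t C n.+1) (cyc_s C n j))) x _) => u w.
  rewrite lscaleE [LHS]lcompE [X in _ *: X]lcompE [cyc_t C n _]C_t [LHS]linearZZ !C_s //; try lia.
  rewrite [cyc_t C n.+1 _]C_t scalerA -exprS [(-1) ^+ n.+2]exprS exprS mulrA.
  rewrite mulN1r opprK mul1r; congr (_ *: _ w); apply: ptens_ext => l ln.
  by case: l ln => [|[|l]] ln; idx.
refine (@eqC n _ (lcomp (cyc_s C n 0) (cyc_t C n))
    (lscale ((-1) ^+ n) (lcomp (cyc_t C n.+1) (lcomp (cyc_t C n.+1) (cyc_s C n n)))) x _) => u w.
rewrite lscaleE [LHS]lcompE [X in _ *: X]lcompE [X in _ *: cyc_t _ _ X]lcompE.
rewrite [cyc_t C n _]C_t [LHS]linearZZ !C_s //; try lia.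
rewrite [cyc_t C n.+1 (ptens _ _ _)]C_t [cyc_t C n.+1 _]linearZZ [cyc_t C n.+1 _]C_t.
rewrite !scalerA -mulrA -exprD addnn -mul2n exprM sqrrN !expr1n mulr1.
congr (_ *: _ w); apply: ptens_ext => l ln.
by case: l ln => [|[|l]] ln; idx.
Qed.

Lemma C_tt_id n x : iter n.+1 (cyc_t C n) x = x.
Proof.
refine (@eqC n _ (mklin (@iter_linear _ C n n.+1)) (lid _) x _) => u w.
rewrite lidE -[LHS]/(iter n.+1 (cyc_t C n) (ptens n.+1 u w)).
have iter_t i : iter i (cyc_t C n) (ptens n.+1 u w) =
    (-1) ^+ (n * i) *: ptens n.+1 (fun j => u (iter i (rotidx n) j)) w.
  elim: i => [|i IH]; first by rewrite muln0 scale1r.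
  rewrite iterS IH [LHS]linearZZ C_t scalerA -exprD mulnS addnC; congr (_ *: _ w).
  by apply: ptens_ext => j _; rewrite /rotu iterSr; case: j.
rewrite iter_t -signr_odd oddM oddS andbN expr0 scale1r; congr (_ w); apply: ptens_ext => l ln.
by rewrite iter_rotidx // ifN ?addnK //; lia.
Qed.

Lemma C_extra n x : extra C n x = tpair (aone H) x.
Proof.
refine (@eqC n _ (extra C n) (tpairl _ (aone H)) x _) => u w.
rewrite extraE C_s // C_t scalerA -exprD addnn -mul2n exprM sqrrN !expr1n scale1r.
transitivity (ptens n.+2 (fun j => if j is j'.+1 then u j' else pone H X) w).
  by congr (_ w); apply: ptens_ext => l ln; case: l ln => [|l] ln; idx.
by rewrite ptensS conv_ptl //; apply: tpair_bilin.
Qed.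

End AlgebraDegeneracies.

(** * The Hopf algebra U(g) *)

Section EnvelopingHopf.
Variables (k : comPzRingType) (g : lieAlgType k).
Local Notation U := (Ug g).
Local Notation Delta := (udelta g).
Local Notation eps := (ueps g).
Local Notation S := (uanti g).

Lemma uword_cons (x : g) w : uword (x :: w) = amul (uinj x) (uword w) :> U.
Proof. by rewrite /amul /= umulE. Qed.

Lemma Ug_ext (M : lmodType k) (F G : {linear U -> M}) :
  F (aone U) = G (aone U) ->
  (forall x a, F a = G a -> F (amul (uinj x) a) = G (amul (uinj x) a)) -> F =1 G.
Proof.
move=> e1 eM; apply: (@pres_ext _ _ _ _ F G); try exact: linearP.
elim=> [|x w IH]; first exact: e1.
by rewrite -/(uword _) uword_cons; apply: eM.
Qed.

Lemma uact_one (N : lmodType k) phi n0 (Hphi : @bilin k g N N phi) Hlie :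
  uact n0 Hphi Hlie (aone U) = n0.
Proof. exact: (uactE n0 Hphi Hlie [::]). Qed.

Lemma uact_mul (N : lmodType k) phi n0 (Hphi : @bilin k g N N phi) Hlie x a :
  uact n0 Hphi Hlie (amul (uinj x) a) = phi x (uact n0 Hphi Hlie a).
Proof.
apply: (@pres_ext _ _ _ _ (lcomp (uact n0 Hphi Hlie) (lmul (uinj x)))
  (lcomp (mklin (proj2 Hphi x)) (uact n0 Hphi Hlie))); try exact: linearP.
by move=> w; rewrite !lcompE -/(uword w) -[lmul _ _]/(amul _ _) -uword_cons !uactE.
Qed.

Lemma deltaX x a : Delta (amul (uinj x) a) = udelta_act x (Delta a).
Proof. exact: uact_mul. Qed.
Lemma epsX x a : eps (amul (uinj x) a) = 0.
Proof. exact: uact_mul. Qed.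
Lemma antiX x a : S (amul (uinj x) a) = - amul (S a) (uinj x).
Proof. exact: uact_mul. Qed.
Lemma anti_prim x : S (uinj x) = - uinj x.
Proof.
by rewrite -[uinj x in LHS](@amul1r k U) antiX [S _]uact_one amul1l.
Qed.
Lemma delta_prim x : Delta (uinj x) = tpair (uinj x) (aone U) + tpair (aone U) (uinj x).
Proof.
rewrite -[uinj x in LHS](@amul1r k U) deltaX [Delta _]uact_one /udelta_act !tmapE.
by rewrite !lmulE !amul1r.
Qed.

Lemma udelta_actE x z : udelta_act x z = amul2 (Delta (uinj x)) z.
Proof.
rewrite delta_prim amul2Dl.
elim/tens_ind: z => [|r a b z IH]; first by rewrite !amul2_lin addr0;
  apply: (linear0 (mklin (proj2 (udelta_bilin g) x))).
by rewrite (proj2 (udelta_bilin g)) IH !amul2_lin !amul2E !amul1l scalerDr addrACA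
  /udelta_act !tmapE.
Qed.

Lemma enveloping_deltaM a b : Delta (amul a b) = amul2 (Delta a) (Delta b).
Proof.
pose R := mklin (proj1 (@bilin_amul2 k U) (Delta b)).
have : lcomp Delta (rmul b) =1 lcomp R Delta; last by apply.
apply: Ug_ext => [|x c].
  rewrite !lcompE -[R _]/(amul2 _ _) -[rmul _ _]/(amul _ _) amul1l [Delta (aone U)]uact_one.
  elim/tens_ind: (Delta b) => [|r c d z IH]; rewrite ?amul2_lin //.
  by rewrite amul2E !amul1l -IH.
rewrite !lcompE -![R _]/(amul2 _ _) -![rmul _ _]/(amul _ _) => IH.
by rewrite -amulA !deltaX IH !udelta_actE amul2A.
Qed.

Lemma enveloping_antiM a b : S (amul a b) = amul (S b) (S a).
Proof.
have : lcomp S (rmul b) =1 lcomp (lmul (S b)) S; last by apply.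
apply: Ug_ext => [|x c].
  by rewrite !lcompE -[rmul _ _]/(amul _ _) amul1l [S (aone U)]uact_one lmulE amul1r.
rewrite !lcompE -![rmul _ _]/(amul _ _) !lmulE => IH.
by rewrite -amulA !antiX IH amulNr amulA.
Qed.

Lemma enveloping_epsM a b : eps (amul a b) = (eps a : k) * eps b.
Proof.
have : lcomp eps (rmul b) =1 lscale (eps b : k) eps.
  apply: Ug_ext => [|x c _]; rewrite lcompE lscaleE -[rmul _ _]/(amul _ _).
    by rewrite amul1l [eps (aone U)]uact_one [RHS]mulr1.
  by rewrite -amulA !epsX scaler0.
by move=> /(_ a); rewrite lcompE lscaleE => ->; rewrite [LHS]mulrC.
Qed.

Lemma enveloping_hopf : cocommutative_hopf Delta eps S.
Proof.
split.
- exact: enveloping_deltaM.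
- exact: uact_one.
- exact: enveloping_epsM.
- exact: uact_one.
- exact: enveloping_antiM.
- exact: uact_one.
- move=> a; have : lcomp S S =1 lid _; last by apply.
  apply: Ug_ext => [|x c]; rewrite !lcompE !lidE; first by rewrite !uact_one.
  move=> IH; rewrite antiX linearN enveloping_antiM IH anti_prim.
  by rewrite amulNl opprK.
- move=> a; have : lcomp Delta S =1 lcomp (tmap S S) Delta; last by apply.
  apply: Ug_ext => [|x c]; rewrite !lcompE.
    by rewrite [S _]uact_one [Delta _]uact_one tmapE [S _]uact_one.
  move=> IH; rewrite antiX linearN enveloping_deltaM IH deltaX udelta_actE delta_prim.
  elim/tens_ind: (Delta c) => [|r b d z IH']; first by rewrite !(amul2_lin, linear0).
  rewrite (linearP (tmap S S)) amul2_lin opprD -scalerN IH' amul2_lin (linearP (tmap S S)).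
  congr (_ *: _ + _); rewrite tmapE amul2Dr amul2Dl (linearD (tmap S S)) !amul2E !tmapE.
  by rewrite !amul1l !amul1r !antiX tpairNl tpairNr opprD.
- move=> a; have : lcomp eps S =1 eps; last by apply.
  apply: Ug_ext => [|x c]; rewrite !lcompE; first by rewrite [S _]uact_one.
  move=> _; rewrite antiX linearN enveloping_epsM.
  have -> : eps (uinj x) = 0 by rewrite -[uinj x](@amul1r k U) epsX.
  by rewrite mulr0 oppr0 epsX.
move=> a; pose M := tlift (antipode_bilin S).
pose R := mklin (proj1 (@epshead_bilin k U eps U) (aone U)).
have RE c : R c = (eps c : k) *: aone U by [].
have : lcomp M Delta =1 R; last by move=> /(_ a).
  apply: Ug_ext => [|x c _]; rewrite lcompE.
    rewrite [Delta _]uact_one RE.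
    by rewrite [eps _]uact_one scale1r /M tliftE [S _]uact_one amul1l.
  rewrite RE epsX scale0r deltaX.
  (* [M] kills (x ⊗ 1 + 1 ⊗ x) z for every z, since S(x a) b = - S(a) x b cancels S(a) (x b). *)
  elim/tens_ind: (Delta c) => [|r a' b z IH].
    by rewrite udelta_actE amul2_lin linear0.
  rewrite (proj2 (udelta_bilin g)) linearP IH addr0 /udelta_act !tmapE linearD /M !tliftE.
  by rewrite antiX !lmulE amulNl amulA addNr scaler0.
Qed.

End EnvelopingHopf.

(** * Density of grouplike points in the tensor powers of U(g) *)

Section EnvelopingPoints.
Variables (k : comPzRingType) (g : lieAlgType k).
Local Notation U := (Ug g).
Local Notation X := (nat * g)%type.
Local Notation gl := (@grouplike k U X (udelta g) (ueps g)).

Fixpoint upure n (W : nat -> seq g) : tpow U n :=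
  match n with
  | 0 => (1 : k^o)
  | n'.+1 => tpair (uword (W 0)) (upure n' (fun i => W i.+1))
  end.

Lemma upure_dense n (M : lmodType k) (F G : {linear tpow U n -> M}) :
  (forall W, F (upure n W) = G (upure n W)) -> F =1 G.
Proof.
elim: n M F G => [|n IH] M F G FG.
  by move=> c; rewrite -[c]mulr1 -[c * 1]/(c *: (1 : k^o)) !linearZ (FG (fun=> [::])).
apply: tens_ext => v z.
pose Fz z := lcomp F (mklin (proj1 (tpair_bilin U (tpow U n)) z)).
pose Gz z := lcomp G (mklin (proj1 (tpair_bilin U (tpow U n)) z)).
apply: (@pres_ext _ _ _ _ (Fz z) (Gz z)) => [||w] {v}; try exact: linearP.
apply: (IH _ (lcomp F (tpairl _ (uword w))) (lcomp G (tpairl _ (uword w)))) => W.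
exact: (FG (fun i => if i is i'.+1 then W i' else w)).
Qed.

(* The exponential of the letters tagged i; a word of letters tagged by their
   positions then recovers a single pure tensor. *)
Definition wpoint i (w : seq X) : U :=
  uword [seq (if p.1 == i then p.2 else 0) | p <- w].

Lemma gl_wpoint i : gl (wpoint i).
Proof.
split=> [w|w|//].
  elim: w => [|x w IH]; first by rewrite [LHS]uact_one.
  rewrite /wpoint /= uword_cons deltaX IH /udelta_act !tmap_conv.
  by congr (_ + _); apply: eq_usum => a b; rewrite /wpoint /= uword_cons.
case: w => [|x w]; first exact: uact_one.
by rewrite /wpoint /= uword_cons epsX.
Qed.

(** A letter with another tag becomes an entry 0 of the word, and words are multilinear. *)
Lemma wpoint_vanish i w : has (fun p => p.1 != i) w -> wpoint i w = 0.
Proof.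
elim: w => //= p w IH; rewrite /wpoint /= uword_cons => /orP [/negPf -> | /IH IH'].
  by rewrite linear0 -[amul 0 _]/(rmul _ 0) linear0.
by rewrite -/(wpoint i w) IH' -[amul _ 0]/(lmul _ 0) linear0.
Qed.

Lemma usum0_has (M : zmodType) (p : pred X) (F : seq X -> seq X -> M) w :
  (forall a b, has p a || has p b -> F a b = 0) -> has p w -> usum F w = 0.
Proof.
elim: w F => //= x w IH F F0 /orP [px | pw].
  by rewrite !usum0 ?addr0 // => a b; apply: F0; rewrite /= px ?orbT.
by rewrite !IH ?addr0 // => a b /orP [] h; apply: F0; rewrite /= h ?orbT.
Qed.

Lemma ptens_vanish n (p : pred X) (u : nat -> seq X -> U) w :
  (forall i w, has p w -> u i w = 0) -> has p w -> ptens n u w = 0.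
Proof.
elim: n u w => [|n IH] u w u0 pw; first by case: w pw.
rewrite ptensS; apply: (usum0_has (p := p)) => // a b /orP [pa | pb].
  by rewrite u0 // tpair0l.
by rewrite IH ?tpair0r // => i; apply: u0.
Qed.

Fixpoint tagwords m n (W : nat -> seq g) : seq X :=
  if n is n'.+1 then map (pair m) (W 0) ++ tagwords m.+1 n' (fun i => W i.+1) else [::].

Lemma size_tagwords m n W : size (tagwords m n W) = (\sum_(i < n) size (W i))%N.
Proof.
elim: n m W => [|n IH] m W; first by rewrite big_ord0.
by rewrite big_ord_recl /= size_cat size_map IH.
Qed.

Lemma usum_all (M : zmodType) (p : pred X) (F G : seq X -> seq X -> M) w :
  (forall a b, all p a -> all p b -> F a b = G a b) -> all p w ->
  usum F w = usum G w.
Proof.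
elim: w F G => /= [|x w IH] F G FG; first by move=> _; apply: FG.
by move=> /andP [px pw]; congr (_ + _); apply: IH => // a b pa pb; apply: FG;
  rewrite //= px.
Qed.

Lemma all_tagwords m n W : all (fun p => m <= p.1)%N (tagwords m n W).
Proof.
elim: n m W => //= n IH m W; rewrite all_cat all_map /=.
rewrite (sub_all _ (IH m.+1 _)) ?andbT; last by move=> p /ltnW.
by apply/allP => x _ /=.
Qed.

(** Of all distributions of the letters over the factors, only the one that respects the tags
    survives, and it gives back W. *)
Lemma ptens_tagwords m n W :
  ptens n (fun i => wpoint (m + i)%N) (tagwords m n W) = upure n W.
Proof.
elim: n m W => [//|n IH] m W; rewrite ptensS /conv /= addn0 usum_cat.
set v := ptens n _; have vE : v = ptens n (fun i => wpoint (m.+1 + i)%N).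
  by apply: ptens_ext => j _; rewrite addnS.
have v0 w : has (fun p => p.1 == m) w -> v w = 0.
  rewrite vE; apply: ptens_vanish => i w' /hasP [p pw /eqP e].
  by apply: wpoint_vanish; apply/hasP; exists p => //; rewrite e; lia.
(* Here b holds the letters of the first block passed on to the later factors, and c the later
   letters given to the first factor; a term survives only if both are empty. *)
transitivity (usum (fun a b => if b is [::] then
    tpair (wpoint m a) (v (tagwords m.+1 n (fun i => W i.+1))) else 0) (map (pair m) (W 0))).
  apply: (usum_all (p := fun p => p.1 == m)) => [a b am bm|]; last first.
    by rewrite all_map; apply/allP => x _ /=.
  rewrite (@usum_all _ (fun p => m < p.1)%N _ (fun c e => if c is [::] then
     (if b is [::] then tpair (wpoint m a) (v e) else 0) else 0)); last exact: all_tagwords.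
    by rewrite usum_unit.
  move=> c e cm em; case: c cm => [|p c] cm; last first.
    move: cm => /= /andP [lt _].
    by rewrite wpoint_vanish ?tpair0l // has_cat /= (gtn_eqF lt) orbT.
  by rewrite cats0; case: b bm => [//|p b] /= /andP [pm _]; rewrite v0 ?tpair0r //= pm.
rewrite usumC usum_unit vE IH -/(upure n _); congr tpair; congr uword.
by rewrite -map_comp map_id_in // => x _ /=; rewrite eqxx.
Qed.

Lemma Ug_gl_dense : gl_dense X (udelta g) (ueps g).
Proof.
move=> n M F G FG; apply: upure_dense => W.
by rewrite -(ptens_tagwords 0) FG // => i; apply: gl_wpoint.
Qed.

End EnvelopingPoints.

(** * Upsilon and the homotopy *)

Section EOperators.
Variables (k : comPzRingType) (H : assocAlgType k).
Variables (Delta : {linear H -> tens H H}) (eps : {linear H -> k^o}).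
Variable S : {linear H -> H}.
Local Notation E := (Ecyc Delta eps S).
Local Notation dg n := (qproj (@degenerate k E n)).

Lemma E_dE n i : cyc_d E n i = if (i <= n)%N then tmul H n i else epslast eps n.+1.
Proof. by []. Qed.

Lemma EsE n (x : E n) : Es Delta eps S n x = tpair (aone H) x. Proof. by []. Qed.

Lemma d0_Es n x : cyc_d E n 0 (Es Delta eps S n x) = x.
Proof.
rewrite E_dE; have : lcomp (tmul H n 0) (tpairl _ (aone H)) =1 lid (tpow H n.+1); last by apply.
apply: tens_ext => a z; rewrite lcompE lidE tpairlE.
rewrite (_ : tmul H n 0 = tact H (tpow H n)); first by rewrite tactE amul1l.
by case: n z {x}.
Qed.

Lemma dS_Es n i x : (i <= n.+1)%N ->
  cyc_d E n.+1 i.+1 (Es Delta eps S n.+1 x) = Es Delta eps S n (cyc_d E n i x).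
Proof.
move=> le; rewrite !E_dE !EsE ltnS; case: ifP => [le' | /negbT].
  by rewrite -[tmul H n.+1 i.+1]/(tmap (lid H) (tmul H n i)) tmapE.
by rewrite -[epslast eps n.+2]/(tmap (lid H) (epslast eps n.+1)) tmapE.
Qed.

Lemma bdry_Es n x :
  bdry E n.+1 (Es Delta eps S n.+1 x) = x - Es Delta eps S n (bdry E n x).
Proof.
rewrite !bdryE big_ord_recl expr0 scale1r d0_Es linear_sum -sumrN; congr (_ + _).
apply: eq_bigr => i _; rewrite lift0 dS_Es ?exprS ?mulN1r ?scaleNr; last first.
  by have := ltn_ord i; lia.
by rewrite [Es _ _ _ _ (_ *: _)]linearZ.
Qed.

Lemma Es_degenerate n x : dg n x = 0 -> dg n.+1 (Es Delta eps S n x) = 0.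
Proof.
apply: qproj_map => {}x; case: n x => [//|n] x [j [y [jn ->]]].
apply: qproj_sub; exists j.+1, (Es Delta eps S n y); split=> //.
by rewrite EsE -[cyc_s E n.+1 j.+1]/(tmap (lid H) (tins H n.+1 j.+1)) tmapE.
Qed.

Definition hact n (h : H) : {linear tpow H n.+1 -> tpow H n.+1} := tmap (lmul h) (lid (tpow H n)).

Lemma hactE n h a v : hact n h (tpair a v) = tpair (amul h a) v.
Proof. exact: tmapE. Qed.

Lemma hactM n h h' x : hact n (amul h h') x = hact n h (hact n h' x).
Proof.
have : hact n (amul h h') =1 lcomp (hact n h) (hact n h'); last by apply.
by apply: tens_ext => a v; rewrite lcompE !hactE amulA.
Qed.

Lemma hact1 n x : hact n (aone H) x = x.
Proof.
have : hact n (aone H) =1 lid _; last by apply.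
by apply: tens_ext => a v; rewrite hactE amul1l.
Qed.

Lemma hact_d n i h x : cyc_d E n i (hact n.+1 h x) = hact n h (cyc_d E n i x).
Proof.
have : lcomp (cyc_d E n i) (hact n.+1 h) =1 lcomp (hact n h) (cyc_d E n i); last by apply.
apply: tens_ext => a v {x}; rewrite !lcompE hactE E_dE; case: ifP => le; last first.
  by rewrite -[epslast eps n.+1]/(tmap (lid H) (epslast eps n)) !tmapE.
case: i le => [|i] le.
  have -> : tmul H n 0 = tact H (tpow H n) by case: n le v.
  have : lcomp (tact H (tpow H n)) (tpairl _ (amul h a)) =1
     lcomp (hact n h) (lcomp (tact H (tpow H n)) (tpairl _ a)); last by apply.
  by apply: tens_ext => b z; rewrite !lcompE !tpairlE !tactE hactE amulA.
case: n le v => // n le v.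
by rewrite -[tmul H n.+1 i.+1]/(tmap (lid H) (tmul H n i)) !tmapE.
Qed.

Lemma hact_s n i h x : cyc_s E n i (hact n h x) = hact n.+1 h (cyc_s E n i x).
Proof.
have : lcomp (cyc_s E n i) (hact n h) =1 lcomp (hact n.+1 h) (cyc_s E n i); last by apply.
apply: tens_ext => a v; rewrite !lcompE hactE.
by rewrite -[cyc_s E n i]/(tmap (lid H) (tins H n i)) !tmapE.
Qed.

Lemma hact_t n h x : cyc_t E n (hact n h x) = hact n h (cyc_t E n x).
Proof.
case: n x => [//|n] x.
have : lcomp (cyc_t E n.+1) (hact n.+1 h) =1 lcomp (hact n.+1 h) (cyc_t E n.+1); last by apply.
apply: tens_ext => a v; rewrite [LHS]lcompE [RHS]lcompE hactE.
rewrite -[cyc_t E n.+1]/(lscale ((-1) ^+ n.+1) (tlift (Et_bilin Delta S n))) !lscaleE !tliftE.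
rewrite linearZ; congr (_ *: _).
have : tmap (lmul (amul h a)) (tmap S (lid (tpow H n))) =1
  lcomp (hact n.+1 h) (tmap (lmul a) (tmap S (lid (tpow H n)))); last by apply.
by apply: tens_ext => b z; rewrite lcompE !tmapE !lmulE amulA.
Qed.

Lemma hact_bdry n h x : bdry E n (hact n.+1 h x) = hact n h (bdry E n x).
Proof.
rewrite !bdryE linear_sum; apply: eq_bigr => i _.
by rewrite hact_d [hact n h (_ *: _)]linearZ.
Qed.

Lemma hact_connes n h x : connes E n (hact n h x) = hact n.+1 h (connes E n x).
Proof.
have X' y : extra E n (hact n h y) = hact n.+1 h (extra E n y).
  by rewrite !extraE hact_s hact_t [RHS]linearZ.
have N : cnorm E n (hact n h x) = hact n h (cnorm E n x).
  rewrite !cnormE linear_sum; apply: eq_bigr => i _.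
  by elim: (i : nat) => [//|j IH]; rewrite !iterS IH hact_t.
by rewrite !connesE N X' hact_t linearB.
Qed.

Lemma hact_degenerate n h x : dg n x = 0 -> dg n (hact n h x) = 0.
Proof.
apply: qproj_map => {}x; case: n x => [//|n] x [j [y [jn ->]]].
by apply: qproj_sub; exists j, (hact n h y); rewrite hact_s.
Qed.

Lemma hlinE m n (f : {linear tpow H m -> tpow H n.+1}) h v :
  hlin f (tpair h v) = hact n h (f v).
Proof. exact: tliftE. Qed.

Lemma hlin_hact m n (f : {linear tpow H m -> tpow H n.+1}) h x :
  hlin f (hact m h x) = hact n h (hlin f x).
Proof.
have : lcomp (hlin f) (hact m h) =1 lcomp (hact n h) (hlin f); last by apply.
by apply: tens_ext => a v; rewrite [LHS]lcompE [RHS]lcompE hactE !hlinE hactM.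
Qed.

Lemma E_ext m (M : lmodType k) (F G : {linear E m -> M}) :
  (forall h v, F (hact m h (tpair (aone H) v)) = G (hact m h (tpair (aone H) v))) ->
  F =1 G.
Proof.
by move=> FG; apply: tens_ext => h v; have := FG h v; rewrite hactE amul1r.
Qed.

Section Casts.
Local Notation cast e := (Ecast Delta eps S e).

Lemma cast_id n (e : n = n) x : cast e x = x.
Proof. by rewrite (eq_irrelevance e erefl). Qed.
Lemma cast_irr n p (e e' : n = p) x : cast e x = cast e' x.
Proof. by rewrite (eq_irrelevance e e'). Qed.
Lemma cast_bdry n p (e : n = p) e' x : bdry E p (cast e' x) = cast e (bdry E n x).
Proof. by case: p / e e' => e'; rewrite !cast_id. Qed.
Lemma cast_connes n p (e : n = p) e' x : connes E p (cast e x) = cast e' (connes E n x).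
Proof. by case: p / e e' => e'; rewrite !cast_id. Qed.
Lemma cast_hact n p (e : n = p) h x : cast e (hact n h x) = hact p h (cast e x).
Proof. by case: p / e. Qed.
Lemma cast_degenerate n p (e : n = p) x : dg n x = 0 -> dg p (cast e x) = 0.
Proof. by case: p / e; rewrite cast_id. Qed.

End Casts.
End EOperators.

Section Upsilon.
Variables (k : comPzRingType) (H : assocAlgType k).
Variables (Delta : {linear H -> tens H H}) (eps : {linear H -> k^o}).
Variable S : {linear H -> H}.
Local Notation E := (Ecyc Delta eps S).
Local Notation s n := (Es Delta eps S n).
Local Notation U j m := (Ups' Delta eps S j m).
Local Notation cast e := (Ecast Delta eps S e).

Hypotheses (Hf : cyclic_faces E) (Hs : simplicial_degen E) (Hc : cyclic_degen E).

Definition Upsd_cast j m : (j.*2 + m).+2 = (j.*2 + m.+1).+1 :=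
  congr1 succn (esym (addnS j.*2 m)).

(** The term Upsilon'^(j+1) d' of the recursion, equal to 0 for m = 0. The cast identifies 2(j+1) +
    m' with 2j + (m'+1) + 1. *)
Definition Upsd j m : {linear E m -> E (j.*2 + m).+1} :=
  match m with
  | 0 => lzero _ _
  | m'.+1 => lcomp (cast (Upsd_cast j m')) (lcomp (U j.+1 m') (bdry E m'))
  end.

Lemma hact_Ups j m h x : U j m (hact m h x) = hact (j.*2 + m) h (U j m x).
Proof. by case: j => [//|j]; case: m x => [|m] x; apply: hlin_hact. Qed.

Lemma hact_Upsd j m h x : Upsd j m (hact m h x) = hact (j.*2 + m).+1 h (Upsd j m x).
Proof.
case: m x => [|m] x; first by rewrite [LHS](_ : _ = 0) // [Upsd j 0 x](_ : _ = 0) ?linear0.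
by rewrite [LHS]lcompE lcompE hact_bdry hact_Ups cast_hact.
Qed.

Lemma UpsS j m v (x := tpair (aone H) v : E m) :
  U j.+1 m x = s (j.*2 + m).+1 (Upsd j m x - connes E (j.*2 + m) (U j m x)).
Proof. by case: m v @x => [|m] v x; rewrite /= hlinE hact1. Qed.

Lemma Upsd_bdry j m x : Upsd j m (bdry E m x) = 0.
Proof. by case: m x => [//|m] x; rewrite lcompE lcompE (bdry_bdry Hf) !linear0. Qed.

(** Upsilon'^(j+1) is s applied to Upsilon'^(j+1) d' - B' Upsilon'^j, so its equation holds once
    this difference is a cycle. The hypotheses are the same equation one step lower in m and in j;
    with them both boundaries become - B' Upsilon'^j d'. *)
Lemma Ups_cycle j m x :
  (forall m', m = m'.+1 -> forall y : E m', bdry E (j.*2 + m').+1 (U j.+1 m' y) =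
     Upsd j m' y - connes E (j.*2 + m') (U j m' y)) ->
  (forall j', j = j'.+1 -> forall y : E m, bdry E (j'.*2 + m).+1 (U j'.+1 m y) =
     Upsd j' m y - connes E (j'.*2 + m) (U j' m y)) ->
  bdry E (j.*2 + m) (Upsd j m x) = bdry E (j.*2 + m) (connes E (j.*2 + m) (U j m x)).
Proof.
move=> IHm IHj; case: j => [|j] in x IHm IHj *; case: m => [|m] in x IHm IHj *.
- by rewrite [LHS](linear0 (bdry E 0)) [RHS](bdry_connes0 Hf Hs).
- rewrite [RHS](bdry_connes Hf Hs) !lcompE (cast_bdry (esym (addnS 0 m))) IHm //.
  by rewrite Upsd_bdry sub0r [LHS]cast_id.
- rewrite [RHS](bdry_connes Hf Hs) IHj // [connes E _ (_ - _)]linearB (connes_connes Hf) subr0.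
  by rewrite [LHS]linear0 [Upsd _ _ _](_ : _ = 0) // linear0 oppr0.
rewrite [RHS](bdry_connes Hf Hs) IHj // [connes E _ (_ - _)]linearB (connes_connes Hf) subr0.
rewrite !lcompE (cast_bdry (esym (addnS j.+1.*2 m))) IHm // Upsd_bdry sub0r linearN.
by rewrite (cast_connes _ (esym (addnS j.+1.*2 m))).
Qed.

Lemma hact_UpsS j m h x :
  U j.+1 m (hact m h x) = hact (j.*2 + m).+2 h (U j.+1 m x).
Proof. exact: hact_Ups. Qed.

(** This is the compatibility of Upsilon with the differential of negative cyclic chains.
    H-linearity reduces it to elements 1 ⊗ v, where s contracts the cycle of [Ups_cycle]. *)
Lemma bdry_Ups j m x : bdry E (j.*2 + m).+1 (U j.+1 m x) =
  Upsd j m x - connes E (j.*2 + m) (U j m x).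
Proof.
suff step j' m' y : (forall y, bdry E (j'.*2 + m') (Upsd j' m' y) =
      bdry E (j'.*2 + m') (connes E (j'.*2 + m') (U j' m' y))) ->
    bdry E (j'.*2 + m').+1 (U j'.+1 m' y) = Upsd j' m' y - connes E (j'.*2 + m') (U j' m' y).
  elim: j m x => [|j IHj] m; elim: m => [|m IHm] x; apply: step => y;
    by apply: Ups_cycle => // ? [<-].
move=> cyc.
refine (@E_ext _ _ _ _ _ m' _ (lcomp (bdry E (j'.*2 + m').+1) (U j'.+1 m'))
  (lsub (Upsd j' m') (lcomp (connes E (j'.*2 + m')) (U j' m'))) _ y) => h v.
rewrite lsubE [LHS]lcompE [X in _ = _ - X]lcompE hact_UpsS hact_Ups hact_Upsd.
rewrite hact_bdry hact_connes -linearB; congr (hact _ _ _).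
by rewrite UpsS bdry_Es [bdry E _ (_ - _)]linearB cyc subrr linear0 subr0.
Qed.

End Upsilon.

Lemma linear_cancel3 (k : comPzRingType) (V W Q : lmodType k) (b : {linear V -> W})
    (p : {linear W -> Q}) x y z r s t :
  b x = r - t -> p (b y) = p (r - s) -> p (b z) = p (s - t) ->
  p (b (x - y - z)) = 0.
Proof.
move=> e1 e2 e3; rewrite 2!linearB 2!linearB e1 e2 e3 -!linearB.
have -> : r - t - (r - s) = s - t by rewrite opprB addrC addrA subrK.
by rewrite subrr linear0.
Qed.

(** * The homotopy K on elements with degenerate B' *)

Section Homotopy.
Variables (k : comPzRingType) (H : assocAlgType k).
Variables (Delta : {linear H -> tens H H}) (eps : {linear H -> k^o}).
Variable S : {linear H -> H}.
Local Notation E := (Ecyc Delta eps S).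
Local Notation dg n := (qproj (@degenerate k E n)).
Local Notation s n := (Es Delta eps S n).
Local Notation U j m := (Ups' Delta eps S j m).
Local Notation cast e := (Ecast Delta eps S e).

Local Notation Upsd j m := (Upsd Delta eps S j m).

Hypotheses (Hf : cyclic_faces E) (Hs : simplicial_degen E) (Hc : cyclic_degen E).

(* The homotopy between Upsilon and (..., 0, id), defined by the same
   recursion; it is one only on the elements of E(H) where B' is degenerate. *)
Fixpoint Htp_succ j (prev : forall m, {linear E m -> E (j.*2 + m).+1}) m :
    {linear E m -> E (j.*2 + m).+3} :=
  match m with
  | 0 => @hlin k H 0 (j.*2 + 0).+3 (lcomp (s (j.*2 + 0).+2) (lcomp
           (lsub (U j.+1 0) (lcomp (connes E (j.*2 + 0).+1) (prev 0)))
           (tpairl (tpow H 0) (aone H))))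
  | m'.+1 => @hlin k H m'.+1 (j.*2 + m'.+1).+3 (lcomp (s (j.*2 + m'.+1).+2) (lcomp
           (lsub (lsub (U j.+1 m'.+1)
              (lcomp (cast (congr1 succn (Upsd_cast j m')))
                 (lcomp (Htp_succ prev m') (bdry E m'))))
              (lcomp (connes E (j.*2 + m'.+1).+1) (prev m'.+1)))
           (tpairl (tpow H m'.+1) (aone H))))
  end.

Fixpoint Htp j : forall m, {linear E m -> E (j.*2 + m).+1} :=
  match j with
  | 0 => fun m => lzero _ _
  | j'.+1 => Htp_succ (Htp j')
  end.

Definition Htpd j m : {linear E m -> E (j.*2 + m).+2} :=
  match m with
  | 0 => lzero _ _
  | m'.+1 => lcomp (cast (congr1 succn (Upsd_cast j m'))) (lcomp (Htp j.+1 m') (bdry E m'))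
  end.

Lemma hact_Htp j m h x : Htp j m (hact m h x) = hact (j.*2 + m).+1 h (Htp j m x).
Proof.
case: j => [|j]; last by case: m x => [|m] x; apply: hlin_hact.
by rewrite [Htp 0 m x](_ : _ = 0) // linear0.
Qed.

Lemma hact_Htpd j m h x : Htpd j m (hact m h x) = hact (j.*2 + m).+2 h (Htpd j m x).
Proof.
case: m x => [|m] x; first by rewrite [LHS](_ : _ = 0) // [Htpd j 0 x](_ : _ = 0) ?linear0.
by rewrite [LHS]lcompE lcompE hact_bdry hact_Htp cast_hact.
Qed.

Lemma HtpS j m v (x := tpair (aone H) v : E m) :
  Htp j.+1 m x = s (j.*2 + m).+2
    (U j.+1 m x - Htpd j m x - connes E (j.*2 + m).+1 (Htp j m x)).
Proof.
case: m v @x => [|m] v x; rewrite -[Htp j.+1]/(Htp_succ (Htp j)) /= hlinE hact1 //.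
by rewrite [Htpd j 0 x](_ : _ = 0) // subr0.
Qed.

Lemma Htpd_bdry j m x : Htpd j m (bdry E m x) = 0.
Proof. by case: m x => [//|m] x; rewrite lcompE lcompE (bdry_bdry Hf) !linear0. Qed.

(* A family of elements v such that B'(1 (x) v) is degenerate, and whose
   H-span in E(H) is stable under the differential. *)
Variable good : forall m, tpow H m -> Prop.
Hypothesis good_connes : forall m (v : tpow H m), good v ->
  dg m.+1 (connes E m (tpair (aone H) v)) = 0.
Hypothesis good_bdry : forall m (M : lmodType k) (F : {linear E m -> M}),
  (forall h (v : tpow H m), good v -> F (hact m h (tpair (aone H) v)) = 0) ->
  forall v : tpow H m.+1, good v -> F (bdry E m (tpair (aone H) v)) = 0.

(** The failure of d' K^(j+1) = Upsilon'^(j+1) - K^(j+1) d' - B' K^j modulo degenerate elements. As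
    a single linear map it can be fed to [good_bdry], which passes its vanishing on to boundaries of
    good elements. *)
Definition defect j m : {linear E m -> quot (@degenerate k E (j.*2 + m).+2)} :=
  lcomp (qproj _) (lsub (lcomp (bdry E (j.*2 + m).+2) (Htp j.+1 m))
    (lsub (lsub (U j.+1 m) (Htpd j m)) (lcomp (connes E (j.*2 + m).+1) (Htp j m)))).

Lemma defectE j m x : defect j m x = dg (j.*2 + m).+2
  (bdry E (j.*2 + m).+2 (Htp j.+1 m x) -
   (U j.+1 m x - Htpd j m x - connes E (j.*2 + m).+1 (Htp j m x))).
Proof. by []. Qed.

Lemma connes_dg n x : dg n x = 0 -> dg n.+1 (connes E n x) = 0.
Proof. by apply: qproj_map => y; apply: connes_degenerate. Qed.

(** This is B' K^j d'. It occurs with opposite signs in the boundaries of K^(j+1) d' and of B' K^j,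
    and cancels in their sum. *)
Let W j m : {linear E m -> E (j.*2 + m).+1} :=
  match j with
  | 0 => lzero _ _
  | j'.+1 => lcomp (connes E (j'.*2 + m).+2) (Htpd j' m)
  end.

Let dg_bdry_Htpd j m (v : tpow H m) (x := tpair (aone H) v : E m) : good v ->
  (forall m' h (v' : tpow H m'), m = m'.+1 -> good v' ->
    defect j m' (hact m' h (tpair (aone H) v')) = 0) ->
  dg (j.*2 + m).+1 (bdry E (j.*2 + m).+1 (Htpd j m x)) =
  dg (j.*2 + m).+1 (Upsd j m x - W j m x).
Proof.
case: m v @x => [|m] v x gv IH.
  rewrite [Htpd _ _ _](_ : _ = 0) // [Upsd _ _ _](_ : _ = 0) //.
  rewrite [W _ _ _](_ : _ = 0); first by rewrite [bdry _ _ 0]linear0 subrr.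
  by case: j {IH} => [//|j]; rewrite [LHS]linear0.
have := good_bdry (fun h v' gv' => IH m h v' erefl gv') gv.
rewrite -/x defectE Htpd_bdry subr0 => /(cast_degenerate (Upsd_cast j m)).
set y := bdry E m x => Hy; apply/qproj_eq; rewrite -{}Hy; congr (qproj _ _).
rewrite [RHS]linearB [cast _ (_ - _)]linearB.
rewrite [Htpd j m.+1 x]lcompE [Upsd j m.+1 x]lcompE !lcompE -/y.
rewrite (cast_bdry (Upsd_cast j m)); congr (_ - (_ - _)).
case: j {IH} => [|j] /=; first by rewrite !linear0.
by rewrite lcompE lcompE lcompE (cast_connes _ (Upsd_cast j.+1 m)).
Qed.

Let connesB n (x y : E n) : connes E n (x - y) = connes E n x - connes E n y.
Proof. exact: linearB. Qed.
Let hactB n h (x y : tpow H n.+1) : hact n h (x - y) = hact n h x - hact n h y.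
Proof. exact: linearB. Qed.

Let dg_bdry_connes j m (v : tpow H m) (x := tpair (aone H) v : E m) : good v ->
  (forall j', j = j'.+1 -> defect j' m x = 0) ->
  dg (j.*2 + m).+1 (bdry E (j.*2 + m).+1 (connes E (j.*2 + m).+1 (Htp j m x))) =
  dg (j.*2 + m).+1 (W j m x - connes E (j.*2 + m) (U j m x)).
Proof.
move=> gv; case: j => [|j] IH.
  (* For j = 0 the left side is 0 and the right side is - B' x: this is where degeneracy of B' (1 ⊗
     v) enters. *)
  have -> : Htp 0 m x = 0 by [].
  rewrite [connes _ _ 0]linear0 [bdry _ _ 0]linear0 sub0r linear0 linearN.
  by rewrite [X in - X](good_connes gv) oppr0.
rewrite [bdry _ _ _](bdry_connes Hf Hs) lcompE.
have := IH j erefl; rewrite defectE => /connes_dg.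
rewrite connesB => /qproj_eq e.
rewrite [LHS]linearN [X in - X]e -linearN; congr (qproj _ _).
transitivity (- (connes E (j.*2 + m).+2 (U j.+1 m x) - connes E (j.*2 + m).+2 (Htpd j m x))).
  by congr (- _); exact: (@connes_sub3 _ _ Hf (j.*2 + m).+1).
exact: opprB.
Qed.

Lemma defect0 j m h (v : tpow H m) : good v ->
  defect j m (hact m h (tpair (aone H) v)) = 0.
Proof.
suff step j' m' h' (v' : tpow H m') : good v' ->
    (forall m'' h (v : tpow H m''), m' = m''.+1 -> good v ->
      defect j' m'' (hact m'' h (tpair (aone H) v)) = 0) ->
    (forall j'', j' = j''.+1 -> defect j'' m' (tpair (aone H) v') = 0) ->
    defect j' m' (hact m' h' (tpair (aone H) v')) = 0.
  elim: j m h v => [|j IHj] m; elim: m => [|m IHm] h v gv; apply: step => //.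
  - by move=> m'' h'' v'' [?]; subst m; apply: IHm.
  - by move=> j'' [<-]; rewrite -[tpair _ _](hact1 (n := 0)); apply: IHj.
  - by move=> m'' h'' v'' [?]; subst m; apply: IHm.
  by move=> j'' [<-]; rewrite -[tpair _ _](hact1 (n := m.+1)); apply: IHj.
move=> gv IHm IHj; set x := tpair (aone H) v'.
rewrite defectE.
have -> : Htp j'.+1 m' (hact m' h' x) = hact (j'.*2 + m').+3 h' (Htp j'.+1 m' x).
  exact: hact_Htp.
rewrite hact_UpsS hact_Htp hact_Htpd hact_bdry hact_connes -!hactB.
apply: hact_degenerate; rewrite HtpS bdry_Es addrAC subrr add0r linearN.
set z := bdry E _ _; suff z0 : dg (j'.*2 + m').+1 z = 0.
  by rewrite [X in - X]Es_degenerate ?oppr0.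
(* Modulo degenerate elements the boundaries of Upsilon'^(j+1), K^(j+1) d' and B' K^j are
   Upsilon'^(j+1) d' - B' Upsilon'^j, Upsilon'^(j+1) d' - W and W - B' Upsilon'^j; the first is the
   sum of the other two. *)
apply: linear_cancel3.
- exact: bdry_Ups.
- by apply: dg_bdry_Htpd => // m'' h v; apply: IHm.
by apply: dg_bdry_connes => // j'' /IHj.
Qed.

End Homotopy.

(** * The antisymmetrization map e *)

Section SignedInsertion.
Variables (k : comPzRingType) (V : lmodType k).

(** In closed form, the sum over i of (-1)^i times the insertion of a after i entries. On
    antisymmetrized tensors it is left exterior multiplication by a. *)
Fixpoint Ins n (a : V) : {linear tpow V n -> tpow V n.+1} :=
  match n with
  | 0 => tpairl (tpow V 0) a
  | n'.+1 => lsub (tpairl (tpow V n'.+1) a) (tmap (lid V) (Ins n' a))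
  end.

Lemma Ins0 a c : Ins 0 a c = tpair a c. Proof. by []. Qed.
Lemma InsS n a y w : Ins n.+1 a (tpair y w) = tpair a (tpair y w) - tpair y (Ins n a w).
Proof. by rewrite lsubE tmapE. Qed.

Lemma InsC n a b w : Ins n.+1 a (Ins n b w) = - Ins n.+1 b (Ins n a w).
Proof.
elim: n w => [|n IH] w; first by rewrite !Ins0 !InsS !Ins0 opprB.
have : lcomp (Ins n.+2 a) (Ins n.+1 b) =1
    lscale (-1) (lcomp (Ins n.+2 b) (Ins n.+1 a)); last first.
  by move=> /(_ w); rewrite lscaleE scaleN1r.
apply: tens_ext => y v; rewrite lscaleE scaleN1r !lcompE !InsS.
rewrite [Ins n.+2 a _]linearB [Ins n.+2 b _]linearB !InsS IH.
rewrite [tpair b (tpair a _ - _)]tpairDr [tpair a (tpair b _ - _)]tpairDr !tpairNr.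
rewrite !(opprD, opprK) !addrA.
by rewrite [LHS](ACl (2 * 1 * 4 * 3 * 5)).
Qed.

Fixpoint tder (d : {linear V -> V}) n : {linear tpow V n -> tpow V n} :=
  match n with
  | 0 => lzero _ _
  | n'.+1 => ladd (tmap d (lid _)) (tmap (lid V) (tder d n'))
  end.

Lemma tderS d n a w :
  tder d n.+1 (tpair a w) = tpair (d a) w + tpair a (tder d n w).
Proof. by rewrite laddE !tmapE. Qed.

Lemma tder_Ins d n a w : tder d n.+1 (Ins n a w) = Ins n (d a) w + Ins n a (tder d n w).
Proof.
elim: n w => [|n IH] w.
  by rewrite Ins0 tderS Ins0 [tder d 0 w](_ : _ = 0) // linear0 tpair0r.
have : lcomp (tder d n.+2) (Ins n.+1 a) =1
    ladd (Ins n.+1 (d a)) (lcomp (Ins n.+1 a) (tder d n.+1)); last by apply.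
apply: tens_ext => y v; rewrite laddE !lcompE !InsS tderS.
rewrite [tder d n.+2 _]linearB !tderS IH.
rewrite [Ins n.+1 a (_ + _)]linearD !InsS.
rewrite [tpair a (_ + _)]tpairDr [tpair y (Ins _ _ _ + _)]tpairDr.
rewrite !(opprD, opprK) !addrA.
by rewrite [RHS](ACl (1 * 3 * 5 * 4 * 2 * 6)).
Qed.

End SignedInsertion.

Section AntisymmetricTensors.
Variables (k : comPzRingType) (g : lieAlgType k).
Local Notation U := (Ug g).
Local Notation E := (Ecyc (udelta g) (ueps g) (uanti g)).

Definition ad (x : g) : {linear U -> U} := lsub (lmul (uinj x)) (rmul (uinj x)).

Lemma adE x a : ad x a = amul (uinj x) a - amul a (uinj x). Proof. by []. Qed.

Lemma ad_uinj x y : ad x (uinj y) = uinj (bracket x y).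
Proof. by rewrite adE uinj_bracket addrC addKr. Qed.

(* The part of the differential of E(U) after its first face. *)
Definition dtail n : {linear tpow U n.+1 -> tpow U n} :=
  match n with
  | 0 => epslast (ueps g) 0
  | n'.+1 => bdry E n'
  end.

Lemma bdry_one n (w : tpow U n.+1) :
  bdry E n (tpair (aone U) w) = w - tpair (aone U) (dtail n w).
Proof.
case: n w => [|n] w; last exact: bdry_Es.
rewrite bdryE !big_ord_recl big_ord0 addr0 expr0 scale1r expr1 scaleN1r.
rewrite [X in X - _](@d0_Es k U (udelta g) (ueps g) (uanti g) 0); congr (_ - _).
by rewrite E_dE -[epslast _ 1]/(tmap (lid U) (epslast (ueps g) 0)) tmapE.
Qed.

Lemma dtailS n y (w : tpow U n.+1) :
  dtail n.+1 (tpair y w) = hact n y w - tpair y (dtail n w).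
Proof.
have -> : tpair y w = hact n.+1 y (tpair (aone U) w) by rewrite hactE amul1r.
rewrite [LHS]hact_bdry bdry_one.
by rewrite linearB /= hactE amul1r.
Qed.

Lemma hact_Ins n y a (w : tpow U n.+1) :
  hact n.+1 y (Ins n.+1 a w) =
  tpair (amul y a) w + Ins n.+1 a (hact n y w) - tpair a (hact n y w).
Proof.
have : lcomp (hact n.+1 y) (Ins n.+1 a) =1
    lsub (ladd (tpairl _ (amul y a)) (lcomp (Ins n.+1 a) (hact n y)))
      (lcomp (tpairl _ a) (hact n y)); last by apply.
apply: tens_ext => z u; rewrite lsubE laddE !lcompE !tpairlE hactE !InsS.
rewrite linearB /= !hactE -[RHS]addrA; congr (_ + _).
by rewrite addrAC subrr add0r.
Qed.

Lemma zmod_cancel (M : zmodType) (a b c e p q r : M) :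
  (a - (b - c)) - ((e + p - b) - q) + (p - (c - r)) = (a - e) + (q + r).
Proof.
rewrite !(opprD, opprK) !addrA.
rewrite [LHS](ACl ((1 * 4 * 7 * 10) * ((2 * 6) * (3 * 9) * (5 * 8)))) /=.
by rewrite addNr subrr addNr !addr0.
Qed.

(** Inserting x before or after an entry y and then multiplying the two gives x y and y x with
    opposite signs. The terms with x away from the product cancel in the anticommutator, and x in
    last place is killed by the counit. *)
Lemma dtail_Ins n x (w : tpow U n.+1) :
  dtail n.+1 (Ins n.+1 (uinj x) w) + Ins n (uinj x) (dtail n w) =
  tder (ad x) n.+1 w.
Proof.
elim: n w => [|n IH] w.
  have : ladd (lcomp (dtail 1) (Ins 1 (uinj x))) (lcomp (Ins 0 (uinj x)) (dtail 0)) =1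
    tder (ad x) 1; last by apply.
  apply: tens_ext => y c; rewrite laddE !lcompE InsS tderS Ins0.
  rewrite [dtail 1 _]linearB !dtailS !hactE.
  have -> : dtail 0 (tpair (uinj x) c) = 0.
    rewrite [LHS]tliftE -[uinj x](@amul1r k U) epsX.
    exact: mul0r.
  rewrite tpair0r subr0 Ins0 addrAC subrK.
  rewrite addr0.
  by rewrite adE tpairDl tpairNl.
have : ladd (lcomp (dtail n.+2) (Ins n.+2 (uinj x))) (lcomp (Ins n.+1 (uinj x)) (dtail n.+1)) =1
  tder (ad x) n.+2; last by apply.
apply: tens_ext => y v; rewrite laddE !lcompE InsS tderS.
rewrite [dtail n.+2 _]linearB !dtailS hact_Ins hactE [Ins n.+1 _ (_ - _)]linearB InsS.
rewrite adE tpairDl tpairNl -IH [tpair (uinj x) (_ - _)]tpairDr tpairNr [tpair y (_ + _)]tpairDr.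
exact: zmod_cancel.
Qed.

Fixpoint asym n (y : nat -> g) : tpow U n :=
  match n with
  | 0 => (1 : k^o)
  | n'.+1 => Ins n' (uinj (y 0)) (asym n' (fun i => y i.+1))
  end.

Lemma asym_ext n y z : (forall i, (i < n)%N -> y i = z i) -> asym n y = asym n z.
Proof.
elim: n y z => //= n IH y z e.
by rewrite e // (IH _ (fun i => z i.+1)) // => i lt; apply: (e i.+1).
Qed.

Definition scons (T : Type) (a : T) (y : nat -> T) i := if i is i'.+1 then y i' else a.

Lemma asymS n y : asym n.+1 y = Ins n (uinj (y 0)) (asym n (fun i => y i.+1)).
Proof. by []. Qed.

Lemma tder_asym n a y : tder (ad a) n (asym n y) =
  \sum_(j < n) (-1) ^+ j *: asym n (scons (bracket a (y j)) (fun l => y (bump j l))).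
Proof.
elim: n y => [|n IH] y; first by rewrite big_ord0.
rewrite asymS tder_Ins ad_uinj IH big_ord_recl expr0 scale1r.
congr (_ + _); rewrite linear_sum; apply: eq_bigr => j _.
rewrite lift0 linearZZ exprS mulN1r scaleNr -scalerN; congr (_ *: _).
case: n j {IH} => [[]//|n] j; rewrite !asymS [LHS]InsC; congr (- _).
rewrite (asym_ext (z := fun i => y (bump j.+1 i.+1))) => [//|i _] /=.
by rewrite bumpS.
Qed.

Definition ce_pair n (y : nat -> g) i j : tpow U n.+1 :=
  asym n.+1 (scons (bracket (y i) (y j)) (fun l => y (bump j (bump i l)))).

Definition ce_tensor n (y : nat -> g) : tpow U n :=
  match n with
  | 0 => 0
  | n'.+1 => \sum_(i < n'.+2) \sum_(j < n'.+2 | (i < j)%N) (-1) ^+ (i + j) *: ce_pair n' y i j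
  end.

(** Peeling off y_0, the derivation ad y_0 gives the brackets [y_0, y_j]. In the other terms y_0 is
    moved past [y_i, y_j], which costs a sign by [InsC], while shifting both i and j by one costs
    none. *)
Lemma dtail_asym n y : dtail n (asym n.+1 y) = - ce_tensor n y.
Proof.
elim: n y => [|n IH] y.
  rewrite oppr0 asymS [LHS]tliftE -[uinj _](@amul1r k U) epsX.
  exact: mul0r.
have -> : dtail n.+1 (asym n.+2 y) = tder (ad (y 0)) n.+1 (asym n.+1 (fun i => y i.+1)) -
    Ins n (uinj (y 0)) (dtail n (asym n.+1 (fun i => y i.+1))).
  by rewrite -dtail_Ins addrK.
rewrite tder_asym IH [Ins _ _ (- _)]linearN opprK [in RHS]/ce_tensor [in RHS]big_ord_recl
  opprD; congr (_ + _).
  rewrite [in RHS]big_mkcond [in RHS]big_ord_recl /= add0r -sumrN; apply: eq_bigr => j _.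
  rewrite -[bump 0 j]/(j.+1) add0n exprS mulN1r scaleNr opprK; congr (_ *: _).
  rewrite /ce_pair [in RHS]asymS; congr (Ins _ _ _); apply: asym_ext => i _ /=.
  by rewrite -[bump 0 i]/(i.+1) bumpS.
rewrite -sumrN; case: n {IH} => [|n].
  rewrite linear0 big_ord_recl big_ord0 addr0 big_mkcond !big_ord_recl big_ord0 /=.
  by rewrite !addr0 oppr0.
rewrite linear_sum; apply: eq_bigr => i _.
rewrite [in RHS]big_mkcond big_ord_recl /= add0r -sumrN.
rewrite linear_sum big_mkcond; apply: eq_bigr => j _.
rewrite -[bump 0 i]/(i.+1) -[bump 0 j]/(j.+1) ltnS; case: ifP => _; last by rewrite oppr0.
rewrite linearZZ addSn addnS !exprS !mulN1r opprK -scalerN; congr (_ *: _).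
rewrite /ce_pair [in RHS]asymS [in RHS]asymS [RHS](_ : _ = - Ins n.+1 (uinj (bracket (y i.+1) (y j.+1)))
  (Ins n (uinj (y 0)) (asym n (fun l => y (bump j (bump i l)).+1)))); last first.
  congr (- Ins _ _ (Ins _ _ _)); apply: asym_ext => l _ /=.
  by rewrite !bumpS.
by rewrite InsC opprK.
Qed.

Definition good n (v : tpow U n) := exists y, v = asym n y.

Lemma linear_ce_tensor n (M : lmodType k) (F : {linear tpow U n -> M}) y :
  (forall y, F (asym n y) = 0) -> F (ce_tensor n y) = 0.
Proof.
move=> F0; case: n F F0 => [|n] F F0; first exact: linear0.
rewrite linear_sum big1 // => i _; rewrite linear_sum big1 // => j _.
by rewrite linearZZ F0 scaler0.
Qed.

(** Expansion along the first entry: an antisymmetrized tensor is a signed sum of terms y_i ⊗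
    (antisymmetrized rest). *)
Lemma linear_asym n (M : lmodType k) (F : {linear tpow U n.+1 -> M}) :
  (forall h y, F (tpair h (asym n y)) = 0) -> forall y, F (asym n.+1 y) = 0.
Proof.
elim: n M F => [|n IH] M F F0 y; first exact: (F0 (uinj (y 0)) (fun=> 0)).
rewrite asymS linearB F0 sub0r.
have e : lcomp F (tmap (lid U) (Ins n (uinj (y 0)))) (asym n.+1 (fun i => y i.+1)) = 0.
  apply: IH => h z; rewrite lcompE tmapE; exact: (F0 h (scons (y 0) z)).
by rewrite lcompE in e; rewrite [X in - X]e oppr0.
Qed.

(** In d'(1 ⊗ e) = e + 1 ⊗ e(d -), the first summand lies in the H-span by [linear_asym], and the
    second is a combination of good tensors. *)
Lemma good_bdry n (M : lmodType k) (F : {linear E n -> M}) :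
  (forall h (v : tpow U n), good v -> F (hact n h (tpair (aone U) v)) = 0) ->
  forall v : tpow U n.+1, good v -> F (bdry E n (tpair (aone U) v)) = 0.
Proof.
move=> F0; have F0' h y : F (tpair h (asym n y)) = 0.
  by rewrite -[h](@amul1r k U) -hactE F0 //; exists y.
move=> _ [y ->]; rewrite bdry_one linearB (linear_asym F0') sub0r.
rewrite dtail_asym tpairNr linearN opprK.
by apply: (linear_ce_tensor (F := lcomp F (tpairl _ (aone U)))) => z; apply: F0'.
Qed.

End AntisymmetricTensors.

(** * Sums over permutations of pure tensors *)

Section PermutedTensors.
Variables (k : comPzRingType) (V : lmodType k).

Lemma unlift_lift0 n (i j : 'I_n.+1) :
  unlift (lift ord0 i) (lift ord0 j) = omap (lift ord0) (unlift i j).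
Proof.
case: (unliftP i j) => [l ->|->] /=; last by rewrite unlift_none.
rewrite (_ : lift ord0 (lift i l) = lift (lift ord0 i) (lift ord0 l)) ?liftK //.
by apply: val_inj; apply: (esym (bumpS i l)).
Qed.

Lemma unlift_lift00 n (i : 'I_n.+1) : unlift (lift ord0 i) ord0 = Some ord0.
Proof.
rewrite (_ : ord0 = lift (lift ord0 i) ord0) ?liftK //; exact: val_inj.
Qed.

Definition insord n (i : 'I_n.+1) (a : V) (v : 'I_n -> V) (j : 'I_n.+1) : V :=
  if unlift i j is Some l then v l else a.

Lemma tpureS n (v : 'I_n.+1 -> V) :
  tpure v = tpair (v ord0) (tpure (fun i : 'I_n => v (lift ord0 i))).
Proof. by []. Qed.

Lemma tpure_ext n (v w : 'I_n -> V) : v =1 w -> tpure v = tpure w.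
Proof. by move=> /funext ->. Qed.

Lemma Ins_tpure n a (v : 'I_n -> V) :
  Ins n a (tpure v) = \sum_(i < n.+1) (-1) ^+ i *: tpure (insord i a v).
Proof.
elim: n a v => [|n IH] a v.
  by rewrite big_ord_recl big_ord0 addr0 scale1r [RHS]tpureS /insord unlift_none.
rewrite big_ord_recl scale1r [tpure v]tpureS InsS; congr (_ + _).
  rewrite [RHS]tpureS /insord unlift_none; congr tpair.
  by rewrite -tpureS; apply: (@tpure_ext n.+1) => j; rewrite liftK.
rewrite IH -tpairlE linear_sum -sumrN; apply: eq_bigr => i _.
rewrite lift0 exprS mulN1r scaleNr linearZZ tpairlE; congr (- (_ *: _)).
rewrite [RHS]tpureS /insord unlift_lift00; congr tpair; apply: (@tpure_ext n.+1) => j.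
by rewrite unlift_lift0; case: unlift.
Qed.

(** Permutations sorted by the position i that is sent to 0; this matches the insertions at position
    i in [Ins]. *)
Lemma lift_perm_bij n : bijective (fun p : 'I_n.+1 * 'S_n => lift_perm p.1 ord0 p.2).
Proof.
apply: inj_card_bij; last by rewrite card_prod card_ord !card_Sn factS.
move=> [i s] [i' s'] /= e.
have ii : i = i'.
  by apply: (@perm_inj _ (lift_perm i ord0 s)); rewrite {2}e !lift_perm_id.
rewrite -{i'}ii in e *; congr pair; apply/permP => j; apply: (@lift_inj _ ord0).
by rewrite -!(lift_perm_lift i) e.
Qed.

Lemma sum_tpure_perm n (v : 'I_n.+1 -> V) :
  \sum_(s : 'S_n.+1) (-1) ^+ s *: tpure (fun i => v (s i)) =
  Ins n (v ord0) (\sum_(s : 'S_n) (-1) ^+ s *: tpure (fun i => v (lift ord0 (s i)))).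
Proof.
rewrite linear_sum; under [RHS]eq_bigr => s _ do rewrite linearZZ Ins_tpure scaler_sumr.
rewrite exchange_big pair_bigA /= (reindex (fun p : 'I_n.+1 * 'S_n => lift_perm p.1 ord0 p.2)) /=;
  last exact: onW_bij (lift_perm_bij n).
apply: eq_bigr => -[i s] _ /=; rewrite scalerA odd_lift_perm /= addbF addbC.
rewrite signr_addb signr_odd; congr (_ *: _); apply: (@tpure_ext n.+1) => j; rewrite /insord.
by case: (unliftP i j) => [l ->|->]; rewrite ?lift_perm_lift ?lift_perm_id.
Qed.

(** The cycle j -> j - 1, 0 -> n underlying the rotation of tensors. Its sign (-1)^n is the one
    built into t. *)
Definition rotp n : 'S_n.+1 := lift_perm ord0 ord_max 1%g.

Lemma rotpE n (j : 'I_n.+1) : rotp n j = rotidx n j :> nat.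
Proof.
case: (unliftP ord0 j) => [l ->|->]; last by rewrite lift_perm_id.
by rewrite lift_perm_lift perm1 lift0 /= /bump leqNgt ltn_ord.
Qed.

Lemma odd_rotp n : rotp n = odd n :> bool.
Proof. by rewrite odd_lift_perm odd_perm1 addbF. Qed.

(** A pure tensor is the coefficient at the empty word of constant points over a dummy alphabet, so
    [trot_ptens] applies to it. *)
Lemma tpure_ptens n (a : nat -> V) :
  tpure (fun i : 'I_n => a i) = ptens n (fun i (_ : seq unit) => a i) [::].
Proof.
elim: n a => [//|n IH] a; rewrite ptensS /conv /= -IH tpureS; congr tpair.
Qed.

Lemma trot_tpure n (v : 'I_n.+1 -> V) :
  trot V n (tpure v) = tpure (fun i => v (rotp n i)).
Proof.
have E (w : 'I_n.+1 -> V) : tpure w = tpure (fun i : 'I_n.+1 => w (inord i)).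
  by apply: tpure_ext => i; rewrite inord_val.
rewrite E [RHS]E (tpure_ptens n.+1 (fun i => v (inord i))) trot_ptens.
rewrite (tpure_ptens n.+1 (fun i => v (rotp n (inord i)))); congr (_ [::]).
apply: ptens_ext => -[|j] lt; apply/funext => _; congr v; apply: val_inj.
  by rewrite /= rotpE !inordK.
by rewrite /= rotpE !inordK // ltnW.
Qed.

End PermutedTensors.

Lemma bump_lt h l n : (l < n)%N -> (bump h l < n.+1)%N.
Proof. by rewrite /bump; case: (h <= l)%N => lt; rewrite ?add1n ?add0n // ltnW. Qed.

Section ExteriorMaps.
Variables (k : comPzRingType) (g : lieAlgType k).
Local Notation U := (Ug g).
Local Notation E := (Ecyc (udelta g) (ueps g) (uanti g)).

Lemma esum_asym n (y : nat -> g) : esum (fun i : 'I_n => y i) = asym n y.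
Proof.
elim: n y => [|n IH] y.
  by rewrite /esum (big_pred1 1%g) ?odd_perm1 ?scale1r // => s; apply/esym/eqP/permP => -[].
rewrite asymS -IH /esum (sum_tpure_perm (fun i : 'I_n.+1 => uinj (y i))).
by congr (Ins _ _ _).
Qed.

Lemma emap_wedge n (x : 'I_n -> g) : emap g n (wedge x) = esum x.
Proof. exact: pliftE. Qed.

(** Replaces families on ordinals by sequences on [nat], so that dropping or shifting entries in
    [asym] requires no dependent indices. *)
Lemma ext_ext n (M : lmodType k) (F G : {linear ext g n -> M}) :
  (forall y : nat -> g, F (wedge (fun i : 'I_n => y i)) = G (wedge (fun i : 'I_n => y i))) ->
  F =1 G.
Proof.
move=> FG; apply: pres_ext; try exact: linearP.
move=> x; case: n F G FG x => [|n] F G FG x.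
  by have := FG (fun=> 0); rewrite (_ : (fun i : 'I_0 => _) = x) //; apply/funext => -[].
have := FG (fun i => x (inord i)); rewrite (_ : (fun i : 'I_n.+1 => _) = x) //.
by apply/funext => i; rewrite inord_val.
Qed.

Lemma emap_asym n (y : nat -> g) : emap g n (wedge (fun i : 'I_n => y i)) = asym n y.
Proof. by rewrite emap_wedge esum_asym. Qed.

Lemma emap_ce n (y : nat -> g) :
  emap g n (ce g n (wedge (fun i : 'I_n.+1 => y i))) = ce_tensor n y.
Proof.
case: n => [|n]; first by rewrite [ce g 0 _](_ : _ = 0) // linear0.
rewrite [ce g n.+1 _]pliftE /ce_sum linear_sum; apply: eq_bigr => i _.
rewrite linear_sum; apply: eq_bigr => j ij; rewrite linearZZ emap_wedge; congr (_ *: _).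
rewrite /ce_pair -esum_asym; congr esum; apply/funext => l; rewrite /ce_word.
case: (unliftP ord0 l) => [l' ->|->]; last by rewrite fcons0.
rewrite fconsS lift0 /= inordK //.
by rewrite !bump_lt // (ltn_ord l').
Qed.

Lemma eps_uinj x : ueps g (uinj x) = 0.
Proof. by rewrite -[uinj x](@amul1r k U) epsX. Qed.

Lemma epshead_asym n y : epshead (ueps g) (tpow U n) (asym n.+1 y) = 0.
Proof.
elim: n y => [|n IH] y; rewrite asymS.
  by rewrite Ins0 [LHS]tliftE eps_uinj scale0r.
rewrite lsubE linearB /= tpairlE [epshead _ _ (tpair _ _)]tliftE eps_uinj scale0r sub0r.
have : lcomp (epshead (ueps g) _) (tmap (lid U) (Ins n (uinj (y 0)))) =1
    lcomp (Ins n (uinj (y 0))) (epshead (ueps g) _).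
  by apply: tens_ext => a v; rewrite !lcompE tmapE ![epshead _ _ _]tliftE linearZZ.
by move=> /(_ (asym n.+1 (fun i => y i.+1))); rewrite !lcompE IH linear0 => ->; rewrite oppr0.
Qed.

Lemma bdry_BUg n (v : tpow U n.+1) :
  bdry (BUg g) n v = epshead (ueps g) (tpow U n) (bdry E n (tpair (aone U) v)).
Proof.
by rewrite !bdryE linear_sum; apply: eq_bigr => i _; rewrite linearZZ.
Qed.

Lemma bdry_emap n (w : ext g n.+1) :
  bdry (BUg g) n (emap g n.+1 w) = emap g n (ce g n w).
Proof.
have : lcomp (bdry (BUg g) n) (emap g n.+1) =1 lcomp (emap g n) (ce g n); last by apply.
apply: ext_ext => y; rewrite [LHS]lcompE [RHS]lcompE emap_ce emap_asym bdry_BUg bdry_one.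
rewrite dtail_asym tpairNr opprK linearD epshead_asym add0r [LHS]tliftE.
by rewrite [ueps g _]uact_one scale1r.
Qed.

Lemma tpure_upure n (x : 'I_n -> g) : exists2 W : nat -> seq g,
  forall i, size (W i) = 1%N & tpure (fun i => uinj (x i)) = upure n W.
Proof.
elim: n x => [|n IH] x; first by exists (fun=> [:: 0]).
have [W W1 e] := IH (fun i => x (lift ord0 i)).
exists (scons [:: x ord0] W) => [[|i] //|]; first exact: W1.
by rewrite tpureS e.
Qed.

Lemma good_connes n (v : tpow U n) : good v ->
  qproj (@degenerate k E n.+1) (connes E n (tpair (aone U) v)) = 0.
Proof.
move=> [y ->]; rewrite -esum_asym /esum.
rewrite -tpairlE !linear_sum big1 // => s _; rewrite !linearZZ tpairlE.
have [W W1 ->] := tpure_upure (fun i => y (s i)).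
(* Each of the n factors carries one letter, so this is a coefficient at a word of length n, within
   the bound of [connes_htens_degenerate]. *)
have -> : tpair (aone U) (upure n W) =
    ptens n.+1 (scons (pone U _) (@wpoint k g)) (tagwords 0 n W).
  by rewrite ptensS conv_ptl -?(ptens_tagwords 0) //; apply: tpair_bilin.
have gu i : grouplike (udelta g) (ueps g) (scons (pone U _) (@wpoint k g) i).
  by case: i => [|i]; [apply: gl_one (enveloping_hopf g) | apply: gl_wpoint].
have [z gz ->] := ptens_htens (enveloping_hopf g) n gu.
rewrite (connes_htens_degenerate (enveloping_hopf g) gz) ?scaler0 //.
by rewrite size_tagwords (eq_bigr (fun=> 1%N)) // sum1_card card_ord.
Qed.

Lemma cnorm_e n (x : 'I_n.+1 -> g) :
  cnorm (CUg g) n (tpair (uinj (x ord0)) (esum (fun i => x (lift ord0 i)))) = esum x.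
Proof.
have iter_t i (v : 'I_n.+1 -> U) : iter i (cyc_t (CUg g) n) (tpure v) =
    (-1) ^+ odd_perm (rotp n ^+ i)%g *: tpure (fun j => v ((rotp n ^+ i)%g j)).
  elim: i => [|i IH].
    by rewrite expg0 odd_perm1 scale1r; apply: tpure_ext => j; rewrite perm1.
  rewrite iterS IH linearZZ -[cyc_t (CUg g) n]/(lscale ((-1) ^+ n) (trot U n)) lscaleE.
  rewrite trot_tpure scalerA expgS odd_permM odd_rotp signr_addb signr_odd mulrC.
  by congr (_ *: _); apply: tpure_ext => j; rewrite permM.
have -> : tpair (uinj (x ord0)) (esum (fun i => x (lift ord0 i))) =
    \sum_(s : 'S_n) (-1) ^+ s *: tpure (fun j => uinj (x (lift_perm ord0 ord0 s j))).
  rewrite -tpairlE linear_sum; apply: eq_bigr => s _; rewrite linearZZ tpairlE tpureS.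
  rewrite lift_perm_id; congr (_ *: tpair _ _); apply: tpure_ext => j.
  by rewrite lift_perm_lift.
have rot0 i (j : 'I_n.+1) : (i <= n)%N -> ((rotp n ^+ i)%g j == ord0) = (j == i :> nat).
  move=> le; rewrite -val_eqE permX /=.
  have -> : iter i (rotp n) j = iter i (rotidx n) j :> nat.
    by elim: i {le} => [//|i IH]; rewrite !iterS rotpE IH.
  have lj := ltn_ord j; rewrite iter_rotidx //; last exact: leqW.
  by case: leqP => c; apply/eqP/eqP; lia.
(* The coset decomposition. The rotation index i is recovered as the position that [h] sends to
   0. *)
pose h (p : 'I_n.+1 * 'S_n) : 'S_n.+1 := (rotp n ^+ p.1 * lift_perm ord0 ord0 p.2)%g.
have h0 p : h p p.1 = ord0.
  have e : (rotp n ^+ p.1)%g p.1 = ord0 by apply/eqP; rewrite rot0 // -ltnS.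
  by rewrite /h permM e lift_perm_id.
have h_bij : bijective h.
  apply: inj_card_bij; last by rewrite card_prod card_ord !card_Sn factS.
  move=> [i s] [i' s'] e; have ii : i = i'.
    by apply: (@perm_inj _ (h (i, s))); rewrite (h0 (i, s)) e (h0 (i', s')).
  rewrite -{i'}ii in e *; congr pair; apply/permP => j; apply: (@lift_inj _ ord0).
  by rewrite -!(lift_perm_lift ord0); move/mulgI: e => /= ->.
rewrite /esum [RHS](reindex h) /=; last exact: onW_bij.
rewrite cnormE -(pair_bigA _ (fun i s => (-1) ^+ h (i, s) *:
  tpure (fun j => uinj (x (h (i, s) j))))) /=; apply: eq_bigr => i _.
rewrite [LHS](linear_sum (mklin (@iter_linear _ (CUg g) n i))); apply: eq_bigr => s _.
rewrite [LHS]iter_tZ iter_t scalerA.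
rewrite /h /= odd_permM odd_lift_perm /= signr_addb mulrC; congr (_ *: _).
by apply: (@tpure_ext _ _ n.+1) => j; rewrite permM.
Qed.

End ExteriorMaps.

Lemma tins0 (k : comPzRingType) (A : assocAlgType k) n (z : tpow A n) :
  tins A n 0 z = tpair (aone A) z.
Proof. by case: n z. Qed.

(** * Negative cyclic chains *)

Section NormalizedChains.
Variables (k : comPzRingType) (g : lieAlgType k).
Local Notation U := (Ug g).
Local Notation E := (Ecyc (udelta g) (ueps g) (uanti g)).
Local Notation C := (CUg g).
Local Notation nE n := (qproj (@degenerate k E n)).
Local Notation nC n := (qproj (@degenerate k C n)).
Local Notation Etau := (Etau (udelta g) (ueps g) (uanti g)).

Let Hopf := enveloping_hopf g.
Let dense := @Ug_gl_dense k g.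

Let denseT n (M : lmodType k) (F G : {linear tpow U n -> M}) :
  (forall (u : nat -> seq (nat * g) -> U) w, F (ptens n u w) = G (ptens n u w)) -> F =1 G.
Proof. by move=> FG; apply: dense => u _ w; apply: FG. Qed.

Let Hf : cyclic_faces E := E_cyclic_faces Hopf dense.
Let Hs : simplicial_degen E := E_simplicial_degen Hopf dense.
Let Hc : cyclic_degen E := E_cyclic_degen Hopf dense.
Let HsC : simplicial_degen C := C_simplicial_degen denseT.
Let HcC : cyclic_degen C := C_cyclic_degen denseT.

Lemma mix_b_norm n (x : C n.+1) : mix_b (nC n.+1 x : normalized C n.+1) = nC n (bdry C n x).
Proof. by apply: qmapE => v; apply: bdry_degenerate. Qed.

Lemma mix_B_norm n (x : C n) : mix_B (nC n x : normalized C n) = nC n.+1 (connes C n x).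
Proof. by apply: qmapE => v; apply: connes_degenerate. Qed.

Lemma Etau_degenerate n x : nE n x = 0 -> nC n (Etau n x) = 0.
Proof.
apply: qproj_map => {}x; case: n x => [//|n] x [j [y [jn ->]]].
by rewrite (Etau_s Hopf dense) //; apply: qproj_sub; exists j, (Etau n y).
Qed.

Lemma Etau_hact n h x : Etau n (hact n h x) = (ueps g h : k) *: Etau n x.
Proof.
have : lcomp (Etau n) (hact n h) =1 lscale (ueps g h : k) (Etau n); last by apply.
apply: tens_ext => a v; rewrite lscaleE [LHS]lcompE hactE.
have E b : Etau n (tpair b v) = (ueps g b : k) *: tau (udelta g) (ueps g) (uanti g) n v.
  by rewrite lcompE [epshead _ _ _]tliftE linearZZ.
by rewrite !E (epsM Hopf) scalerA.
Qed.

Lemma Etau_one n v : Etau n (tpair (aone U) v) = tau (udelta g) (ueps g) (uanti g) n v.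
Proof. by rewrite lcompE [epshead _ _ _]tliftE (eps1 Hopf) scale1r. Qed.

(** [Etau] turns the action of h into the scalar eps(h), so after it an H-linear map depends only on
    the coinvariant class of its argument. *)
Lemma Etau_coinv m n (F : {linear E m -> E n}) x :
  (forall h y, F (hact m h y) = hact n h (F y)) ->
  Etau n (F x) = Etau n (F (tpair (aone U) (epshead (ueps g) (tpow U m) x))).
Proof.
move=> FH.
have : lcomp (Etau n) F =1 lcomp (Etau n) (lcomp F (lcomp (tpairl _ (aone U)) (epshead (ueps g) _))).
  apply: tens_ext => h v; rewrite -[RHS]/(Etau n (F (tpair (aone U)
    (epshead (ueps g) (tpow U m) (tpair h v))))) -[LHS]/(Etau n (F (tpair h v))).
  rewrite [epshead _ _ _]tliftE -[tpair _ (_ *: _)]tpairlE !linearZZ tpairlE.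
  by rewrite -[h in LHS](@amul1r k U) -hactE FH Etau_hact.
by move=> /(_ x).
Qed.

Lemma epshead_bdry n (w : ext g n.+1) :
  epshead (ueps g) (tpow U n) (bdry E n (tpair (aone U) (emap g n.+1 w))) = emap g n (ce g n w).
Proof. by rewrite -bdry_BUg bdry_emap. Qed.

Lemma ecast_class n p (e : n = p) (x : E n) :
  ecast m (normalized C m) e (nC n (Etau n x)) =
  nC p (Etau p (Ecast (udelta g) (ueps g) (uanti g) e x)).
Proof. by case: p / e. Qed.

(** N (1 - t) = 0 makes B independent of the representative, so the one chosen by [Blambda] may be
    exchanged for x_0 ⊗ e(x_1, ..., x_n). *)
Lemma C_connes_quot n (x y : C n) :
  qproj (fun z : C n => exists u, z = u - cyc_t C n u) x =
  qproj (fun z : C n => exists u, z = u - cyc_t C n u) y -> connes C n x = connes C n y.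
Proof.
move=> /qproj_eq /(qproj_kills (F := connes C n)) H.
apply/eqP; rewrite -subr_eq0 -linearB H // => z [u ->].
rewrite connesE linearB /= (cnorm_cyclic (C_tt_id denseT (n := n))) subrr.
by rewrite !linear0 ?addr0.
Qed.

(** F is any map that vanishes as soon as some entry after the first is 1. The equation [e] lets the
    hypothesis speak of a nonzero length, so that it is empty for n = 0. *)
Lemma sw2_prim n (M : lmodType k) (F : {linear tens U (tpow U n) -> M}) (x : 'I_n -> g) :
  (forall p n' j (e : n'.+1 = n) z, (j <= n')%N ->
     F (tpair p (ecast m (tpow U m) e (tins U n' j z))) = 0) ->
  F (sw2 (udelta g) n (tpure (fun i => uinj (x i)))) =
  F (tpair (aone U) (tpure (fun i => uinj (x i)))).
Proof.
elim: n M F x => [//|n IH] M F x HF.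
rewrite tpureS [sw2 _ _ _]tliftE delta_prim linearD !tliftE linearD.
set y := sw2 _ _ _.
have -> : F (tmap (lmul (uinj (x ord0))) (tpairl (tpow U n) (aone U)) y) = 0.
  have : lcomp F (tmap (lmul (uinj (x ord0))) (tpairl (tpow U n) (aone U))) =1 lzero _ _.
    apply: tens_ext => p z; rewrite lcompE tmapE.
    by have := HF (lmul (uinj (x ord0)) p) n 0 erefl z (leq0n n); rewrite /= tins0.
  by apply.
have := IH M (lcomp F (tmap (lmul (aone U)) (tpairl (tpow U n) (uinj (x ord0)))))
   (fun i => x (lift ord0 i)).
rewrite !lcompE add0r => -> //; first by rewrite tmapE lmulE amul1l.
move=> p n' j e z jn; rewrite lcompE tmapE.
clear y; case: n / e IH F HF x => IH F HF x.
have := HF (lmul (aone U) p) n'.+1 j.+1 erefl (tpair (uinj (x ord0)) z) jn.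
by rewrite -[tins U n'.+1 j.+1]/(tmap (lid U) (tins U n' j)) /= tmapE.
Qed.

Lemma tau_esum n (x : 'I_n -> g) :
  nC n (tau (udelta g) (ueps g) (uanti g) n (esum x)) = nC n (tpair (aone U) (esum x)).
Proof.
rewrite -[LHS]/(lcomp (nC n) (tau (udelta g) (ueps g) (uanti g) n) (esum x)).
rewrite -[RHS]/(lcomp (nC n) (tpairl _ (aone U)) (esum x)) /esum !linear_sum.
apply: eq_bigr => s _; rewrite !linearZZ; congr (_ *: _).
rewrite -[RHS]/(nC n (tpair (aone U) (tpure (fun i => uinj (x (s i)))))).
rewrite -[LHS]/(nC n (tmap (uanti g) (lid (tpow U n)) (sw2 (udelta g) n (tpure (fun i => uinj (x (s i))))))).
have := sw2_prim (F := lcomp (nC n) (tmap (uanti g) (lid (tpow U n)))) (fun i => x (s i)).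
rewrite !lcompE => ->; first by rewrite tmapE (anti1 Hopf).
move=> p n' j e z jn; rewrite lcompE tmapE.
case: n / e {x s} => /=; apply: qproj_sub; exists j, (tpair (uanti g p) z); split=> //.
by rewrite (tmapE (lid U) (tins U n' j)).
Qed.

Lemma norm_connes n (x : C n) :
  nC n.+1 (connes C n x) = nC n.+1 (tpair (aone U) (cnorm C n x)).
Proof.
by rewrite connesE linearB /= (t_extra_degenerate HcC) subr0 (C_extra denseT).
Qed.

Lemma connes_lift n (w : ext g n) :
  nE n.+1 (connes E n (tpair (aone U) (emap g n w))) = 0.
Proof.
pose F := lcomp (nE n.+1) (lcomp (connes E n) (lcomp (tpairl _ (aone U)) (emap g n))).
have : F =1 lzero _ _; last by apply.
apply: ext_ext => y; rewrite -[LHS]/(nE n.+1 (connes E n (tpair (aone U)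
  (emap g n (wedge (fun i : 'I_n => y i)))))) emap_asym.
by apply: good_connes; exists y.
Qed.

End NormalizedChains.

(** * Chains of HN(U(g)) represented by families in E(U(g)) *)

Section NegativeCyclicChains.
Variables (k : comPzRingType) (g : lieAlgType k).
Local Notation U := (Ug g).
Local Notation E := (Ecyc (udelta g) (ueps g) (uanti g)).
Local Notation C := (CUg g).
Local Notation nC n := (qproj (@degenerate k C n)).
Local Notation Etau := (Etau (udelta g) (ueps g) (uanti g)).
Local Notation tau := (tau (udelta g) (ueps g) (uanti g)).
Local Notation cast e := (Ecast (udelta g) (ueps g) (uanti g) e).
Local Notation Ups j m := (Ups' (udelta g) (ueps g) (uanti g) j m).
Local Notation Upsd j m := (Upsd (udelta g) (ueps g) (uanti g) j m).
Local Notation Htp j m := (Htp (udelta g) (ueps g) (uanti g) j m).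
Local Notation Htpd j m := (Htpd (udelta g) (ueps g) (uanti g) j m).

Let Hopf := enveloping_hopf g.
Let dense := @Ug_gl_dense k g.
Let Hf : cyclic_faces E := E_cyclic_faces Hopf dense.
Let Hs : simplicial_degen E := E_simplicial_degen Hopf dense.
Let Hc : cyclic_degen E := E_cyclic_degen Hopf dense.

Definition lift_one n (w : ext g n) : E n := tpair (aone U) (emap g n w).

Definition HNclass n (a : forall j, E (j.*2 + n)%N) : HNUg_norm g n :=
  fun j => nC (j.*2 + n)%N (Etau (j.*2 + n)%N (a j)).

Lemma HNclass_ext n (a b : forall j, E (j.*2 + n)%N) :
  (forall j, nC (j.*2 + n)%N (Etau _ (a j)) = nC (j.*2 + n)%N (Etau _ (b j))) ->
  HNclass a = HNclass b.
Proof. by move=> e; apply/functional_extensionality_dep => j; apply: e. Qed.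

Lemma HNd_class n (a : forall j, E (j.*2 + n.+1)%N) :
  HNd (HNclass a) = HNclass (fun j => bdry E (j.*2 + n) (cast (addnS j.*2 n) (a j)) +
    match j return E (j.*2 + n)%N with
    | 0 => 0
    | i.+1 => connes E (i.*2 + n).+1 (cast (addnS i.*2 n) (a i))
    end).
Proof.
apply/functional_extensionality_dep => j; rewrite /HNd /HNshift /HNclass.
rewrite ecast_class mix_b_norm -(Etau_bdry Hopf dense) linearD.
rewrite linearD; congr (_ + _); case: j => [|i]; first by rewrite !linear0.
by rewrite ecast_class mix_B_norm -(Etau_connes Hopf dense).
Qed.

Lemma tau_degenerate n v : @degenerate k (BUg g) n v -> nC n (tau n v) = 0.
Proof.
case: n v => [//|n] v [j [y [jn ->]]].
rewrite -[tau n.+1 _]/(Etau n.+1 (cyc_s E n j (tpair (aone U) y))) (Etau_s Hopf dense) //.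
by apply: qproj_sub; exists j, (Etau n (tpair (aone U) y)).
Qed.

Lemma tau_psi_class n (w : ext g n) :
  tau_psi w = HNclass (fun j => match j return E (j.*2 + n)%N with
    | 0 => lift_one w
    | _ => 0
    end).
Proof.
apply/functional_extensionality_dep => -[|j]; rewrite /HNclass.
  rewrite -[LHS]/(qmap (@degenerate k C n) (tau n)
    (qproj (@degenerate k (BUg g) n) (emap g n w))).
  by rewrite (qmapE (tau_degenerate (n := n))) Etau_one.
rewrite -[LHS]/(qmap (@degenerate k C _) (tau (j.+1.*2 + n)) (0 : quot (@degenerate k (BUg g) _))).
rewrite -[0 in LHS](linear0 (qproj (@degenerate k (BUg g) _))).
by rewrite (qmapE (tau_degenerate (n := _))) !linear0.
Qed.

Lemma c_e_class n (w : ext g n) : c_e w = HNclass (fun j => Ups j n (lift_one w)).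
Proof. by []. Qed.

Lemma B_theta_tau_psi n (x : 'I_n.+1 -> g) : tau_psi (wedge x) = B_theta x.
Proof.
rewrite tau_psi_class; apply/functional_extensionality_dep => -[|j]; last first.
  by rewrite /HNclass -[RHS]/(nC _ 0) !linear0.
rewrite /HNclass -[RHS]/(nC n.+1 (connes C n (qrep (theta x)))) Etau_one emap_wedge.
rewrite tau_esum.
rewrite (@C_connes_quot k g n _ (tpair (uinj (x ord0)) (esum (fun i => x (lift ord0 i))))).
  by rewrite norm_connes cnorm_e.
by rewrite qrepK /theta emap_wedge.
Qed.

Lemma castK n p (e : n = p) (e' : p = n) (x : E n) : cast e' (cast e x) = x.
Proof. by case: p / e e' => e'; rewrite !cast_id. Qed.

Lemma Etau_bdry_lift n (w : ext g n.+1) :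
  Etau n (bdry E n (lift_one w)) = Etau n (lift_one (ce g n w)).
Proof. by rewrite Etau_one lcompE epshead_bdry. Qed.

Lemma HNd_tau_psi n (w : ext g n.+1) : HNd (tau_psi w) = tau_psi (ce g n w).
Proof.
rewrite !tau_psi_class HNd_class; apply: HNclass_ext => -[|[|j]].
- rewrite addr0 [cast _ _](cast_id (_ : n.+1 = n.+1)).
  by rewrite [Etau _ _]Etau_bdry_lift.
- rewrite [cast _ 0]linear0 linear0 add0r [RHS](_ : _ = 0); last by rewrite !linear0.
  apply: Etau_degenerate; rewrite [cast _ _](cast_id (_ : n.+1 = n.+1)).
  exact: connes_lift.
by congr (nC _ (Etau _ _)); rewrite !linear0 addr0.
Qed.

Lemma HNd_c_e n (w : ext g n.+1) : HNd (c_e w) = c_e (ce g n w).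
Proof.
rewrite !c_e_class HNd_class; apply: HNclass_ext => -[|i].
  rewrite addr0 [cast _ _](cast_id (_ : n.+1 = n.+1)).
  by rewrite [Etau _ _]Etau_bdry_lift.
set x := lift_one w; congr (nC _ _).
pose e1 : (i.*2 + n.+1).+1 = (i.*2 + n).+2 := congr1 succn (addnS i.*2 n).
rewrite [bdry _ _ _](cast_bdry e1) (cast_connes _ e1) -linearD.
transitivity (Etau _ (Ups i.+1 n (bdry E n x))).
  congr (Etau _ _); rewrite bdry_Ups // subrK.
  by rewrite [Upsd _ _ _]lcompE castK.
rewrite (Etau_coinv (F := Ups i.+1 n)); last by move=> h y; apply: hact_Ups.
by rewrite epshead_bdry.
Qed.

Definition hfun n (w : ext g n) : HNUg_norm g n.+1 :=
  HNclass (fun j => cast (esym (addnS j.*2 n)) (Htp j n (lift_one w))).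

Lemma hfun_linear n : linear (@hfun n).
Proof.
move=> a v w; apply/functional_extensionality_dep => j.
pose F := lcomp (nC _) (lcomp (Etau _) (lcomp (cast (esym (addnS j.*2 n)))
  (lcomp (Htp j n) (lcomp (tpairl _ (aone U)) (emap g n))))).
exact: (linearP F).
Qed.

(** The formula is stated on a single wedge because [good] describes single antisymmetrized tensors,
    not their sums. *)
Lemma homotopy_formula n (y : nat -> g) (w := wedge (fun i : 'I_n.+1 => y i)) :
  c_e w - tau_psi w = HNd (hfun w) + hfun (ce g n w).
Proof.
rewrite c_e_class tau_psi_class HNd_class; apply/functional_extensionality_dep => -[|i].
  (* In component 0 both chains are the class of 1 ⊗ e(w), since Upsilon'^0 = 1, and the homotopy
     contributes nothing, since K^0 = 0. *)
  rewrite -[LHS]/(nC n.+1 (Etau n.+1 (lift_one w)) - nC n.+1 (Etau n.+1 (lift_one w))).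
  rewrite subrr; symmetry.
  set z := (X in HNclass X + _); rewrite -[LHS]/(HNclass z 0 + hfun (ce g n w) 0).
  rewrite /HNclass /z addr0 castK !linear0 add0r.
  rewrite /hfun /HNclass [Htp 0 n _](_ : _ = 0) //.
  by rewrite [cast _ 0]linear0 !linear0.
set x := lift_one w.
pose c := nC (i.+1.*2 + n.+1)%N; pose t := Etau (i.+1.*2 + n.+1)%N.
pose F := lcomp (cast (esym (addnS i.+1.*2 n))) (Htp i.+1 n).
transitivity (c (t (Ups i.+1 n.+1 x)) - c (t 0)); first by [].
transitivity (c (t (bdry E (i.+1.*2 + n.+1) (cast (addnS i.+1.*2 n.+1)
     (cast (esym (addnS i.+1.*2 n.+1)) (Htp i.+1 n.+1 x))) +
   connes E (i.*2 + n.+1).+1 (cast (addnS i.*2 n.+1)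
     (cast (esym (addnS i.*2 n.+1)) (Htp i n.+1 x))))) +
   c (t (F (lift_one (ce g n w))))); last by [].
rewrite !castK.
(* Replaces 1 ⊗ e(dw) by d'(1 ⊗ e(w)), which has the same coinvariant class; the result is the term
   K^(i+1) d' of the homotopy recursion. *)
have -> : t (F (lift_one (ce g n w))) = t (Htpd i n.+1 x).
  rewrite /t /lift_one -epshead_bdry -Etau_coinv.
    by congr (Etau _ _); rewrite [Htpd _ _ _]lcompE lcompE; apply: cast_irr.
  by move=> h z; rewrite lcompE hact_Htp cast_hact.
have gx : good (emap g n.+1 w) by exists y; apply: emap_asym.
have := defect0 Hf Hs Hc (@good_connes k g) (@good_bdry k g) i (aone U) gx.
rewrite hact1 -/(lift_one w) -/x defectE => /Etau_degenerate.
have abs (V W Q : lmodType k) (f : {linear V -> W}) (q : {linear W -> Q}) (b u d e : V) :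
    q (f (b - (u - d - e))) = 0 -> q (f u) - q (f 0) = q (f (b + e)) + q (f d).
  move=> H; rewrite linear0 linear0 subr0 -[RHS]linearD -linearD.
  have E0 : b + e + d - u = b - (u - d - e) by rewrite !opprB !addrA.
  by apply/esym/eqP; rewrite -subr_eq0 -!linearB E0 H.
exact: abs.
Qed.

End NegativeCyclicChains.

(** * Naturality *)

Section HopfMaps.
Variables (k : comPzRingType) (H H' : assocAlgType k) (X : Type).
Variables (Delta : {linear H -> tens H H}) (eps : {linear H -> k^o}).
Variable S : {linear H -> H}.
Variables (Delta' : {linear H' -> tens H' H'}) (eps' : {linear H' -> k^o}).
Variable S' : {linear H' -> H'}.
Hypothesis Hopf : cocommutative_hopf Delta eps S.
Hypothesis Hopf' : cocommutative_hopf Delta' eps' S'.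
Hypothesis dense : gl_dense X Delta eps.
Variable phi : {linear H -> H'}.

Record hopf_map : Prop := HopfMap {
  hopf_mapM : forall a b, phi (amul a b) = amul (phi a) (phi b);
  hopf_map1 : phi (aone H) = aone H';
  hopf_map_delta : forall a, Delta' (phi a) = tmap phi phi (Delta a);
  hopf_map_eps : forall a, eps' (phi a) = eps a;
  hopf_map_anti : forall a, S' (phi a) = phi (S a) }.
Hypothesis Hphi : hopf_map.

Local Notation P := (seq X -> H).
Local Notation gl := (@grouplike k H X Delta eps).
Local Notation E := (Ecyc Delta eps S).
Local Notation E' := (Ecyc Delta' eps' S').
Local Notation Phi n := (tpowmap phi n).
Let push (u : nat -> P) : nat -> seq X -> H' := fun i w => phi (u i w).

Lemma tpowmapS n a v : Phi n.+1 (tpair a v) = tpair (phi a) (Phi n v).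
Proof. exact: tmapE. Qed.

Let tpowmap_ptens n u w : Phi n (ptens n u w) = ptens n (push u) w.
Proof.
elim: n u w => [|n IH] u w; first by case: w => [|x w] //=.
rewrite ptensS -[Phi n.+1]/(tmap phi (Phi n)) tmap_conv [in RHS]ptensS.
by apply: eq_usum => a b; rewrite IH.
Qed.

(** Both sides of each naturality square are linear on tensor powers of H, so they are compared on
    grouplike points of H, whose images in H' are grouplike again. *)
Let gl_push u : (forall i, gl (u i)) -> forall i, grouplike Delta' eps' (push u i).
Proof.
move=> gu i; split=> [w|w|].
- by rewrite (hopf_map_delta Hphi) (gl_delta (gu i)) tmap_conv.
- by rewrite (hopf_map_eps Hphi) (gl_eps (gu i)).
by rewrite /push (gl_nil (gu i)) (hopf_map1 Hphi).
Qed.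

Let push_mul (u v : P) : pmul (fun w => phi (u w)) (fun w => phi (v w)) =
  fun w => phi (pmul u v w).
Proof.
apply/funext => w; rewrite /pmul linear_conv.
by apply: eq_usum => a b; rewrite (hopf_mapM Hphi).
Qed.

Let push_inv (u : P) : pinv S' (fun w => phi (u w)) = fun w => phi (pinv S u w).
Proof. by apply/funext => w; rewrite /pinv (hopf_map_anti Hphi). Qed.

Let tpowmap_htens n u w : Phi n.+1 (htens S n u w) = htens S' n (push u) w.
Proof.
rewrite tpowmap_ptens; congr (_ w); apply: ptens_ext => -[|j] _ //=.
by rewrite [pinv _ _]push_inv [pmul _ _]push_mul.
Qed.

Lemma tpowmap_d n i x : (i <= n.+1)%N ->
  Phi n.+1 (cyc_d E n i x) = cyc_d E' n i (Phi n.+2 x).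
Proof.
move=> le; refine (@htens_dense _ _ X _ _ _ Hopf dense n.+1 _ (lcomp (Phi n.+1) (cyc_d E n i))
  (lcomp (cyc_d E' n i) (Phi n.+2)) _ x) => u gu w.
rewrite [LHS]lcompE [RHS]lcompE E_d // !tpowmap_htens (E_d Hopf') //.
exact: gl_push.
Qed.

Lemma tpowmap_s n i x : (i <= n)%N ->
  Phi n.+2 (cyc_s E n i x) = cyc_s E' n i (Phi n.+1 x).
Proof.
move=> le; refine (@htens_dense _ _ X _ _ _ Hopf dense n _ (lcomp (Phi n.+2) (cyc_s E n i))
  (lcomp (cyc_s E' n i) (Phi n.+1)) _ x) => u gu w.
rewrite [LHS]lcompE [RHS]lcompE E_s // !tpowmap_htens (E_s Hopf') //.
exact: gl_push.
Qed.

Lemma tpowmap_t n x : Phi n.+1 (cyc_t E n x) = cyc_t E' n (Phi n.+1 x).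
Proof.
refine (@htens_dense _ _ X _ _ _ Hopf dense n _ (lcomp (Phi n.+1) (cyc_t E n))
  (lcomp (cyc_t E' n) (Phi n.+1)) _ x) => u gu w.
rewrite [LHS]lcompE [RHS]lcompE E_t // [LHS]linearZZ !tpowmap_htens (E_t Hopf') //.
exact: gl_push.
Qed.

Lemma tpowmap_Etau n x :
  Phi n.+1 (Etau Delta eps S n x) = Etau Delta' eps' S' n (Phi n.+1 x).
Proof.
refine (@htens_dense _ _ X _ _ _ Hopf dense n _ (lcomp (Phi n.+1) (Etau Delta eps S n))
  (lcomp (Etau Delta' eps' S' n) (Phi n.+1)) _ x) => u gu w.
rewrite [LHS]lcompE [RHS]lcompE (Etau_ptens Hopf) // tpowmap_htens (Etau_ptens Hopf'); last exact: gl_push.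
rewrite tpowmap_ptens; congr (_ w); apply: ptens_ext => -[|j] _ /=;
  by rewrite [pinv _ _]push_inv [pmul _ _]push_mul.
Qed.

Lemma tpowmap_bdry n x : Phi n.+1 (bdry E n x) = bdry E' n (Phi n.+2 x).
Proof.
rewrite !bdryE linear_sum; apply: eq_bigr => i _.
by rewrite linearZZ tpowmap_d // -ltnS.
Qed.

Lemma tpowmap_connes n x : Phi n.+2 (connes E n x) = connes E' n (Phi n.+1 x).
Proof.
have N : Phi n.+1 (cnorm E n x) = cnorm E' n (Phi n.+1 x).
  rewrite !cnormE linear_sum; apply: eq_bigr => i _.
  by elim: (i : nat) => [//|j IH]; rewrite !iterS tpowmap_t IH.
have X' y : Phi n.+2 (extra E n y) = extra E' n (Phi n.+1 y).
  by rewrite !extraE linearZZ tpowmap_t tpowmap_s.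
by rewrite !connesE linearB tpowmap_t X' N.
Qed.

Lemma tpowmap_hact n h x : Phi n.+1 (hact n h x) = hact n (phi h) (Phi n.+1 x).
Proof.
have : lcomp (Phi n.+1) (hact n h) =1 lcomp (hact n (phi h)) (Phi n.+1); last by apply.
apply: tens_ext => a z; rewrite [LHS]lcompE [RHS]lcompE hactE !tpowmapS hactE.
by rewrite (hopf_mapM Hphi).
Qed.

Lemma tpowmap_one n v : Phi n.+1 (tpair (aone H) v) = tpair (aone H') (Phi n v).
Proof. by rewrite tpowmapS (hopf_map1 Hphi). Qed.

Lemma tpowmap_cast n p (e : n = p) x :
  Phi p.+1 (Ecast Delta eps S e x) = Ecast Delta' eps' S' e (Phi n.+1 x).
Proof. by case: p / e. Qed.

Lemma tpowmap_Es n x :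
  Phi n.+2 (Es Delta eps S n x) = Es Delta' eps' S' n (Phi n.+1 x).
Proof. exact: (@tpowmap_one n.+1). Qed.

Lemma tpowmap_hlinear m n (F : {linear E m -> E n}) (F' : {linear E' m -> E' n}) :
  (forall h x, F (hact m h x) = hact n h (F x)) ->
  (forall h x, F' (hact m h x) = hact n h (F' x)) ->
  (forall v, Phi n.+1 (F (tpair (aone H) v)) = F' (tpair (aone H') (Phi m v))) ->
  forall x, Phi n.+1 (F x) = F' (Phi m.+1 x).
Proof.
move=> FH FH' FF x.
refine (@E_ext _ _ Delta eps S m _ (lcomp (Phi n.+1) F) (lcomp F' (Phi m.+1)) _ x) => h v.
by rewrite [LHS]lcompE [RHS]lcompE FH !tpowmap_hact FH' FF tpowmap_one.
Qed.

Local Notation Ups j m := (Defs.Ups' Delta eps S j m).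
Local Notation Ups' j m := (Defs.Ups' Delta' eps' S' j m).
Local Notation Upsd' j m := (Upsd Delta' eps' S' j m).
Local Notation Upsd j m := (Upsd Delta eps S j m).
Local Notation Htp' j m := (Htp Delta' eps' S' j m).
Local Notation Htp j m := (Htp Delta eps S j m).
Local Notation Htpd' j m := (Htpd Delta' eps' S' j m).
Local Notation Htpd j m := (Htpd Delta eps S j m).

Lemma tpowmap_Ups j m x : Phi (j.*2 + m).+1 (Ups j m x) = Ups' j m (Phi m.+1 x).
Proof.
elim: j m x => [//|j IHj].
have step m : (forall x, Phi (j.*2 + m).+2 (Upsd j m x) = Upsd' j m (Phi m.+1 x)) ->
    forall x, Phi (j.+1.*2 + m).+1 (Ups j.+1 m x) = Ups' j.+1 m (Phi m.+1 x).
  move=> dm; apply: tpowmap_hlinear => [h x|h x|v]; [exact: hact_Ups | exact: hact_Ups |].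
  rewrite !UpsS -tpowmap_one.
  rewrite [LHS]tpowmap_Es; apply: (congr1 (Es Delta' eps' S' (j.*2 + m).+1)).
  by rewrite [LHS]linearB dm -IHj -tpowmap_connes.
elim=> [|m IHm]; apply: step => x; first by rewrite [LHS]linear0.
by rewrite [LHS]tpowmap_cast [X in Ecast _ _ _ _ X]IHm [X in Ups' _ _ X]tpowmap_bdry.
Qed.

Lemma tpowmap_Htp j m x : Phi (j.*2 + m).+2 (Htp j m x) = Htp' j m (Phi m.+1 x).
Proof.
elim: j m x => [|j IHj]; first by move=> m x; rewrite [LHS]linear0.
have step m : (forall x, Phi (j.*2 + m).+3 (Htpd j m x) = Htpd' j m (Phi m.+1 x)) ->
    forall x, Phi (j.+1.*2 + m).+2 (Htp j.+1 m x) = Htp' j.+1 m (Phi m.+1 x).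
  move=> dm; apply: tpowmap_hlinear => [h x|h x|v]; [exact: hact_Htp | exact: hact_Htp |].
  rewrite !HtpS -tpowmap_one.
  rewrite [LHS]tpowmap_Es; apply: (congr1 (Es Delta' eps' S' (j.*2 + m).+2)).
  by rewrite [LHS]linearB [X in X - _]linearB dm [X in X - _ - _]tpowmap_Ups -IHj -tpowmap_connes.
elim=> [|m IHm]; apply: step => x; first by rewrite [LHS]linear0.
by rewrite [LHS]tpowmap_cast [X in Ecast _ _ _ _ X]IHm [X in Htp' _ _ X]tpowmap_bdry.
Qed.

End HopfMaps.

Section Naturality.
Variables (k : comPzRingType) (g g' : lieAlgType k) (f : lieHom g g').
Local Notation U := (Ug g).
Local Notation U' := (Ug g').
Local Notation phi := (umap f : {linear U -> U'}).

Lemma umap_one : phi (aone U) = aone U'.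
Proof. exact: pliftE. Qed.

Lemma umapX x a : phi (amul (uinj x) a) = amul (uinj (f x)) (phi a).
Proof.
have : lcomp phi (lmul (uinj x)) =1 lcomp (lmul (uinj (f x))) phi; last by apply.
apply: (@pres_ext _ _ _ _ (lcomp _ _) (lcomp _ _)); try exact: linearP.
move=> w; rewrite !lcompE !lmulE -/(uword w) -uword_cons.
by rewrite -[umap f (uword _)]/(plift _ (pgen _ _)) pliftE
  -[umap f (uword _)]/(plift _ (pgen _ _)) pliftE -uword_cons.
Qed.

Lemma umap_uinj x : phi (uinj x) = uinj (f x).
Proof. by rewrite -[uinj x](@amul1r k U) umapX umap_one amul1r. Qed.

Lemma umap_hopf : hopf_map (udelta g) (ueps g) (uanti g)
  (udelta g') (ueps g') (uanti g') phi.
Proof.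
have M a b : phi (amul a b) = amul (phi a) (phi b).
  have : lcomp phi (rmul b) =1 lcomp (rmul (phi b)) phi; last by apply.
  apply: Ug_ext => [|x c]; rewrite !lcompE -![rmul _ _]/(amul _ _).
    by rewrite umap_one !amul1l.
  by move=> IH; rewrite -amulA !umapX IH amulA.
split=> //; first exact: umap_one.
- move=> a; have : lcomp (udelta g') phi =1 lcomp (tmap phi phi) (udelta g); last by apply.
  apply: Ug_ext => [|x c]; rewrite !lcompE.
    by rewrite umap_one [udelta g' _]uact_one [udelta g _]uact_one tmapE umap_one.
  move=> IH; rewrite umapX !deltaX IH; elim/tens_ind: (udelta g c) => [|r p q z IHz].
    by rewrite !udelta_actE !(amul2_lin, linear0).
  rewrite (linearP (tmap phi phi)) !(proj2 (udelta_bilin _)) IHz (linearP (tmap phi phi)).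
  congr (_ *: _ + _); rewrite tmapE /udelta_act (linearD (tmap phi phi)) !tmapE.
  by rewrite !lmulE !umapX.
- move=> a; have : lcomp (ueps g') phi =1 ueps g; last by apply.
  apply: Ug_ext => [|x c]; rewrite !lcompE.
    by rewrite umap_one [ueps g' _]uact_one [ueps g _]uact_one.
  by move=> _; rewrite umapX !epsX.
move=> a; have : lcomp (uanti g') phi =1 lcomp phi (uanti g); last by apply.
apply: Ug_ext => [|x c]; rewrite !lcompE.
  by rewrite umap_one [uanti g' _]uact_one [uanti g _]uact_one umap_one.
by move=> IH; rewrite umapX !antiX IH linearN M umap_uinj.
Qed.

Let Hopf := enveloping_hopf g.
Let Hopf' := enveloping_hopf g'.
Let dense := @Ug_gl_dense k g.
Local Notation nC' n := (qproj (@degenerate k (CUg g') n)).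

(** C(U(g)) and E(U(g)) have the same degeneracies by definition, so the square is inherited from
    E(U(g)). *)
Lemma tpowmap_ins n j z : (j <= n)%N ->
  tpowmap phi n.+2 (cyc_s (CUg g) n j z) = cyc_s (CUg g') n j (tpowmap phi n.+1 z).
Proof. exact: (tpowmap_s Hopf Hopf' dense umap_hopf). Qed.

Lemma tpowmap_degenerate n v : @degenerate k (CUg g) n v ->
  nC' n (tpowmap phi n.+1 v) = 0.
Proof.
case: n v => [//|n] v [j [z [jn ->]]]; rewrite tpowmap_ins //.
by apply: qproj_sub; exists j, (tpowmap phi n.+1 z).
Qed.

Lemma tpowmap_tpure n (x : 'I_n -> U) :
  tpowmap phi n (tpure x) = tpure (fun i => phi (x i)).
Proof. by elim: n x => [//|n IH] x; rewrite !tpureS tpowmapS IH. Qed.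

Lemma tpowmap_emap n (w : ext g n) :
  tpowmap phi n (emap g n w) = emap g' n (extmap f n w).
Proof.
have : lcomp (tpowmap phi n) (emap g n) =1 lcomp (emap g' n) (extmap f n); last by apply.
apply: ext_ext => y; rewrite [LHS]lcompE [RHS]lcompE emap_wedge [extmap _ _ _]pliftE emap_wedge.
rewrite /esum linear_sum; apply: eq_bigr => s _; rewrite linearZZ tpowmap_tpure.
by congr (_ *: _); apply: tpure_ext => i; apply: umap_uinj.
Qed.

Lemma hfun_natural n (w : ext g n) : HNUg_map f (hfun w) = hfun (extmap f n w).
Proof.
apply/functional_extensionality_dep => j; rewrite /HNUg_map /HNmap /hfun /HNclass.
rewrite (qmapE (tpowmap_degenerate (n := _))); congr (nC' _ _).
rewrite [LHS](tpowmap_Etau Hopf Hopf' dense umap_hopf); congr (Etau _ _ _ _ _).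
rewrite [LHS](@tpowmap_cast _ _ _ _ _ _ (udelta g') (ueps g') (uanti g')).
congr (Ecast _ _ _ _ _).
rewrite [LHS](tpowmap_Htp Hopf Hopf' dense umap_hopf); congr (Htp _ _ _ _ _ _).
by rewrite [LHS](tpowmap_one umap_hopf) tpowmap_emap.
Qed.

End Naturality.
Theorem theorem4p2p2 (k : comPzRingType) :
  (forall g : lieAlgType k,
     [/\ forall n (x : 'I_n.+1 -> g), tau_psi (wedge x) = B_theta x,
         chain_map (@tau_psi k g)
       & chain_map (@c_e k g)]) /\
  (exists h : forall (g : lieAlgType k) (n : nat),
       {linear ext g n.+1 -> HNUg_norm g n.+2},
     natural1 h /\
     forall g : lieAlgType k,
       (forall x : 'I_1 -> g,
          c_e (wedge x) - B_theta x = HNd (h g 0%N (wedge x))) /\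
       (forall (n : nat) (x : 'I_n.+2 -> g),
          c_e (wedge x) - B_theta x =
          HNd (h g n.+1 (wedge x)) + h g n (ce g n.+1 (wedge x)))).
Proof.
have tau_psi_linear (g : lieAlgType k) n : linear (@tau_psi k g n).
  move=> a v w; rewrite !tau_psi_class; apply/functional_extensionality_dep => j.
  pose F := lcomp (qproj (@degenerate k (CUg g) (j.*2 + n)))
    (Etau (udelta g) (ueps g) (uanti g) (j.*2 + n)).
  pose G : {linear ext g n -> Ecyc (udelta g) (ueps g) (uanti g) (j.*2 + n)} :=
    match j with
    | 0 => lcomp (tpairl _ (aone (Ug g))) (emap g n)
    | _ => lzero _ _
    end.
  by rewrite /HNclass; case: j @F @G => [|j] F G; apply: (linearP (lcomp F G)).
have c_e_linear (g : lieAlgType k) n : linear (@c_e k g n).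
  move=> a v w; rewrite !c_e_class; apply/functional_extensionality_dep => j.
  exact: (linearP (lcomp (qproj (@degenerate k (CUg g) (j.*2 + n)))
    (lcomp (Etau (udelta g) (ueps g) (uanti g) (j.*2 + n))
      (lcomp (Ups' (udelta g) (ueps g) (uanti g) j n)
        (lcomp (tpairl _ (aone (Ug g))) (emap g n)))))).
have chain (g : lieAlgType k) (F : forall n, ext g n -> HNUg_norm g n) :
    (forall n, linear (F n)) ->
    (forall n (w : ext g n.+1), HNd (F n.+1 w) = F n (ce g n w)) -> chain_map F.
  move=> Flin Fd; split=> // w.
  (* In degree 1 the uniform formula holds with [ce g 0], which is 0. *)
  by rewrite Fd; apply: (linear0 (mklin (Flin 0%N))).
split=> [g | ].
  split=> [n x||]; first exact: B_theta_tau_psi.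
    by apply: chain => // n w; apply: HNd_tau_psi.
  by apply: chain => // n w; apply: HNd_c_e.
(* [hfun] is also defined on the exterior power of degree 0; the witness keeps its positive
   degrees. *)
exists (fun g n => mklin (@hfun_linear k g n.+1)); split=> [g g' f n w | g].
  exact: hfun_natural.
have H n (x : 'I_n.+1 -> g) : c_e (wedge x) - B_theta x =
    HNd (hfun (wedge x)) + hfun (ce g n (wedge x)).
  rewrite -B_theta_tau_psi (_ : x = fun i : 'I_n.+1 => x (inord i)).
    exact: (@homotopy_formula k g n (fun i => x (inord i))).
  by apply/funext => i; rewrite inord_val.
split=> [x | n x]; last exact: H.
(* The extra summand is [hfun] of a value of [ce g 0], hence of 0. *)
by rewrite H -[RHS]addr0; congr (_ + _); apply: (linear0 (mklin (@hfun_linear k g 0))).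
Qed.
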